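(* Let $n=2k+1$ be an odd integer with $k\ge 1$, and let $D_n$ be the dihedral group of order $2n$. Let $b>1$ be an integer, let $K=\{p_1,\dots,p_b\}\subset S^2$ be a set of $b$ distinct points, let $N(K)$ be a union of sufficiently small disjoint disks forming a tubular neighborhood of $K$, and let $E(K)=S^2\setminus \mathrm{int}(N(K))$, so that $\pi_1(E(K))$ is a free group $F_\ell$ of rank $\ell=b-1$. Let $\phi:\pi_1(E(K))=F_\ell\to D_n$ be a group homomorphism, and let $M$ be the associated $n$-fold branched cover of $S^2$ branched along $K$. Then there is an immersed braiding $$f: M\to S^2\times\left([0,n+1]\times[-1,1]\right).$$ In particular, $f$ is a continuous, general position map whose restriction to the part of $M$ lying over the exterior $E(K)$ is an immersion, and the composition $p_1\circ f: M\to S^2$ of $f$ with the projection $p_1$ onto the factor $S^2$ is the branched covering map.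
   Context: The dihedral group $D_n=\langle r,x : r^2=x^n=(xr)^2=1\rangle$ is regarded as a subgroup of the symmetric group $\Sigma_n$ via its action on the $n$ vertices of a regular $n$-gon. The $n$-fold (irregular, possibly disconnected) cover of $E(K)$ associated to $\phi$ is the covering whose monodromy is $\pi_1(E(K))\to D_n\subset\Sigma_n$. The associated branched cover $M\to S^2$ is obtained by extending this covering over $N(K)$ in the standard way: over the disk around $p_i$, each boundary circle that covers the meridian circle with degree $d$ is filled by a disk mapping as $z\mapsto z^d$. A folding of $M$ is a continuous map $g:M\to S^2\times[0,n+1]$ such that (1) away from a neighborhood of the branch set, $g$ is a general position immersion, and (2) the composition of $g$ with the projection onto $S^2$ is the branched covering map. Here ''general position immersion'' of a surface in 3-space means an immersion each of whose multiple points has a neighborhood in which the image is locally modeled on $\{xy=0\}\subset\mathbb{R}^3$ (double points) or $\{xyz=0\}\subset\mathbb{R}^3$ (triple points). An immersed braiding of $M$ is a continuous map $f:M\to S^2\times[0,n+1]\times[-1,1]$ that is a lift of a folding (its composition with the projection to $S^2\times[0,n+1]$ is a folding), such that away from a neighborhood of the branch set $f$ is a general position immersion (its only multiple points there are isolated transverse double points), and such that the composition with the projection onto $S^2$ is the branched covering map. *)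

(* Defs.v *)
From HB Require Import structures.
From mathcomp Require Import all_boot all_order all_algebra all_fingroup.
From mathcomp Require Import all_classical all_reals all_analysis.
From mathcomp Require Import complex lra homotopy.
Set Implicit Arguments.
Unset Strict Implicit.
Unset Printing Implicit Defensive.
Import Order.TTheory GRing.Theory Num.Theory numFieldNormedType.Exports.
Local Open Scope classical_set_scope.
Local Open Scope ring_scope.

(* The type `unitI R` is the interval [0,1], as a bipointed space, so that
   `{path unitI R from x to x}` is the type of loops at x. *)
Section unit_interval.
Context (R : realType).

Definition unitI : Type := `[0 : R, 1]%classic.
HB.instance Definition _ := Topological.on unitI.

Definition clamp_def (x : R) : R := Num.max 0 (Num.min 1 x).
Lemma clamp_subproof x : clamp_def x \in `[0 : R, 1]%classic.
Proof. by rewrite inE /= in_itv /= /clamp_def le_max lexx ge_max ler01 ge_min lexx. Qed.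

Definition clamp (x : R) : unitI := SigSub (clamp_subproof x).
Definition coord (t : unitI) : R := set_val t.

Lemma coord_itv t : 0 <= coord t <= 1.
Proof. by have := valP t; rewrite inE /= in_itv. Qed.

Lemma clampE x : coord (clamp x) = Num.max 0 (Num.min 1 x).
Proof. by []. Qed.

Lemma clamp_id x : 0 <= x <= 1 -> coord (clamp x) = x.
Proof. by move=> /andP[x0 x1]; rewrite clampE (min_idPr x1) (max_idPr x0). Qed.

Lemma coord_inj : injective coord.
Proof. by move=> s t st; apply: val_inj. Qed.

Lemma coordK : cancel coord clamp.
Proof.
by move=> t; apply: coord_inj; rewrite clamp_id // coord_itv.
Qed.

Lemma continuous_coord : continuous coord.
Proof. exact: initial_continuous. Qed.

Lemma continuous_clamp : continuous clamp.
Proof.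
apply: continuous_comp_initial => x.
rewrite /comp /=; apply: continuous_max; first exact: cvg_cst.
by apply: continuous_min; [exact: cvg_cst|exact: cvg_id].
Qed.

Lemma clamp01 : clamp 0 != clamp 1.
Proof.
by apply/eqP => /(congr1 coord); rewrite !clamp_id ?lexx ?ler01 // => /eqP;
  rewrite eq_sym oner_eq0.
Qed.

HB.instance Definition _ := isBiPointed.Build unitI clamp01.

End unit_interval.

Section fundamental_group.
Context {R : realType} {X : topologicalType}.
Local Notation I := (unitI R).

Lemma zeroE : zero = clamp 0 :> I. Proof. by []. Qed.
Lemma oneE : one = clamp 1 :> I. Proof. by []. Qed.

(* Homotopy relative to the endpoints; the deformation parameter is [z.1]. *)
Definition homotopic (x y : X) (p q : {path I from x to y}) : Prop :=
  exists H : I * I -> X, [/\ continuous H,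
    (forall t, H (zero, t) = p t), (forall t, H (one, t) = q t),
    (forall s, H (s, zero) = x) & (forall s, H (s, one) = y)].

Lemma glue_continuous (T : topologicalType) (u : T -> R) (c : R) (f g : T -> X) :
  continuous u -> continuous f -> continuous g ->
  (forall t, u t = c -> f t = g t) ->
  continuous (fun t => if u t <= c then f t else g t).
Proof.
move=> cu cf cg fg t U /=; case: (ltgtP (u t) c) => utc Ut;
  change (\forall s \near t, U (if u s <= c then f s else g s)).
- have Uf := cf t _ Ut.
  have Uu : \forall s \near t, u s < c.
    exact: (cvgr_lt _ (cu t)).
  near=> s; rewrite /=; have /ltW -> : u s < c by near: s.
  by near: s.
- have Ug := cg t _ Ut.
  have Uu : \forall s \near t, c < u s.
    exact: (cvgr_gt _ (cu t)).
  near=> s; rewrite /= leNgt; have -> /= : c < u s by near: s.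
  by near: s.
- have Uf := cf t _ Ut; have Ut' : nbhs (g t) U by rewrite -fg.
  have Ug := cg t _ Ut'.
  near=> s; rewrite /=; have Ufs : U (f s) by near: s.
  have Ugs : U (g s) by near: s.
  by case: ifP.
Unshelve. all: by end_near. Qed.

Lemma continuous_pair (S T U : topologicalType) (f : S -> T) (g : S -> U) z :
  {for z, continuous f} -> {for z, continuous g} ->
  {for z, continuous (fun z => (f z, g z))}.
Proof. by move=> cf cg; exact: (cvg_pair (f := f) (g := g)). Qed.

Variable x : X.
Local Notation loop := {path I from x to x}.

Lemma homotopic_refl (p : loop) : homotopic p p.
Proof.
exists (p \o snd); split => //= [|s|s]; rewrite ?path_zero ?path_one //.
by move=> z; apply: continuous_comp; [exact: cvg_snd|exact: cts_fun].
Qed.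

Lemma homotopic_reparam (a p q : loop) (r0 r1 : R -> R) :
  continuous r0 -> continuous r1 -> r0 0 = r1 0 -> r0 1 = r1 1 ->
  (forall t, p t = a (clamp (r0 (coord t)))) ->
  (forall t, q t = a (clamp (r1 (coord t)))) -> homotopic p q.
Proof.
move=> c0 c1 r00 r11 pE qE.
exists (fun z : I * I => a (clamp ((1 - coord z.1) * r0 (coord z.2)
                                  + coord z.1 * r1 (coord z.2)))); split => /=.
- move=> z.
  pose u (z : I * I) : R :=
    (1 - coord z.1) * r0 (coord z.2) + coord z.1 * r1 (coord z.2).
  suff cu : {for z, continuous u}.
    apply: (@continuous_comp _ _ _ (@clamp R \o u) a); last exact: cts_fun.
    by apply: continuous_comp => //; exact: continuous_clamp.
  have cc1 : {for z, continuous (fun z : I * I => coord z.1 : R)}.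
    by apply: (@continuous_comp _ _ _ fst); [exact: cvg_fst|exact: continuous_coord].
  have cc2 r : continuous r -> {for z, continuous (fun z : I * I => r (coord z.2) : R)}.
    move=> cr; apply: (@continuous_comp _ _ _ (@coord R \o snd) r); last exact: cr.
    by apply: continuous_comp; [exact: cvg_snd|exact: continuous_coord].
  apply: continuousD; apply: continuousM => //; try exact: cc2.
  by apply: continuousB => //; exact: cvg_cst.
- by move=> t; rewrite zeroE clamp_id ?lexx ?ler01 // subr0 mul1r mul0r addr0 pE.
- by move=> t; rewrite oneE clamp_id ?lexx ?ler01 // subrr mul1r mul0r add0r qE.
- move=> s; rewrite zeroE (@clamp_id _ 0) ?lexx ?ler01 // r00 -mulrDl subrK mul1r.
  by rewrite -r00 -[RHS](path_zero (s := p)) pE zeroE clamp_id ?lexx ?ler01.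
- move=> s; rewrite oneE (@clamp_id _ 1) ?lexx ?ler01 // r11 -mulrDl subrK mul1r.
  by rewrite -r11 -[RHS](path_one (s := p)) pE oneE clamp_id ?lexx ?ler01.
Qed.


Lemma homotopic_sym (p q : loop) : homotopic p q -> homotopic q p.
Proof.
move=> [H [cH H0 H1 Hx Hy]].
exists (fun z => H (clamp (1 - coord z.1), z.2)); split => //=; last first.
- by move=> t; rewrite -H0 oneE (@clamp_id _ 1) ?lexx ?ler01 // subrr.
- by move=> t; rewrite -H1 zeroE (@clamp_id _ 0) ?lexx ?ler01 // subr0.
move=> z; pose u (z : I * I) : I * I := (clamp (1 - coord z.1), z.2).
apply: (@continuous_comp _ _ _ u H); last exact: cH.
apply: continuous_pair; last exact: cvg_snd.
apply: (@continuous_comp _ _ _ (fun z : I * I => 1 - coord z.1 : R) (@clamp R));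
  last exact: continuous_clamp.
apply: continuousB; first exact: cvg_cst.
by apply: (@continuous_comp _ _ _ fst); [exact: cvg_fst|exact: continuous_coord].
Qed.

Lemma homotopic_trans (p q r : loop) :
  homotopic p q -> homotopic q r -> homotopic p r.
Proof.
move=> [H [cH H0 H1 Hx Hy]] [K [cK K0 K1 Kx Ky]].
have cc (u : R -> R) : continuous u -> continuous
    (fun z : I * I => (clamp (u (coord z.1)), z.2) : I * I).
  move=> cu z.
  apply: (@continuous_pair _ _ _ (fun z : I * I => clamp (u (coord z.1))) snd); last exact: cvg_snd.
  apply: (@continuous_comp _ _ _ (fun z : I * I => u (coord z.1)) (@clamp R));
    last exact: continuous_clamp.
  apply: (@continuous_comp _ _ _ (fun z : I * I => coord z.1 : R) u); last exact: cu.
  by apply: (@continuous_comp _ _ _ fst); [exact: cvg_fst|exact: continuous_coord].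
exists (fun z => if coord z.1 <= 2^-1 then H (clamp (2 * coord z.1), z.2)
                 else K (clamp (2 * coord z.1 - 1), z.2)); split => /=.
- apply: (@glue_continuous _ (fun z : I * I => coord z.1)).
  + move=> z; apply: (@continuous_comp _ _ _ fst); first exact: cvg_fst.
    exact: continuous_coord.
  + move=> z; apply: (@continuous_comp _ _ _ _ H); last exact: cH.
    by apply: (cc (fun t => 2 * t)) => t; apply: cvgMr; exact: cvg_id.
  + move=> z; apply: (@continuous_comp _ _ _ _ K); last exact: cK.
    apply: (cc (fun t => 2 * t - 1)) => t.
    by apply: cvgB; [apply: cvgMr; exact: cvg_id|exact: cvg_cst].
  + by move=> z /= ->; rewrite mulfV ?pnatr_eq0// subrr -oneE -zeroE H1 K0.
- move=> t; rewrite zeroE clamp_id ?lexx ?ler01 // mulr0 invr_ge0 ler0n.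
  by rewrite -zeroE H0.
- move=> t; rewrite oneE clamp_id ?lexx ?ler01 // mulr1.
  by rewrite ifF; [rewrite (_ : 2 - 1 = 1) -?oneE ?K1//; lra|apply/negbTE; lra].
- by move=> s; case: ifP.
- by move=> s; case: ifP.
Qed.

Definition loop_cat_fun (p q : loop) (t : I) : X :=
  if coord t <= 2^-1 then p (clamp (2 * coord t))
  else q (clamp (2 * coord t - 1)).

Lemma loop_cat_continuous p q : continuous (loop_cat_fun p q).
Proof.
have cc (u : R -> R) (r : loop) : continuous u ->
    continuous (fun t : I => r (clamp (u (coord t)))).
  move=> cu t.
  apply: (@continuous_comp _ _ _ (@clamp R \o (u \o @coord R)) r);
    last exact: cts_fun.
  apply: continuous_comp; last exact: continuous_clamp.
  by apply: continuous_comp; [exact: continuous_coord|exact: cu].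
apply: glue_continuous.
- exact: continuous_coord.
- by apply: (cc (fun t => 2 * t)) => t; apply: cvgMr; exact: cvg_id.
- apply: (cc (fun t => 2 * t - 1)) => t.
  by apply: cvgB; [apply: cvgMr; exact: cvg_id|exact: cvg_cst].
- move=> t ->; rewrite mulfV ?pnatr_eq0// subrr -oneE -zeroE.
  by rewrite path_one path_zero.
Qed.

Lemma loop_cat_zero p q : loop_cat_fun p q zero = x.
Proof.
rewrite /loop_cat_fun zeroE clamp_id ?lexx ?ler01 // mulr0 invr_ge0 ler0n.
exact: path_zero.
Qed.

Lemma loop_cat_one p q : loop_cat_fun p q one = x.
Proof.
rewrite /loop_cat_fun oneE clamp_id ?lexx ?ler01 // mulr1.
rewrite ifF; last by apply/negbTE; lra.
by rewrite (_ : 2 - 1 = 1); [exact: path_one|lra].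
Qed.

Definition loop_cat (p q : loop) : loop :=
  mk_path (@loop_cat_continuous p q) (loop_cat_zero p q) (loop_cat_one p q).

Lemma loop_catE p q t : loop_cat p q t =
  if coord t <= 2^-1 then p (clamp (2 * coord t))
  else q (clamp (2 * coord t - 1)).
Proof. by []. Qed.

Lemma loop_rev_continuous (p : loop) : continuous (fun t : I => p (clamp (1 - coord t))).
Proof.
move=> t; pose u (t : I) : R := 1 - coord t.
apply: (@continuous_comp _ _ _ (@clamp R \o u) p); last exact: cts_fun.
apply: (@continuous_comp _ _ _ u (@clamp R)); last exact: continuous_clamp.
by apply: continuousB; [exact: cst_continuous|exact: continuous_coord].
Qed.

Lemma loop_rev_zero (p : loop) : p (clamp (1 - coord (@zero I))) = x.
Proof. by rewrite clamp_id ?lexx ?ler01 // subr0 -oneE path_one. Qed.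

Lemma loop_rev_one (p : loop) : p (clamp (1 - coord (@one I))) = x.
Proof. by rewrite clamp_id ?lexx ?ler01 // subrr -zeroE path_zero. Qed.

Definition loop_rev (p : loop) : loop :=
  mk_path (@loop_rev_continuous p) (loop_rev_zero p) (loop_rev_one p).

Lemma loop_revE p t : loop_rev p t = p (clamp (1 - coord t)).
Proof. by []. Qed.

Definition loop_cst : loop := (cst x : I -> X).

Lemma homotopic_cat (p p' q q' : loop) : homotopic p p' -> homotopic q q' ->
  homotopic (loop_cat p q) (loop_cat p' q').
Proof.
move=> [H [cH H0 H1 Hx Hy]] [K [cK K0 K1 Kx Ky]].
have cc (u : R -> R) : continuous u -> continuous
    (fun z : I * I => (z.1, clamp (u (coord z.2))) : I * I).
  move=> cu z.
  apply: (@continuous_pair _ _ _ fst (fun z : I * I => clamp (u (coord z.2)))); first exact: cvg_fst.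
  apply: (@continuous_comp _ _ _ (fun z : I * I => u (coord z.2)) (@clamp R));
    last exact: continuous_clamp.
  apply: (@continuous_comp _ _ _ (fun z : I * I => coord z.2 : R) u); last exact: cu.
  by apply: (@continuous_comp _ _ _ snd); [exact: cvg_snd|exact: continuous_coord].
exists (fun z => if coord z.2 <= 2^-1 then H (z.1, clamp (2 * coord z.2))
                 else K (z.1, clamp (2 * coord z.2 - 1))); split => /=.
- apply: (@glue_continuous _ (fun z : I * I => coord z.2)).
  + move=> z; apply: (@continuous_comp _ _ _ snd); first exact: cvg_snd.
    exact: continuous_coord.
  + move=> z; apply: (@continuous_comp _ _ _ _ H); last exact: cH.
    by apply: (cc (fun t => 2 * t)) => t; apply: cvgMr; exact: cvg_id.
  + move=> z; apply: (@continuous_comp _ _ _ _ K); last exact: cK.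
    apply: (cc (fun t => 2 * t - 1)) => t.
    by apply: cvgB; [apply: cvgMr; exact: cvg_id|exact: cvg_cst].
  + by move=> z /= ->; rewrite mulfV ?pnatr_eq0// subrr -oneE -zeroE Hy Kx.
- by move=> t; rewrite H0 K0.
- by move=> t; rewrite H1 K1.
- move=> s; rewrite zeroE clamp_id ?lexx ?ler01 // mulr0 invr_ge0 ler0n.
  exact: Hx.
- move=> s; rewrite oneE clamp_id ?lexx ?ler01 // mulr1.
  rewrite ifF; last by apply/negbTE; lra.
  by rewrite (_ : 2 - 1 = 1) -?oneE ?Ky//; lra.
Qed.

Lemma homotopic_rev (p q : loop) :
  homotopic p q -> homotopic (loop_rev p) (loop_rev q).
Proof.
move=> [H [cH H0 H1 Hx Hy]].
exists (fun z => H (z.1, clamp (1 - coord z.2))); split => //=.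
- move=> z; pose u (z : I * I) : I * I := (z.1, clamp (1 - coord z.2)).
  apply: (@continuous_comp _ _ _ u H); last exact: cH.
  apply: continuous_pair; first exact: cvg_fst.
  apply: (@continuous_comp _ _ _ (fun z : I * I => 1 - coord z.2 : R) (@clamp R));
    last exact: continuous_clamp.
  apply: continuousB; first exact: cvg_cst.
  by apply: (@continuous_comp _ _ _ snd); [exact: cvg_snd|exact: continuous_coord].
- by move=> t; rewrite H0.
- by move=> t; rewrite H1.
- by move=> s; rewrite zeroE (@clamp_id _ 0) ?lexx ?ler01 // subr0 -oneE.
- by move=> s; rewrite oneE (@clamp_id _ 1) ?lexx ?ler01 // subrr -zeroE.
Qed.

Let cvg2 (t : R) : 2 * z @[z --> t] --> 2 * t.
Proof. by apply: cvgMr; exact: cvg_id. Qed.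

Lemma loop_catA p q r :
  homotopic (loop_cat p (loop_cat q r)) (loop_cat (loop_cat p q) r).
Proof.
apply: homotopic_sym.
apply: (@homotopic_reparam (loop_cat p (loop_cat q r)) _ _
  (fun t => Num.min (2 * t) (Num.min (t + 4^-1) ((t + 1) / 2))) id).
- move=> t; apply: (@continuous_min _ _ (fun t : R => 2 * t)) => //; first exact: cvg2.
  apply: (@continuous_min _ _ (fun t : R => t + 4^-1) (fun t => (t + 1) / 2)).
    by apply: cvgD; [exact: cvg_id|exact: cvg_cst].
  by apply: cvgMl; apply: cvgD; [exact: cvg_id|exact: cvg_cst].
- by move=> t; exact: cvg_id.
- by rewrite /= /Num.min; do 2!case: ifP; lra.
- by rewrite /= /Num.min; do 2!case: ifP; lra.
- move=> t; have := coord_itv t; rewrite !loop_catE.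
  move: (coord t) => s sI.
  have [s4|s4] := leP s 4^-1.
    have -> : Num.min (2 * s) (Num.min (s + 4^-1) ((s + 1) / 2)) = 2 * s.
      by rewrite (min_idPl _) // le_min; lra.
    rewrite clamp_id; last lra.
    have -> : s <= 2^-1 by lra.
    by have -> : 2 * s <= 2^-1 by lra.
  have [s2|s2] := leP s 2^-1.
    have -> : Num.min (2 * s) (Num.min (s + 4^-1) ((s + 1) / 2)) = s + 4^-1.
      rewrite (min_idPr _); last by rewrite ge_min; lra.
      by rewrite (min_idPl _) //; lra.
    rewrite (@clamp_id _ (2 * s)); last lra.
    rewrite (@clamp_id _ (s + _)); last lra.
    rewrite (@clamp_id _ (2 * _ - 1)); last lra.
    have -> : (2 * s <= 2^-1) = false by apply/negbTE; lra.
    have -> : (s + 4^-1 <= 2^-1) = false by apply/negbTE; lra.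
    have -> : 2 * (s + 4^-1) - 1 <= 2^-1 by lra.
    by congr (q (clamp _)); lra.
  have -> : Num.min (2 * s) (Num.min (s + 4^-1) ((s + 1) / 2)) = (s + 1) / 2.
    rewrite (min_idPr _); last by rewrite ge_min; lra.
    by rewrite (min_idPr _) //; lra.
  rewrite (@clamp_id _ ((s + 1) / 2)); last lra.
  have -> : ((s + 1) / 2 <= 2^-1) = false by apply/negbTE; lra.
  rewrite (@clamp_id _ (2 * _ - 1)); last lra.
  have -> : (2 * ((s + 1) / 2) - 1 <= 2^-1) = false by apply/negbTE; lra.
  by congr (r (clamp _)); lra.
- by move=> t; rewrite coordK.
Qed.

Lemma loop_cat1l p : homotopic (loop_cat loop_cst p) p.
Proof.
apply: (@homotopic_reparam p _ _ (fun t => Num.max 0 (2 * t - 1)) id).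
- move=> t; apply: (@continuous_max _ _ (fun t : R => 0) (fun t => 2 * t - 1)).
    exact: cvg_cst.
  by apply: cvgB; [exact: cvg2|exact: cvg_cst].
- by move=> t; exact: cvg_id.
- by rewrite /= /Num.max; case: ifP; lra.
- by rewrite /= /Num.max; case: ifP; lra.
- move=> t; rewrite loop_catE; case: ifP => tI.
    rewrite (max_idPl _); last lra.
    by rewrite -zeroE path_zero.
  by rewrite (max_idPr _) //; move: tI => /negbT; lra.
- by move=> t; rewrite coordK.
Qed.

Lemma loop_cat1r p : homotopic (loop_cat p loop_cst) p.
Proof.
apply: (@homotopic_reparam p _ _ (fun t => Num.min 1 (2 * t)) id).
- move=> t; apply: (@continuous_min _ _ (fun t : R => 1) (fun t => 2 * t)).
    exact: cvg_cst.
  exact: cvg2.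
- by move=> t; exact: cvg_id.
- by rewrite /= /Num.min; case: ifP; lra.
- by rewrite /= /Num.min; case: ifP; lra.
- move=> t; rewrite loop_catE; case: ifP => tI.
    by rewrite (min_idPr _) //; lra.
  rewrite (min_idPl _); last by move: tI => /negbT; lra.
  by rewrite -oneE path_one.
- by move=> t; rewrite coordK.
Qed.

Lemma loop_catV p : homotopic (loop_cat p (loop_rev p)) loop_cst.
Proof.
apply: (@homotopic_reparam p _ _ (fun t => Num.min (2 * t) (2 - 2 * t)) (fun=> 0)).
- move=> t; apply: (@continuous_min _ _ (fun t : R => 2 * t) (fun t => 2 - 2 * t)).
    exact: cvg2.
  by apply: cvgB; [exact: cvg_cst|exact: cvg2].
- by move=> t; exact: cvg_cst.
- by rewrite /= /Num.min; case: ifP; lra.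
- by rewrite /= /Num.min; case: ifP; lra.
- move=> t; have := coord_itv t; rewrite loop_catE !loop_revE => tI.
  have [t2|t2] := leP; first by rewrite (min_idPl _) //; lra.
  rewrite (min_idPr _); last lra.
  by rewrite clamp_id; [congr (p (clamp _)); lra|lra].
- by move=> t; rewrite -zeroE path_zero.
Qed.

Lemma loop_catVl p : homotopic (loop_cat (loop_rev p) p) loop_cst.
Proof.
apply: (@homotopic_reparam p _ _ (fun t => Num.max (1 - 2 * t) (2 * t - 1)) (fun=> 1)).
- move=> t; apply: (@continuous_max _ _ (fun t : R => 1 - 2 * t) (fun t => 2 * t - 1)).
    by apply: cvgB; [exact: cvg_cst|exact: cvg2].
  by apply: cvgB; [exact: cvg2|exact: cvg_cst].
- by move=> t; exact: cvg_cst.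
- by rewrite /= /Num.max; case: ifP; lra.
- by rewrite /= /Num.max; case: ifP; lra.
- move=> t; have := coord_itv t; rewrite loop_catE !loop_revE => tI.
  have [t2|t2] := leP.
    rewrite (max_idPl _); last lra.
    by rewrite clamp_id; [congr (p (clamp _)); lra|lra].
  by rewrite (max_idPr _) //; lra.
- by move=> t; rewrite -oneE path_one.
Qed.

Let homotopicb (p q : loop) := `[< homotopic p q >].

Let homotopicb_refl : reflexive homotopicb.
Proof. by move=> p; apply/asboolP; exact: homotopic_refl. Qed.

Let homotopicb_sym : symmetric homotopicb.
Proof. by move=> p q; apply/asboolP/asboolP; exact: homotopic_sym. Qed.

Let homotopicb_trans : transitive homotopicb.
Proof.
move=> q p r /asboolP pq /asboolP qr; apply/asboolP.
exact: homotopic_trans pq qr.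
Qed.

Definition homotopy_rel :=
  EquivRel homotopicb homotopicb_refl homotopicb_sym homotopicb_trans.

Definition pi1 := {eq_quot homotopy_rel}%qT.
HB.instance Definition _ := Quotient.on pi1.
HB.instance Definition _ := Choice.on pi1.

Definition pi1_class (p : loop) : pi1 := (\pi_pi1 p)%qT.

Lemma pi1_classP p q : pi1_class p = pi1_class q <-> homotopic p q.
Proof. by split=> [/eqmodP/asboolP//|pq]; apply/eqmodP/asboolP. Qed.

Lemma pi1_classK (a : pi1) : pi1_class (generic_quotient.repr a) = a.
Proof. exact: reprK. Qed.

Definition pi1_mul (a b : pi1) : pi1 := pi1_class (loop_cat (generic_quotient.repr a) (generic_quotient.repr b)).
Definition pi1_inv (a : pi1) : pi1 := pi1_class (loop_rev (generic_quotient.repr a)).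

Lemma pi1_mulE p q :
  pi1_mul (pi1_class p) (pi1_class q) = pi1_class (loop_cat p q).
Proof.
apply/pi1_classP/homotopic_cat; apply/pi1_classP; exact: pi1_classK.
Qed.

Lemma pi1_invE p : pi1_inv (pi1_class p) = pi1_class (loop_rev p).
Proof. by apply/pi1_classP/homotopic_rev/pi1_classP; exact: pi1_classK. Qed.

Fact pi1_mulA : associative pi1_mul.
Proof.
move=> a b c; rewrite -[a]pi1_classK -[b]pi1_classK -[c]pi1_classK !pi1_mulE.
exact/pi1_classP/loop_catA.
Qed.

Fact pi1_mul1 : left_id (pi1_class loop_cst) pi1_mul.
Proof. by move=> a; rewrite -[a]pi1_classK pi1_mulE; exact/pi1_classP/loop_cat1l. Qed.

Fact pi1_mulr1 : right_id (pi1_class loop_cst) pi1_mul.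
Proof. by move=> a; rewrite -[a]pi1_classK pi1_mulE; exact/pi1_classP/loop_cat1r. Qed.

Fact pi1_mulV : left_inverse (pi1_class loop_cst) pi1_inv pi1_mul.
Proof.
move=> a; rewrite -[a]pi1_classK pi1_invE pi1_mulE.
exact/pi1_classP/loop_catVl.
Qed.

Fact pi1_mulrV : right_inverse (pi1_class loop_cst) pi1_inv pi1_mul.
Proof.
move=> a; rewrite -[a]pi1_classK pi1_invE pi1_mulE.
exact/pi1_classP/loop_catV.
Qed.

HB.instance Definition _ :=
  isGroup.Build pi1 pi1_mulA pi1_mul1 pi1_mulr1 pi1_mulV pi1_mulrV.

End fundamental_group.
Arguments pi1 R {X} x.
Arguments pi1_class {R X x}.

Section dihedral.
Variable n : nat.

(* The rotation x and the reflection r of the regular n-gon, acting on its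
   vertices, which are numbered cyclically by 'I_n. *)
Definition polygon_rot : 'S_n := perm (@ordS_inj n).
Definition polygon_refl : 'S_n := perm (@rev_ord_inj n).

Definition dihedral : {group 'S_n} := <<[set polygon_refl; polygon_rot]%SET>>%G.

End dihedral.

Section sphere.
Context {R : realType}.
Implicit Types u v : 'rV[R]_3.

Definition dotp u v : R := \sum_i u 0 i * v 0 i.
Definition edist u v : R := Num.sqrt (dotp (u - v) (u - v)).

Definition sphere : set 'rV[R]_3 := [set u | dotp u u = 1].
Definition cap u (r : R) : set 'rV[R]_3 := [set v | sphere v /\ edist u v <= r].
Definition open_cap u (r : R) : set 'rV[R]_3 :=
  [set v | sphere v /\ edist u v < r].

Definition exterior b (p : 'I_b -> 'rV[R]_3) (rho : 'I_b -> R) :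
  set 'rV[R]_3 := sphere `\` \bigcup_i open_cap (p i) (rho i).

End sphere.

Section branched_covers.
Context {R : realType} {M : topologicalType}.

(* E is evenly covered by n slices, each given as the image of a section s i. *)
Definition covering_over (q : M -> 'rV[R]_3) (E : set 'rV[R]_3) (n : nat) :=
  forall y, E y -> exists2 U : set 'rV[R]_3, open U /\ U y &
    exists s : 'I_n -> 'rV[R]_3 -> M,
    [/\ forall i, {within U `&` E, continuous (s i)},
        forall i z, (U `&` E) z -> q (s i z) = z,
        forall m, (U `&` E) (q m) -> exists! i, s i (q m) = m &
        forall i, exists2 V : set M, open V &
          s i @` (U `&` E) = V `&` q @^-1` (U `&` E)].

(* The fiber over x0 is labelled by e, and the lift of a loop g starting at e i
   ends at e (rho [g] i). In MathComp (s * t) i = t (s i), so this convention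
   makes the monodromy a homomorphism for concatenation from left to right. *)
Definition has_monodromy (q : M -> 'rV[R]_3) (E : set 'rV[R]_3) (x0 : E)
    (n : nat) (rho : pi1 R x0 -> 'S_n) :=
  exists e : 'I_n -> M,
  [/\ injective e, range e = q @^-1` [set set_val x0] &
      forall (g : {path unitI R from x0 to x0}) (h : unitI R -> M) i,
        continuous h -> (forall t, q (h t) = set_val (g t)) ->
        h zero = e i -> h one = e (rho (pi1_class g) i)].

Definition unit_disk : set R[i]^o := [set z | `|z| <= 1].

(* Over the disk D around y, M consists of finitely many disjoint closed disks,
   the images of the maps c j, and q reads z |-> z ^+ d j on the j-th one.
   The maps k and c j are homeomorphisms onto their images, because the unit
   disk is compact and M is Hausdorff in the definition of branched_cover. *)
Definition filled_by_powers (q : M -> 'rV[R]_3) (y : 'rV[R]_3)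
    (D : set 'rV[R]_3) :=
  exists k : R[i]^o -> 'rV[R]_3,
  [/\ {within unit_disk, continuous k}, {in unit_disk &, injective k},
      k @` unit_disk = D, k 0 = y &
  exists (l : nat) (d : 'I_l -> nat) (c : 'I_l -> R[i]^o -> M),
  [/\ forall j, (0 < d j)%N,
      forall j, {within unit_disk, continuous (c j)},
      forall i j z w, unit_disk z -> unit_disk w -> c i z = c j w ->
        i = j /\ z = w,
      \bigcup_j (c j @` unit_disk) = q @^-1` D &
      forall j z, unit_disk z -> q (c j z) = k (z ^+ d j)]].

Record branched_cover (b n : nat) (p : 'I_b -> 'rV[R]_3) (rho : 'I_b -> R)
    (x0 : exterior p rho) (phi : pi1 R x0 -> [subg dihedral n])
    (q : M -> 'rV[R]_3) : Prop := {
  bc_hausdorff : hausdorff_space M;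
  bc_continuous : continuous q;
  bc_sphere : forall m, sphere (q m);
  bc_covering : covering_over q (exterior p rho) n;
  bc_monodromy : has_monodromy q (fun a => sgval (phi a));
  bc_filling : forall i, filled_by_powers q (p i) (cap (p i) (rho i))
}.

End branched_covers.

Section smooth_maps.
Context {R : realType} {V W : normedModType R}.

Fixpoint class_C (k : nat) (U : set V) (f : V -> W) : Prop :=
  if k is k'.+1 then
    (forall x, U x -> differentiable f x) /\
    (forall v, class_C k' U (fun x => 'd f x v))
  else forall x, U x -> {for x, continuous f}.

Definition smooth_immersion (U : set V) (f : V -> W) : Prop :=
  [/\ open U, forall k, class_C k U f &
      forall x, U x -> injective ('d f x)].

End smooth_maps.

Section general_position.
Context {R : realType} {M : topologicalType} (q : M -> 'rV[R]_3).

(* Away from the branch points M carries the smooth structure for which q is a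
   local diffeomorphism to the sphere: its smooth local parametrizations are the
   continuous maps s such that q \o s is a smooth immersion. *)
Definition local_param (A : set M) (W : set 'rV[R]_2) (s : 'rV[R]_2 -> M) :=
  [/\ forall w, W w -> {for w, continuous s}, s @` W `<=` A &
      smooth_immersion W (q \o s)].

Definition immersion_on (V : normedModType R) (A : set M) (f : M -> V) :=
  exists O : set M, [/\ open O, A `<=` O &
    forall W s, local_param O W s -> smooth_immersion W (f \o s)].

Definition tangent_plane (V : normedModType R) (A : set M) (f : M -> V)
    (m : M) : set V :=
  [set v | exists W s w u, [/\ local_param A W s, W w, s w = m &
                             v = 'd (f \o s) w u]].

Definition multiple_point (V : Type) (A : set M) (f : M -> V) (y : V) :=
  exists m1 m2, [/\ A m1, A m2, m1 <> m2, f m1 = y & f m2 = y].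

(* In sphere * R, near y, the set S is diffeomorphic to L near 0 in R^3;
   the inverse diffeomorphism psi parametrizes a neighborhood of y. *)
Definition locally_modeled (S : set ('rV[R]_3 * R)) (y : 'rV[R]_3 * R)
    (L : set 'rV[R]_3) :=
  exists (O : set 'rV[R]_3) (psi : 'rV[R]_3 -> 'rV[R]_3 * R),
  [/\ smooth_immersion O psi /\ {in O &, injective psi},
      O 0, psi 0 = y,
      exists2 G, open G & psi @` O = G `&` (sphere `*` setT) &
      forall t, O t -> S (psi t) <-> L t].

Definition double_model : set 'rV[R]_3 := [set t | t 0 0 * t 0 1 = 0].
Definition triple_model : set 'rV[R]_3 := [set t | \prod_i t 0 i = 0].

(* A multiple point at height 0 or n+1 would be a tangency, so that using
   sphere * R instead of sphere * [0,n+1] as the target makes no difference;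
   the same holds for transverse double points in sphere * R^2. *)
Definition general_position_3d (A : set M) (g : M -> 'rV[R]_3 * R) :=
  immersion_on A g /\
  forall y, multiple_point A g y ->
    ((A `&` g @^-1` [set y] #= `I_2)%card /\
     locally_modeled (g @` A) y double_model) \/
    ((A `&` g @^-1` [set y] #= `I_3)%card /\
     locally_modeled (g @` A) y triple_model).

Definition isolated_multiple_point (A : set M) (f : M -> 'rV[R]_3 * (R * R)) y :=
  exists G, [/\ open G, G y & forall z, G z -> multiple_point A f z -> z = y].

(* The tangent space of sphere * R^2 at y is [set v | dotp v.1 y.1 = 0]. *)
Definition transverse_at (A : set M) (f : M -> 'rV[R]_3 * (R * R))
    (m1 m2 : M) :=
  forall v, dotp v.1 (f m1).1 = 0 ->
    exists v1 v2, [/\ tangent_plane A f m1 v1, tangent_plane A f m2 v2 &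
                      v = v1 + v2].

Definition general_position_4d (A : set M) (f : M -> 'rV[R]_3 * (R * R)) :=
  immersion_on A f /\
  forall y, multiple_point A f y ->
    [/\ (A `&` f @^-1` [set y] #= `I_2)%card, isolated_multiple_point A f y &
        forall m1 m2, A m1 -> A m2 -> m1 <> m2 -> f m1 = y -> f m2 = y ->
          transverse_at A f m1 m2].

Context (n b : nat) (p : 'I_b -> 'rV[R]_3) (rho : 'I_b -> R).

(* P holds on the complement in M of the part over a closed neighborhood of
   the branch points that is contained in the interior of N(K). *)
Definition away_from_branching (P : set M -> Prop) :=
  exists C : set 'rV[R]_3,
  [/\ closed C, range p `<=` C°, C `&` exterior p rho = set0 &
      P (q @^-1` (~` C))].

Record folding (g : M -> 'rV[R]_3 * R) : Prop := {
  folding_continuous : continuous g;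
  folding_proj : forall m, (g m).1 = q m;
  folding_height : forall m, 0 <= (g m).2 <= n.+1%:R;
  folding_generic : away_from_branching (general_position_3d ^~ g)
}.

Record immersed_braiding (f : M -> 'rV[R]_3 * (R * R)) : Prop := {
  braiding_continuous : continuous f;
  braiding_folding : folding (fun m => ((f m).1, (f m).2.1));
  braiding_height : forall m, -1 <= (f m).2.2 <= 1;
  braiding_proj : forall m, (f m).1 = q m;
  braiding_generic : away_from_branching (general_position_4d ^~ f)
}.

End general_position.

(* Main.v *)
(* Stereographic projection from one branch point, followed by a shear, sends the
   other branch points to points (x_i, y_i) of the plane with distinct y_i.  The
   cover is trivial over the plane cut along thin horizontal strips running from
   each (x_i, y_i) to the right; there the j-th sheet is put at height 2^-j.
   Across the i-th strip the sheets are permuted by some s_i, and inside the strip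
   the j-th sheet moves from 2^-j to 2^-s_i(j) along a straight line, with the
   time B a smooth function of y that goes from 0 to 1 and is flat at both ends.
   Two such lines cross at most once, transversally, and the heights 2^-j decrease
   so fast that no three of them meet; hence the folding has double curves only.
   The second coordinate B (1 - B) 2^-j separates the sheets inside the strips,
   so the lift has no multiple point at all away from the branch set.  Both
   coordinates are multiplied by a cutoff function vanishing near the branch set,
   where only continuity is required. *)
Require Import Defs.
From HB Require Import structures.
From mathcomp Require Import all_boot all_order all_algebra all_fingroup.
From mathcomp Require Import all_classical all_reals all_analysis.
From mathcomp Require Import complex homotopy ring lra.
Set Implicit Arguments.
Unset Strict Implicit.
Unset Printing Implicit Defensive.
Import Order.TTheory GRing.Theory Num.Theory numFieldNormedType.Exports.
Local Open Scope classical_set_scope.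
Local Open Scope ring_scope.

(** * Smooth maps *)

Section smooth_calculus.
Context {R : realType}.
Implicit Types V W : normedModType R.

(** The covering is given only over the exterior of round disks, whereas the cuts are straight
    strips that start at small boxes inside these disks. Hence the covering is extended over the
    punctured disks, where it is a union of power maps, until every point of the sphere other than a
    branch point has a neighborhood with [n] sheets. Projecting from a branch point makes the cuts
    end there, so sheets are needed only over a bounded part of the plane. They are patched together
    row by row, by comparing labels on connected overlaps. Smoothness is defined through iterated
    differentials, so the calculus is kept to the rules that the construction uses: sums, products,
    inverses, and composition with linear maps or with functions of one real variable. A chart at a
    double curve has to undo the time function [B] smoothly; this is the reason for a step function
    whose inverse on []0, 1[] is elementary. *)

Lemma is_diff_near V W (f g df : V -> W) x :
  (\forall y \near x, f y = g y) -> is_diff x f df -> is_diff x g df.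
Proof.
move=> fg dfx; have fgx : f x = g x := nbhs_singleton fg.
have h0 : is_diff x (g - f) 0.
  have E : (g - f) \o shift x = cst ((g - f) x) + 0 +o_ 0 id.
    apply/eqaddoP => e e0; near=> y.
    rewrite /= !fctE /= addr0 fgx subrr subr0.
    suff -> : g (y + x) = f (y + x).
      by rewrite subrr normr0; apply: mulr_ge0; [exact: ltW|exact: normr_ge0].
    apply/esym; near: y.
    have := fg; rewrite (near_shift 0 x) /= => H.
    by apply: filterS H => y /=; rewrite subr0.
  have c0 : continuous (0 : V -> W) by exact: cst_continuous.
  have D : 'd (g - f) x = 0 :> (V -> W) by apply: (@diff_unique _ _ _ _ \0).
  by split=> //; apply/diff_locallyP; rewrite D; split.
have := @is_diffD _ _ _ f (g - f) df 0 x dfx h0.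
by rewrite addr0 addrC subrK.
Unshelve. all: by end_near. Qed.

Lemma class_C_sub V W k (U U' : set V) (f : V -> W) :
  U' `<=` U -> class_C k U f -> class_C k U' f.
Proof.
move=> U'U; elim: k f => [|k IH] f /=; first by move=> Uf x /U'U; exact: Uf.
by move=> [df Cf]; split=> [x /U'U|v]; [exact: df|exact/IH/Cf].
Qed.

Lemma class_C_cover V W k (U : set V) (f : V -> W) :
  (forall x, U x -> exists2 U', U' x & class_C k U' f) -> class_C k U f.
Proof.
elim: k f => [|k IH] f /= Uf.
  by move=> x /Uf[U' U'x]; apply.
split=> [x /Uf[U' U'x [df _]]|v]; first exact: df.
by apply: IH => x /Uf[U' U'x [_ Cf]]; exists U'.
Qed.

Lemma class_C_ext V W k (U : set V) (f g : V -> W) : open U ->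
  (forall x, U x -> f x = g x) -> class_C k U f -> class_C k U g.
Proof.
move=> oU; elim: k f g => [|k IH] f g fg /=.
  move=> cf x Ux; rewrite /prop_for /continuous_at -fg //.
  apply: cvg_trans (cf x Ux); apply: near_eq_cvg.
  by apply: filterS (open_nbhs_nbhs (conj oU Ux)) => y /fg.
have near_fg x : U x -> \forall y \near x, f y = g y.
  by move=> Ux; apply: filterS (open_nbhs_nbhs (conj oU Ux)) => y /fg.
have D x : U x -> differentiable f x -> is_diff x g ('d f x).
  move=> Ux dfx; apply: is_diff_near (near_fg x Ux) _; exact: differentiableP.
move=> [df Cf]; split=> [x Ux|v].
  by have [] := D x Ux (df x Ux).
apply: IH (Cf v) => x Ux.
by have [_ ->] := D x Ux (df x Ux).
Qed.

Definition smooth V W (U : set V) (f : V -> W) := forall k, class_C k U f.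

Lemma smooth_sub V W (U U' : set V) (f : V -> W) :
  U' `<=` U -> smooth U f -> smooth U' f.
Proof. by move=> U'U Uf k; exact: class_C_sub U'U (Uf k). Qed.

Lemma smooth_cover V W (U : set V) (f : V -> W) :
  (forall x, U x -> exists2 U', U' x & smooth U' f) -> smooth U f.
Proof.
by move=> Uf k; apply: class_C_cover => x /Uf[U' U'x /(_ k)]; exists U'.
Qed.

Lemma smooth_ext V W (U : set V) (f g : V -> W) : open U ->
  (forall x, U x -> f x = g x) -> smooth U f -> smooth U g.
Proof. by move=> oU fg Uf k; exact: class_C_ext oU fg (Uf k). Qed.

Lemma smooth_differentiable V W (U : set V) (f : V -> W) x :
  smooth U f -> U x -> differentiable f x.
Proof. by move=> /(_ 1)[+ _]; exact. Qed.

Lemma smooth_continuous V W (U : set V) (f : V -> W) x :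
  smooth U f -> U x -> {for x, continuous f}.
Proof. by move=> /(_ 0); exact. Qed.

(** The rules below use this form: a formula [df] that gives the differential on [U] is enough, and
    its values elsewhere are free. *)
Lemma class_CS V W k (U : set V) (f : V -> W) (df : V -> V -> W) : open U ->
  (forall x, U x -> is_diff x f (df x)) ->
  (forall v, class_C k U (fun x => df x v)) -> class_C k.+1 U f.
Proof.
move=> oU fdf Cdf; split=> [x Ux|v]; first by have [] := fdf x Ux.
by apply: class_C_ext (Cdf v) => // x Ux; have [_ ->] := fdf x Ux.
Qed.

(** The derivative of a product still contains the factors themselves, one order lower. *)
Lemma class_CW V W k (U : set V) (f : V -> W) :
  class_C k.+1 U f -> class_C k U f.
Proof.
elim: k f => [|k IH] f; last by move=> [df Cf]; split=> // v; exact/IH/Cf.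
by move=> [df _] x Ux; apply: differentiable_continuous; exact: df.
Qed.

Lemma class_C_cst V W k (U : set V) (a : W) : open U -> class_C k U (cst a).
Proof.
move=> oU; elim: k a => [|k IH] a; first by move=> x _; exact: cst_continuous.
apply: (@class_CS _ _ _ _ _ (fun _ => 0)) => // v.
exact: (IH 0).
Qed.

Lemma class_C_lin V W k (U : set V) (l : {linear V -> W}) :
  open U -> continuous l -> class_C k U l.
Proof.
move=> oU cl; case: k => [|k]; first by move=> x _; exact: cl.
apply: (@class_CS _ _ _ _ _ (fun _ => l)) => // [x _|v].
  by split; [exact: linear_differentiable|exact: diff_lin].
exact: class_C_cst.
Qed.

Lemma class_CD V W k (U : set V) (f g : V -> W) : open U ->
  class_C k U f -> class_C k U g -> class_C k U (fun x => f x + g x).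
Proof.
move=> oU; elim: k f g => [|k IH] f g.
  by move=> cf cg x Ux; apply: continuousD; [exact: cf|exact: cg].
move=> [df Cf] [dg Cg].
apply: (@class_CS _ _ _ _ _ (fun x v => 'd f x v + 'd g x v)) => // [x Ux|v].
  by apply: is_diffD; apply: differentiableP; [exact: df|exact: dg].
exact: IH (Cf v) (Cg v).
Qed.

Lemma class_C_comp_lin V W W' k (U : set V) (f : V -> W) (l : {linear W -> W'}) :
  open U -> continuous l -> class_C k U f -> class_C k U (l \o f).
Proof.
move=> oU cl; elim: k f => [|k IH] f.
  by move=> cf x Ux; apply: continuous_comp; [exact: cf|exact: cl].
move=> [df Cf].
apply: (@class_CS _ _ _ _ _ (fun x v => l ('d f x v))) => // [x Ux|v].
  apply: (@is_diff_comp _ _ _ _ f ('d f x) l l).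
    by apply: differentiableP; exact: df.
  by split; [exact: linear_differentiable|exact: diff_lin].
exact: IH (Cf v).
Qed.

Lemma class_CM V k (U : set V) (f g : V -> R) : open U ->
  class_C k U f -> class_C k U g -> class_C k U (fun x => f x * g x).
Proof.
move=> oU; elim: k f g => [|k IH] f g.
  by move=> cf cg x Ux; apply: continuousM; [exact: cf|exact: cg].
move=> Cfk Cgk; have [df Cf] := Cfk; have [dg Cg] := Cgk.
apply: (@class_CS _ _ _ _ _ (fun x v => f x * 'd g x v + g x * 'd f x v)) => //.
  by move=> x Ux; apply: is_diffM; apply: differentiableP; [exact: df|exact: dg].
move=> v; apply: class_CD => //.
  by apply: IH; [exact: class_CW|exact: Cg].
by apply: IH; [exact: class_CW|exact: Cf].
Qed.

Lemma is_diff_real (g : R -> R) (x dg : R) :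
  is_derive x 1 g dg -> is_diff x g (fun v => v * dg).
Proof.
move=> [g1 <-]; split; first exact/derivable1_diffP.
by rewrite deriv1E // derive1E.
Qed.

Lemma class_CS_real k (U : set R) (g g' : R -> R) : open U ->
  (forall x, U x -> is_derive x 1 g (g' x)) -> class_C k U g' ->
  class_C k.+1 U g.
Proof.
move=> oU gg' Cg'.
apply: (@class_CS R R _ _ _ (fun x v => v * g' x)) => // [x Ux|v].
  exact/is_diff_real/gg'.
by apply: class_CM => //; exact: class_C_cst.
Qed.

(** [g] is smooth of every order so that the induction on [k] can pass from [g] to its derivative
    [fun y => 'd g y 1]. In one variable this derivative is a scalar, which turns the chain rule
    into a product. *)
Lemma class_C_comp_real V k (U : set V) (f : V -> R) (U' : set R) (g : R -> R) :
  open U -> (forall x, U x -> U' (f x)) -> smooth U' g ->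
  class_C k U f -> class_C k U (g \o f).
Proof.
move=> oU fU'; elim: k g => [|k IH] g Cg.
  move=> cf x Ux; apply: continuous_comp; first exact: cf.
  by apply: (Cg 0); exact: fU'.
move=> Cfk; have [df Cf] := Cfk.
apply: (@class_CS _ _ _ _ _ (fun x v => ('d g (f x) 1) * ('d f x v))) => // [x Ux|v].
  have -> : (fun v => ('d g (f x) 1) * ('d f x v)) = 'd g (f x) \o 'd f x.
    apply/funext => v /=.
    have <- : ('d f x v) *: (1 : R) = 'd f x v by rewrite /GRing.scale /= mulr1.
    by rewrite [RHS]linearZ /GRing.scale /= mulr1 mulrC.
  apply: is_diff_comp; apply: differentiableP; first exact: df.
  by apply: smooth_differentiable Cg _; exact: fU'.
apply: class_CM => //; last exact: Cf.
apply: (IH (fun y => 'd g y 1)); last exact: class_CW.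
by move=> j; have [_] := Cg j.+1; exact.
Qed.

Lemma smooth_cst V W (U : set V) (a : W) : open U -> smooth U (cst a).
Proof. by move=> oU k; exact: class_C_cst. Qed.

Lemma smooth_lin V W (U : set V) (l : {linear V -> W}) :
  open U -> continuous l -> smooth U l.
Proof. by move=> oU cl k; exact: class_C_lin. Qed.

Lemma smoothD V W (U : set V) (f g : V -> W) : open U ->
  smooth U f -> smooth U g -> smooth U (fun x => f x + g x).
Proof. by move=> oU Uf Ug k; exact: class_CD. Qed.

Lemma smooth_comp_lin V W W' (U : set V) (f : V -> W) (l : {linear W -> W'}) :
  open U -> continuous l -> smooth U f -> smooth U (l \o f).
Proof. by move=> oU cl Uf k; exact: class_C_comp_lin. Qed.

Lemma smoothM V (U : set V) (f g : V -> R) : open U ->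
  smooth U f -> smooth U g -> smooth U (fun x => f x * g x).
Proof. by move=> oU Uf Ug k; exact: class_CM. Qed.

Lemma smoothN V (U : set V) (f : V -> R) : open U ->
  smooth U f -> smooth U (fun x => - f x).
Proof.
move=> oU Uf.
have -> : (fun x => - f x) = (fun x => cst (- 1) x * f x).
  by apply/funext => x; rewrite mulN1r.
by apply: smoothM => //; exact: smooth_cst.
Qed.

Lemma smooth_comp_real V (U : set V) (f : V -> R) (U' : set R) (g : R -> R) :
  open U -> (forall x, U x -> U' (f x)) -> smooth U' g ->
  smooth U f -> smooth U (g \o f).
Proof. by move=> oU fU' Ug Uf k; exact: (class_C_comp_real oU fU' Ug). Qed.

Lemma open_neq0 : open [set x : R | x != 0].
Proof.
rewrite (_ : [set x | _] = ~` [set 0]).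
  exact/closed_openC/accessible_closed_set1/hausdorff_accessible/norm_hausdorff.
by apply/seteqP; split=> x /= /eqP.
Qed.

(** The derivative is written with [x^-1 * x^-1], so that the induction hypothesis applies to each
    factor. *)
Lemma smooth_inv : smooth [set x : R | x != 0] (fun x => x^-1).
Proof.
elim=> [|k IH].
  by move=> x x0; exact: inv_continuous.
apply: (@class_CS_real _ _ _ (fun x => - 1 * (x^-1 * x^-1))).
- exact: open_neq0.
- move=> x x0; rewrite mulN1r.
  split; first exact: (@derivableV _ _ id).
  by rewrite (@deriveV _ _ id) // derive_id /GRing.scale /= mulr1 expr2 invfM.
- apply: class_CM; [exact: open_neq0|exact/class_C_cst/open_neq0|].
  by apply: class_CM => //; exact: open_neq0.
Qed.

Lemma smoothV V (U : set V) (f : V -> R) : open U ->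
  (forall x, U x -> f x != 0) -> smooth U f -> smooth U (fun x => (f x)^-1).
Proof. by move=> oU f0 Uf; exact: (smooth_comp_real oU f0 smooth_inv). Qed.

End smooth_calculus.

(** * A smooth step function with an explicit smooth inverse *)

Section smooth_step.
Context {R : realType}.
Implicit Types (p : {poly R}) (x u : R).

(* The derivative of [flat p] is again of this form. *)
Definition flat p x : R := if 0 < x then p.[x^-1] * expR (- x^-1) else 0.

(** The term of degree [i] is compared with the term of degree [i.+1] of the exponential series at
    [x^-1]; the spare factor becomes the linear decay that the derivative at 0 requires. *)
Lemma flat_bound p : exists2 C, 0 <= C & forall x, `|flat p x| <= C * `|x|.
Proof.
exists (\sum_(i < size p) `|p`_i| * (i.+1)`!%:R).
  by apply: sumr_ge0 => i _; rewrite mulr_ge0.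
move=> x; rewrite /flat; case: ifPn => [x0|_]; last first.
  by rewrite normr0 mulr_ge0// sumr_ge0 // => i _; rewrite mulr_ge0.
rewrite normrM (gtr0_norm (expR_gt0 _)) horner_coef mulr_suml.
apply: (@le_trans _ _ (\sum_(i < size p) (`|p`_i| * x^-1 ^+ i * expR (- x^-1)))).
  rewrite -mulr_suml ler_pM2r ?expR_gt0// (le_trans (ler_norm_sum _ _ _))//.
  by apply: ler_sum => i _; rewrite normrM normrX (@gtr0_norm _ x^-1)// invr_gt0.
apply: ler_sum => i _; rewrite -!mulrA ler_wpM2l //.
rewrite (gtr0_norm x0) expRN ler_pdivrMr ?expR_gt0//.
have xi0 : 0 <= x^-1 by rewrite invr_ge0 ltW.
have {}H : x^-1 ^+ i.+1 <= i.+1`!%:R * expR x^-1.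
  rewrite mulrC -ler_pdivrMr ?ltr0n ?fact_gt0//.
  by apply: le_trans (expR_ge1Dxn i xi0) ; rewrite lerDr.
rewrite -(ler_pM2l (x := x^-1)) ?invr_gt0// -exprS (le_trans H)//.
by rewrite le_eqVlt; apply/orP; left; apply/eqP; field; rewrite gt_eqF.
Qed.

Lemma is_derive_flat p x :
  is_derive x 1 (flat p) (flat ((p - p^`()) * 'X^2) x).
Proof.
have [x0|x0|<-] := ltgtP 0 x; last first.
- have -> : flat ((p - p^`()) * 'X^2) 0 = 0 by rewrite /flat ltxx.
  (* At 0 the difference quotient of [flat p] is [flat (p * 'X)], which tends to 0 by the linear
     bound. *)
  have [C C0 HC] := flat_bound (p * 'X).
  suff H : h^-1 *: (flat p (h *: 1 + 0) - flat p 0) @[h --> 0^'] --> (0 : R).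
    split; first by apply/cvg_ex; exists 0; exact: H.
    exact: (cvg_lim _ H).
  apply/cvgr0Pnorm_le => e e0.
  near=> h; have h0 : h != 0 by near: h; exact: nbhs_dnbhs_neq.
  have -> : h^-1 *: (flat p (h *: 1 + 0) - flat p 0) = flat (p * 'X) h.
    rewrite /flat ltxx subr0 addr0 /GRing.scale /= mulr1.
    case: ifP => _; last by rewrite mulr0.
    by rewrite hornerMX; ring.
  apply: le_trans (HC h) _.
  have : `|h| <= e / (C + 1).
    near: h; apply: nbhs_dnbhs; apply: (@nbhs0_le _ R).
    by rewrite divr_gt0// ltr_pwDr.
  rewrite ler_pdivlMr ?ltr_pwDr// => /(le_trans _); apply.
  by rewrite mulrC ler_wpM2l// lerDl.
- have -> : flat ((p - p^`()) * 'X^2) x = 0 by rewrite /flat ltNge (ltW x0).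
  apply: (@near_eq_is_derive _ _ _ (cst 0 : R -> R)).
  near=> y; rewrite /flat; have : y < 0 by near: y; exact: lt_nbhsl.
  by case: ltgtP.
- apply: (@near_eq_is_derive R R R (fun y : R => p.[y^-1] * expR (- y^-1))).
    near=> y; rewrite /flat; have -> // : 0 < y by near: y; exact: lt_nbhsr.
  have xn0 : x != 0 by rewrite gt_eqF.
  have dV : is_derive x 1 (fun y : R => y^-1) (- x ^- 2 *: 1).
    exact: (@is_deriveV _ id).
  have dp : is_derive (x^-1) 1 (horner p) (p^`()).[x^-1].
    by split; [exact: derivable_horner|rewrite derivE derive1E].
  have d1 : is_derive x 1 (fun y => p.[y^-1]) (p^`().[x^-1] * (- x ^- 2 *: 1)).
    exact: (@is_derive1_comp _ (horner p) (fun y => y^-1)).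
  have dN : is_derive x 1 (fun y : R => - y^-1) (- (- x ^- 2 *: 1)).
    exact: is_deriveN.
  have d2 : is_derive x 1 (fun y => expR (- y^-1))
      (expR (- x^-1) * (- (- x ^- 2 *: 1))).
    exact: (@is_derive1_comp _ expR (fun y => - y^-1)).
  apply: (is_derive_eq (is_deriveM d1 d2)).
  rewrite /flat x0 hornerM hornerD hornerN hornerXn /GRing.scale /=.
  by field.
Unshelve. all: by end_near. Qed.

Lemma smooth_flat p : smooth setT (flat p).
Proof.
move=> k; elim: k p => [|k IH] p.
  move=> x _; have [+ _] := is_derive_flat p x.
  by move=> /derivable1_diffP/differentiable_continuous.
apply: (class_CS_real openT (fun x _ => is_derive_flat p x)); exact: IH.
Qed.

Definition step x : R := flat 1 x / (flat 1 x + flat 1 (1 - x)).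

Lemma flat1E x : flat 1 x = if 0 < x then expR (- x^-1) else 0.
Proof. by rewrite /flat hornerC mul1r. Qed.

Lemma flat1_ge0 x : 0 <= flat 1 x.
Proof. by rewrite flat1E; case: ifP => // _; exact: expR_ge0. Qed.

Lemma step_den_gt0 x : 0 < flat 1 x + flat 1 (1 - x).
Proof.
have [x0|x0] := ltP 0 x.
  by rewrite ltr_pwDl ?flat1_ge0// flat1E x0 expR_gt0.
rewrite ltr_pwDr ?flat1_ge0// flat1E ifT ?expR_gt0//.
by rewrite subr_gt0 (le_lt_trans x0)// ltr01.
Qed.

Lemma step_ge0 x : 0 <= step x.
Proof. by rewrite divr_ge0 ?flat1_ge0// ltW// step_den_gt0. Qed.

Lemma step_le1 x : step x <= 1.
Proof. by rewrite ler_pdivrMr ?step_den_gt0// mul1r lerDl flat1_ge0. Qed.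

Lemma step_eq0 x : x <= 0 -> step x = 0.
Proof. by move=> x0; rewrite /step flat1E ltNge x0 mul0r. Qed.

Lemma step_eq1 x : 1 <= x -> step x = 1.
Proof.
move=> x1; have := step_den_gt0 x; rewrite /step (flat1E (1 - x)) subr_gt0.
by rewrite [x < 1]ltNge x1 /= addr0 => /gt_eqF/negbT/divff.
Qed.

Lemma smooth_step : smooth setT step.
Proof.
apply: smoothM; [exact: openT|exact: smooth_flat|].
apply: smoothV; [exact: openT| |].
  by move=> x _; rewrite gt_eqF// step_den_gt0.
apply: smoothD; [exact: openT|exact: smooth_flat|].
apply: (@smooth_comp_real _ _ _ _ setT (flat 1)) => //; [exact: openT|exact: smooth_flat|].
apply: smoothD; [exact: openT|exact/smooth_cst/openT|].
apply: smoothN; first exact: openT.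
by apply: (@smooth_lin _ _ _ _ idfun); [exact: openT|move=> y; exact: cvg_id].
Qed.

Lemma smooth_ln : smooth [set x : R | 0 < x] (@ln R).
Proof.
case=> [|k]; first by move=> x; exact: continuous_ln.
apply: (@class_CS_real _ _ _ _ (fun x => x^-1)); first exact: open_gt.
apply: class_C_sub (smooth_inv k) => x /=; exact: lt0r_neq0.
Qed.

Lemma smooth_sqrt : smooth [set x : R | 0 < x] (@Num.sqrt R).
Proof.
elim=> [|k IH]; first by move=> x _; exact: sqrt_continuous.
apply: (@class_CS_real _ _ _ _ (fun x => (2 * Num.sqrt x)^-1)).
  exact: open_gt.
have oU : open [set x : R | 0 < x] by exact: open_gt.
have H : class_C k [set x : R | 0 < x] (fun x => 2 * Num.sqrt x).
  by apply: class_CM => //; exact: class_C_cst.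
apply: (class_C_comp_real oU _ smooth_inv H) => x x0.
by rewrite /= mulf_neq0// gt_eqF// sqrtr_gt0.
Qed.

Definition logit x : R := ln x - ln (1 - x).

(* The solution [y] of [logit x = (1 - y)^-1 - y^-1], a quadratic equation. *)
Definition step_inv x : R :=
  2 / ((2 - logit x) + Num.sqrt (logit x * logit x + 4)).

Lemma sqr4_gt0 u : 0 < u * u + 4.
Proof. by rewrite ltr_pwDr// -expr2 sqr_ge0. Qed.

(** The root of the quadratic equation has its radical in the denominator because the usual form
    divides by [logit x], which vanishes at 1/2. A denominator above 2 yields both smoothness and
    [step_inv x < 1]. *)
Lemma step_inv_den u : 2 < 2 - u + Num.sqrt (u * u + 4).
Proof.
suff : u < Num.sqrt (u * u + 4) by lra.
rewrite (le_lt_trans (ler_norm u))// -sqrtr_sqr ltr_sqrt ?sqr4_gt0//.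
by rewrite expr2 ltrDl.
Qed.

Lemma smooth_step_inv : smooth [set x : R | 0 < x < 1] step_inv.
Proof.
have oU : open [set x : R | 0 < x < 1].
  rewrite (_ : [set x | _] = [set x | x > 0] `&` [set x | x < 1]).
    by apply: openI; [exact: open_gt|exact: open_lt].
  by apply/seteqP; split=> x /= => [/andP|[-> ->]].
have sl : smooth [set x : R | 0 < x < 1] logit.
  apply: smoothD => //.
    by apply: smooth_sub smooth_ln => x /= /andP[].
  apply: smoothN => //.
  apply: (smooth_comp_real oU _ smooth_ln) => [x /= /andP[_]|].
    by rewrite subr_gt0.
  apply: smoothD => //; first exact: smooth_cst.
  apply: smoothN => //.
  by apply: (@smooth_lin _ _ _ _ idfun) => // y; exact: cvg_id.
apply: smoothM => //; first exact: smooth_cst.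
apply: smoothV => // [x _|].
  by rewrite gt_eqF// (lt_trans _ (step_inv_den _)).
apply: smoothD => //.
  by apply: smoothD => //; [exact: smooth_cst|exact: smoothN].
apply: (smooth_comp_real oU _ smooth_sqrt) => [x _|]; first exact: sqr4_gt0.
by apply: smoothD => //; [exact: smoothM|exact: smooth_cst].
Qed.

Lemma step_inv_itv x : 0 < step_inv x < 1.
Proof.
have := step_inv_den (logit x); rewrite /step_inv; move: (_ + _) => d d2.
by rewrite ltr_pdivrMr ?mul1r ?d2 ?andbT ?divr_gt0//; lra.
Qed.

(** On []0, 1[] the step is the logistic function of [(1 - x)^-1 - x^-1]. Its logit is therefore
    rational, and inverting the step amounts to solving a quadratic equation. *)
Lemma stepE x : 0 < x < 1 -> step x = (1 + expR (x^-1 - (1 - x)^-1))^-1.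
Proof.
move=> /andP[x0 x1]; rewrite /step !flat1E x0 subr_gt0 x1.
rewrite expRD expRN (expRN (1 - x)^-1).
have e1 := expR_gt0 x^-1; have e2 := expR_gt0 (1 - x)^-1.
by field; rewrite !gt_eqF//= addr_gt0.
Qed.

Lemma step_itv x : 0 < x < 1 -> 0 < step x < 1.
Proof.
move=> x01; rewrite stepE //; set e := expR _; have e0 : 0 < e := expR_gt0 _.
by rewrite invr_gt0 invf_lt1; lra.
Qed.

Lemma logit_step x : 0 < x < 1 -> logit (step x) = (1 - x)^-1 - x^-1.
Proof.
move=> x01; have /andP[s0 s1] := step_itv x01.
rewrite /logit -ln_div ?posrE ?subr_gt0// -[RHS]expRK; congr ln.
rewrite stepE // -opprB expRN; set e := expR _.
have e0 : 0 < e := expR_gt0 _.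
by field; rewrite !gt_eqF//; lra.
Qed.

Lemma stepK x : 0 < x < 1 -> step_inv (step x) = x.
Proof.
move=> x01; rewrite /step_inv logit_step//.
move: x01 => /andP[x0 x1]; have x1' : 0 < 1 - x by rewrite subr_gt0.
(* With [a = (1 - x)^-1] and [c = x^-1] one has [a * c = a + c], so the radicand is a perfect
   square. *)
have -> : ((1 - x)^-1 - x^-1) * ((1 - x)^-1 - x^-1) + 4 =
    (((1 - x)^-1 + x^-1) - 2) ^+ 2.
  by field; rewrite !gt_eqF.
rewrite sqrtr_sqr ger0_norm; last first.
  have : 1 <= x^-1 by rewrite invf_ge1// ltW.
  have : 1 <= (1 - x)^-1 by rewrite invf_ge1//; lra.
  lra.
by field; rewrite !gt_eqF//; lra.
Qed.

Lemma step_invK x : 0 < x < 1 -> step (step_inv x) = x.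
Proof.
move=> /andP[x0 x1]; rewrite stepE ?step_inv_itv//.
have Hd := step_inv_den (logit x); have l2 := sqr_sqrtr (ltW (sqr4_gt0 (logit x))).
have -> : (step_inv x)^-1 - (1 - step_inv x)^-1 = - logit x.
  rewrite /step_inv.
  move: (logit x) (Num.sqrt _) Hd l2 => l r Hd l2.
  have rl : r - l != 0 by rewrite gt_eqF; lra.
  apply/eqP; rewrite -subr_eq0 opprK; apply/eqP.
  have -> : (2 / (2 - l + r))^-1 - (1 - 2 / (2 - l + r))^-1 + l
     = (r ^+ 2 - l * l - 4) / (2 * (r - l)).
    by field; rewrite rl !gt_eqF; lra.
  by rewrite l2; field.
rewrite opprB expRD expRN !lnK ?posrE ?subr_gt0//.
by field; rewrite !gt_eqF//; lra.
Qed.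

End smooth_step.

(** * Sheets of a covering *)

Lemma within_near (S T : topologicalType) (D : set S) (f : S -> T) z (U : set T) :
  {within D, continuous f} -> D z -> nbhs (f z) U ->
  \forall x \near z, D x -> U (f x).
Proof.
by move=> /subspace_continuousP cf Dz nU; have := cf z Dz U nU; exact.
Qed.

Section sheets.
Context {M : topologicalType} {Z : Type} (q : M -> Z) (n : nat).
Hypothesis M_hausdorff : hausdorff_space M.

(** A trivialization over [D] of the pullback of [q] along [phi]. The parameter [phi] lets the same
    lemmas serve the sphere, with [phi = id], and the plane. Openness of the slices is replaced by
    the Hausdorff property of [M] together with the finiteness of [n]. *)
Definition sheets (T : topologicalType) (phi : T -> Z) (D : set T)
    (s : 'I_n -> T -> M) :=
  [/\ forall i, {within D, continuous (s i)},
      forall i z, D z -> q (s i z) = phi z &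
      forall m z, D z -> q m = phi z -> exists! i, s i z = m].

Lemma sheets_inj (T : topologicalType) (phi : T -> Z) D s i j z :
  sheets phi D s -> D z -> s i z = s j z -> i = j.
Proof.
move=> [_ qs us] Dz ij; have [k [ki uk]] := us _ z Dz (qs i z Dz).
by rewrite -(uk i erefl); apply: uk.
Qed.

Lemma sheets_surj (T : topologicalType) (phi : T -> Z) D s m z :
  sheets phi D s -> D z -> q m = phi z -> exists i, s i z = m.
Proof. by move=> [_ _ us] Dz qm; have [i [im _]] := us m z Dz qm; exists i. Qed.

Lemma sheets_cvg (T : topologicalType) (phi : T -> Z) D s i z :
  sheets phi D s -> D z -> s i x @[x --> within D (nbhs z)] --> s i z.
Proof. by move=> [cs _ _]; move: (cs i) => /subspace_continuousP; apply. Qed.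

Lemma sheets_near (T : topologicalType) (phi : T -> Z) D s i z (U : set M) :
  sheets phi D s -> D z -> nbhs (s i z) U ->
  \forall x \near z, D x -> U (s i x).
Proof. by move=> [cs _ _]; apply: within_near; exact: cs. Qed.

Lemma sheets_sub (T : topologicalType) (phi : T -> Z) (D D' : set T) s :
  D' `<=` D -> sheets phi D s -> sheets phi D' s.
Proof.
move=> D'D [cs qs us]; split.
- by move=> i; exact: continuous_subspaceW (cs i).
- by move=> i z /D'D; exact: qs.
- by move=> m z /D'D; exact: us.
Qed.

Lemma sheets_pullback (T T' : topologicalType) (phi : T -> Z) (psi : T' -> T)
    (D : set T) (D' : set T') s :
  {within D', continuous psi} -> (forall z, D' z -> D (psi z)) ->
  sheets phi D s -> sheets (phi \o psi) D' (fun i => s i \o psi).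
Proof.
move=> cpsi D'D Ds; have [_ qs us] := Ds; split.
- move=> i; apply/subspace_continuousP => z D'z.
  apply: cvg_comp (sheets_cvg Ds (D'D z D'z)).
  move: cpsi => /subspace_continuousP /(_ z D'z) cpsi.
  move=> U nU; have := cpsi _ nU.
  rewrite /nbhs /= /within /= => H; near=> x => D'x.
  by apply: (near H x) => //; exact: D'D.
- by move=> i z /D'D; exact: qs.
- by move=> m z /D'D; exact: us.
Unshelve. all: by end_near. Qed.

(** For [i != j] the limits of [tau i] and [sigma] are separated by disjoint open sets, so among
    finitely many candidates only [tau j] can eventually meet [sigma]. A general filter covers both
    [nbhs] and [within]. *)
Lemma agree_near (T : Type) (F : set_system T) {FF : Filter F} (sigma : T -> M)
    (tau : 'I_n -> T -> M) (m0 : M) (t0 : 'I_n -> M) j :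
  sigma @ F --> m0 -> (forall i, tau i @ F --> t0 i) ->
  (forall i, t0 i = m0 -> i = j) ->
  (\forall x \near F, exists i, tau i x = sigma x) ->
  \forall x \near F, tau j x = sigma x.
Proof.
move=> cs ct t0j ex; have sep i : \forall x \near F, i != j -> tau i x <> sigma x.
  have [->|ij] := eqVneq i j; first by near=> x.
  have : t0 i != m0 by apply: contra_neq ij; exact: t0j.
  move: M_hausdorff; rewrite open_hausdorff => /[apply].
  move=> [[A B] /= [/set_mem Ai /set_mem Bm] [oA oB /eqP AB]].
  have nA : \forall x \near F, A (tau i x) by apply: ct; exact: open_nbhs_nbhs.
  have nB : \forall x \near F, B (sigma x) by apply: cs; exact: open_nbhs_nbhs.
  near=> x => _ E; suff : (A `&` B) (sigma x) by rewrite AB.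
  split; last by near: x.
  by rewrite -E; near: x.
have {}sep : \forall x \near F, forall i, i != j -> tau i x <> sigma x.
  exact: filter_forall.
near=> x; have [i ix] : exists i, tau i x = sigma x by near: x.
have [<-//|ij] := eqVneq i j.
by exfalso; move: ij ix; apply: (near sep x).
Unshelve. all: by end_near. Qed.

Lemma sheets_agree (T : topologicalType) (phi : T -> Z) (D D' : set T) s
    (sigma : T -> M) z j :
  sheets phi D s -> {within D', continuous sigma} ->
  (forall x, D' x -> D x -> q (sigma x) = phi x) -> D z -> D' z ->
  s j z = sigma z ->
  \forall x \near z, D x -> D' x -> s j x = sigma x.
Proof.
move=> Ds cs qs Dz D'z E.
have W : \forall x \near within (D `&` D') (nbhs z), s j x = sigma x.
  have wD U : within D (nbhs z) U -> within (D `&` D') (nbhs z) U.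
    by rewrite /within /=; apply: filterS => x + [Dx _]; apply.
  have wD' U : within D' (nbhs z) U -> within (D `&` D') (nbhs z) U.
    by rewrite /within /=; apply: filterS => x + [_ Dx]; apply.
  apply: (@agree_near _ _ _ sigma s (sigma z) (s^~ z)).
  - move=> U /= nU; apply: wD'.
    by move: cs => /subspace_continuousP /(_ z D'z); exact.
  - by move=> i U /= nU; apply: wD; exact: sheets_cvg Ds Dz U nU.
  - by move=> i; rewrite -E; apply: sheets_inj Ds Dz.
  - rewrite near_withinE; apply: nearW => x [Dx D'x].
    exact: (sheets_surj Ds Dx (qs x D'x Dx)).
by move: W; rewrite near_withinE; apply: filterS => x H Dx D'x; exact: H.
Qed.

Lemma sheets_glue (T : topologicalType) (phi : T -> Z) (U D1 D2 : set T) s1 s2 :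
  open U -> closed D1 -> closed D2 ->
  sheets phi (U `&` D1) s1 -> sheets phi (U `&` D2) s2 ->
  (forall i z, U z -> D1 z -> D2 z -> s1 i z = s2 i z) ->
  sheets phi (U `&` (D1 `|` D2))
    (fun i z => if `[< D1 z >] then s1 i z else s2 i z).
Proof.
move=> oU cD1 cD2 S1 S2 s12; have [_ q1 u1] := S1; have [_ q2 u2] := S2.
have E i z : U z -> D2 z -> (if `[< D1 z >] then s1 i z else s2 i z) = s2 i z.
  by case: asboolP => // D1z Uz; exact: s12.
have out (D : set T) z : closed D -> ~ D z -> \forall x \near z, ~ D x.
  by move=> /closed_openC oD Dz; exact: (open_nbhs_nbhs (conj oD Dz)).
split.
- move=> i; apply/subspace_continuousP => z [Uz Dz].
  rewrite /from_subspace => V /= nV.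
  have n1 : \forall x \near z, U x -> D1 x -> V (s1 i x).
    case: (pselect (D1 z)) => D1z; last first.
      by apply: filterS (out _ _ cD1 D1z) => x.
    have nV1 : nbhs (s1 i z) V by move: nV; rewrite asboolT.
    by apply: filterS (sheets_near S1 (conj Uz D1z) nV1) => x + Ux D1x; apply.
  have n2 : \forall x \near z, U x -> D2 x -> V (s2 i x).
    case: (pselect (D2 z)) => D2z; last first.
      by apply: filterS (out _ _ cD2 D2z) => x.
    have nV2 : nbhs (s2 i z) V by move: nV; rewrite E.
    by apply: filterS (sheets_near S2 (conj Uz D2z) nV2) => x + Ux D2x; apply.
  suff H : \forall x \near z, (U `&` (D1 `|` D2)) x ->
      V (if `[< D1 x >] then s1 i x else s2 i x) by exact: H.
  near=> x => -[Ux [D1x|D2x]].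
    by case: asboolP => // _; exact: (near n1 x).
  by rewrite E //; exact: (near n2 x).
- move=> i z [Uz]; case: asboolP => D1z; first by move=> _; exact: q1.
  by case=> // D2z; exact: q2.
- move=> m z [Uz]; case: asboolP => D1z; first by move=> _; exact: u1.
  by case=> // D2z; exact: u2.
Unshelve. all: by end_near. Qed.

Lemma sheets_perm (T : topologicalType) (phi : T -> Z) (D : set T) s
    (pi pi' : 'I_n -> 'I_n) : cancel pi pi' -> cancel pi' pi ->
  sheets phi D s -> sheets phi D (fun i => s (pi i)).
Proof.
move=> pK pK' [cs qs us]; split => //.
- by move=> i z; exact: qs.
- move=> m z Dz qm; have [i [im ui]] := us m z Dz qm.
  exists (pi' i); split; first by rewrite pK'.
  by move=> j jm; rewrite (ui _ jm) pK.
Qed.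

Lemma sheets_match (T : topologicalType) (phi : T -> Z) (D1 D2 : set T) s1 s2 z :
  sheets phi D1 s1 -> sheets phi D2 s2 -> D1 z -> D2 z ->
  exists pi : 'I_n -> 'I_n, [/\ injective pi & forall i, s2 (pi i) z = s1 i z].
Proof.
move=> S1 S2 D1z D2z; have [_ q1 _] := S1.
have /choice[pi piE] : forall i, exists j, s2 j z = s1 i z.
  by move=> i; apply: sheets_surj S2 D2z _; exact: q1.
exists pi; split=> // i j ij.
by apply: (sheets_inj S1 D1z); rewrite -!piE ij.
Qed.

Lemma sheets_glue_perm (T : topologicalType) (phi : T -> Z) (U D1 D2 : set T)
    s1 s2 (pi : 'I_n -> 'I_n) : injective pi ->
  open U -> closed D1 -> closed D2 ->
  sheets phi (U `&` D1) s1 -> sheets phi (U `&` D2) s2 ->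
  (forall i z, U z -> D1 z -> D2 z -> s2 (pi i) z = s1 i z) ->
  exists s, sheets phi (U `&` (D1 `|` D2)) s.
Proof.
move=> pi_inj oU cD1 cD2 S1 S2 s12.
have S2' := sheets_perm (finv_f pi_inj) (f_finv pi_inj) S2.
by eexists; apply: sheets_glue oU cD1 cD2 S1 S2' _ => i z Uz D1z D2z; rewrite s12.
Qed.

(** Labels need to be matched only at [z]: by [sheets_agree] the matched sheets coincide near [z],
    and [V] is shrunk accordingly. *)
Lemma sheets_glue_local (T : topologicalType) (phi : T -> Z) (U D1 D2 : set T)
    s1 s2 z :
  open U -> closed D1 -> closed D2 ->
  sheets phi (U `&` D1) s1 -> sheets phi (U `&` D2) s2 ->
  U z -> D1 z -> D2 z ->
  exists2 V, open V /\ V z & exists s, sheets phi (V `&` (D1 `|` D2)) s.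
Proof.
move=> oU cD1 cD2 S1 S2 Uz D1z D2z.
have UD1z : (U `&` D1) z by []. have UD2z : (U `&` D2) z by [].
have [pi [pi_inj piE]] := sheets_match S1 S2 UD1z UD2z.
have [c1 q1 _] := S1.
have : \forall x \near z, forall i, U x -> D1 x -> D2 x -> s2 (pi i) x = s1 i x.
  apply: filter_forall => i.
  have : \forall x \near z, (U `&` D2) x -> (U `&` D1) x -> s2 (pi i) x = s1 i x.
    by apply: sheets_agree S2 (c1 i) _ _ _ (piE i) => // y UD1y _; exact: q1.
  by apply: filterS => x H Ux D1x D2x; apply: H.
rewrite -nbhs_nearE nbhsE => -[W [oW Wz] HW].
exists (U `&` W); first by split; [exact: openI|].
apply: (sheets_glue_perm pi_inj (openI oU oW) cD1 cD2).
- by apply: sheets_sub S1 => x [[]].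
- by apply: sheets_sub S2 => x [[]].
- by move=> i x [Ux Wx]; exact: HW.
Qed.

Lemma connected_ind (T : topologicalType) (D P : set T) z0 z :
  connected D -> D z0 -> P z0 -> 
  (forall x, D x -> P x -> \forall y \near x, D y -> P y) ->
  (forall x, D x -> ~ P x -> \forall y \near x, D y -> ~ P y) ->
  D z -> P z.
Proof.
move=> cD Dz0 Pz0 HP HN Dz.
suff : D `&` P = D by move=> DP; have : D z := Dz; rewrite -DP => -[].
apply: cD.
- by exists z0.
- exists [set x | D x -> P x]°; first exact: open_interior.
  apply/seteqP; split=> x [Dx H]; split=> //; first exact: HP.
  by move: H => /interior_subset; exact.
- exists (~` [set x | D x -> ~ P x]°).
    exact/open_closedC/open_interior.
  apply/seteqP; split=> x [Dx H]; split=> //.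
    by move=> /interior_subset; exact.
  by apply: contrapT => nP; apply: H; exact: HN.
Qed.

(** The set of agreement is open in [D], and so is its complement: there [s1 i] runs locally along
    another sheet [k] of [s2]. *)
Lemma sheets_match_connected (T : topologicalType) (phi : T -> Z)
    (D1 D2 D : set T) s1 s2 z i j :
  connected D -> D `<=` D1 `&` D2 ->
  sheets phi D1 s1 -> sheets phi D2 s2 -> D z -> s2 j z = s1 i z ->
  forall x, D x -> s2 j x = s1 i x.
Proof.
move=> cD DD S1 S2 Dz E x Dx.
have [c1 q1 _] := S1.
apply: (@connected_ind _ D [set x | s2 j x = s1 i x] z) => // {x Dx}x Dx /=.
  have [D1x D2x] := DD _ Dx => {}E.
  have : \forall y \near x, D2 y -> D1 y -> s2 j y = s1 i y.
    by apply: sheets_agree S2 (c1 i) _ _ _ E => // y D1y _; exact: q1.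
  by apply: filterS => y H /DD[D1y D2y]; exact: H.
have [D1x D2x] := DD _ Dx => NE.
have [k kE] := sheets_surj S2 D2x (q1 i x D1x).
have : \forall y \near x, D2 y -> D1 y -> s2 k y = s1 i y.
  by apply: sheets_agree S2 (c1 i) _ _ _ kE => // y D1y _; exact: q1.
apply: filterS => y H /[dup] Dy /DD[D1y D2y]; rewrite -(H D2y D1y).
by move=> /(sheets_inj S2 D2y) jk; apply: NE; rewrite jk.
Qed.

Lemma sheets_relabel (T : topologicalType) (phi : T -> Z) (D1 D2 D : set T) s1 s2 :
  connected D -> D `<=` D1 `&` D2 -> sheets phi D1 s1 -> sheets phi D2 s2 ->
  exists pi : 'I_n -> 'I_n, injective pi /\
    forall i z, D z -> s2 (pi i) z = s1 i z.
Proof.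
move=> cD DD S1 S2.
case: (pselect (exists z, D z)) => [[z Dz]|D0]; last first.
  by exists id; split=> // i z Dz; exfalso; apply: D0; exists z.
have [D1z D2z] := DD _ Dz.
have [pi [pi_inj piE]] := sheets_match S1 S2 D1z D2z.
exists pi; split=> // i x Dx.
exact: sheets_match_connected cD DD S1 S2 Dz (piE i) x Dx.
Qed.

End sheets.

(** Compactness of [[a, b]] by way of a supremum: the set of [t] with [P a t] contains its supremum,
    and the local hypothesis carries it further unless the supremum is [b]. *)
Lemma interval_induction (R : realType) (P : R -> R -> Prop) (a b : R) :
  a <= b ->
  (forall x y z, a <= x -> x <= y -> y <= z -> z <= b -> P x y -> P y z -> P x z) ->
  (forall x, a <= x <= b -> exists2 e, 0 < e & forall c d,
     a <= c -> c <= d -> d <= b -> x - e <= c -> d <= x + e -> P c d) ->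
  P a b.
Proof.
move=> ab Padd Ploc; pose S := [set t | a <= t <= b /\ P a t].
have Sa : S a.
  split; first by rewrite lexx.
  have [|e e0 He] := Ploc a; first by rewrite lexx.
  by apply: He => //; lra.
have hS : has_sup S by split; [exists a|exists b => t [/andP[]]].
have st_a : a <= sup S by apply: ub_le_sup => //; have [] := hS.
have st_b : sup S <= b by apply: ge_sup => [|t [/andP[]]//]; exists a.
have [|e e0 He] := Ploc (sup S); first by rewrite st_a st_b.
have [t [/andP[ta tb] Pat] te] := sup_adherent e0 hS.
have tsup : t <= sup S by apply: ub_le_sup; [case: hS|split; rewrite ?ta].
pose d := Num.min (sup S + e) b.
have td : t <= d by rewrite le_min tb andbT; lra.
have db : d <= b by rewrite ge_min lexx orbT.
have Sd : S d.
  split; first by rewrite db (le_trans ta).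
  apply: (Padd a t d) => //; apply: He => //; first by lra.
  by rewrite ge_min lexx.
have : d <= sup S by apply: ub_le_sup => //; case: hS.
have dE : d = sup S + e \/ d = b by rewrite /d; case: leP; [left|right].
case: dE => [->|dE _]; first by lra.
by rewrite -dE; case: Sd.
Qed.

(** * Sheets over a planar region whose rows are intervals *)

Section planar_sheets.
Context {R : realType} {M : topologicalType} {Z : Type} (q : M -> Z) (n : nat).
Hypothesis M_hausdorff : hausdorff_space M.
Variables (m0 : M) (phi : R * R -> Z).
Local Notation sheets := (@sheets M Z q n _ phi).

Lemma sheets_glue_connected (D1 D2 : set (R * R)) s1 s2 :
  closed D1 -> closed D2 -> sheets D1 s1 -> sheets D2 s2 ->
  connected (D1 `&` D2) -> exists s, sheets (D1 `|` D2) s.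
Proof.
move=> cD1 cD2 S1 S2 cD.
have S1' : sheets (setT `&` D1) s1 by rewrite setTI.
have S2' : sheets (setT `&` D2) s2 by rewrite setTI.
have [pi [pi_inj piE]] := sheets_relabel M_hausdorff cD (fun=> id) S1 S2.
have [s] : exists s, sheets (setT `&` (D1 `|` D2)) s.
  by apply: sheets_glue_perm pi_inj openT cD1 cD2 S1' S2' _ => i z _ D1z D2z; exact: piE.
by rewrite setTI; exists s.
Qed.

Definition locally_sheeted z :=
  exists2 U, open U /\ U z & exists s, sheets U s.

Variables (X : R) (D : set (R * R)).
Hypotheses (X_ge0 : 0 <= X) (cD : closed D)
  (D_bnd : forall z, D z -> `|z.1| <= X /\ `|z.2| <= X)
  (D_itv : forall y, is_interval [set x | D (x, y)])
  (D_shrink : forall y0, exists2 e, 0 < e &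
     forall x y, `|y - y0| <= e -> D (x, y) -> D (x, y0))
  (D_loc : forall z, D z -> locally_sheeted z).

Lemma sheets_set0 (A : set (R * R)) : (forall z, ~ A z) ->
  sheets A (fun _ _ => m0).
Proof.
move=> A0; split=> [i|i z /A0//|m z /A0//].
by apply/subspace_continuousP => z /A0.
Qed.

Lemma closed_preimage (T T' : topologicalType) (f : T -> T') (A : set T') :
  continuous f -> closed A -> closed (f @^-1` A).
Proof. by move=> cf cA; apply: closed_comp => // x _; exact: cf. Qed.

Lemma closed_strip (f : R * R -> R) (a b : R) :
  continuous f -> closed [set z | a <= f z <= b].
Proof.
move=> cf; rewrite (_ : [set z | _] = f @^-1` `[a, b]).
  by apply: closed_preimage => //; exact: interval_closed.
by apply/seteqP; split=> z /=; rewrite in_itv.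
Qed.

Lemma pairx_continuous (x : R) : continuous (fun y : R => (x, y)).
Proof. by move=> y; apply: (@continuous_pair _ _ _ (fun=> x) id); [exact: cvg_cst|exact: cvg_id]. Qed.

Lemma pairy_continuous (y : R) : continuous (fun x : R => (x, y)).
Proof. by move=> x; apply: (@continuous_pair _ _ _ id (fun=> y)); [exact: cvg_id|exact: cvg_cst]. Qed.

(** A piece of the row of [D] at height [y0], thickened to a product. It may leave [D]; for small
    [e] the open sets of [locally_sheeted] still provide sheets there. *)
Let row (y0 e a b : R) : set (R * R) :=
  [set z | a <= z.1 <= b] `&` [set z | y0 - e <= z.2 <= y0 + e] `&`
  [set z | D (z.1, y0)].

Let closed_row y0 e a b : closed (row y0 e a b).
Proof.
apply: closedI.
  by apply: closedI; apply: closed_strip => z; [exact: cvg_fst|exact: cvg_snd].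
apply: (@closed_preimage _ _ (fun z : R * R => (z.1, y0))) => // z.
by apply: (@continuous_pair _ _ _ fst (fun=> y0)); [exact: cvg_fst|exact: cvg_cst].
Qed.

Lemma sheets_row y0 : exists2 e, 0 < e & exists s, sheets (row y0 e (- X) X) s.
Proof.
pose P a b := exists2 e, 0 < e & exists s, sheets (row y0 e a b) s.
have row_sub e e' a b s : e' <= e -> sheets (row y0 e a b) s ->
    sheets (row y0 e' a b) s.
  move=> ee; apply: sheets_sub => z [[h0 /= /andP[h1 h2]] h3].
  by split=> //; split=> //=; apply/andP; split; lra.
apply: (@interval_induction R P) => [|x y z ax xy yz zb|x xX].
- by rewrite (le_trans _ X_ge0)// oppr_le0.
- move=> [e1 e10 [s1 S1]] [e2 e20 [s2 S2]].
  pose e := Num.min e1 e2; exists e; first by rewrite lt_min e10.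
  have {}S1 : sheets (row y0 e x y) s1 by apply: row_sub S1; rewrite ge_min lexx.
  have {}S2 : sheets (row y0 e y z) s2.
    by apply: row_sub S2; rewrite ge_min lexx orbT.
  (* Adjacent pieces share a vertical segment or nothing at all. *)
  have cI : connected (row y0 e x y `&` row y0 e y z).
    case: (pselect (D (y, y0))) => [Dy|nDy].
      rewrite (_ : _ `&` _ = (fun t => (y, t)) @` `[y0 - e, y0 + e]).
        apply: connected_continuous_connected; first exact: segment_connected.
        exact/continuous_subspaceT/pairx_continuous.
      apply/seteqP; split=> [[u v]|_ [v + <-]].
        move=> [[[/= /andP[h1 h2] h3] h4] [[/= /andP[h5 h6] _] _]].
        by exists v; rewrite /= ?in_itv //=; congr (_, _); lra.
      rewrite /= in_itv /= => yv.
      by split; split=> //; split=> //=; rewrite ?lexx ?xy ?yz.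
    rewrite (_ : _ `&` _ = set0); first exact: connected0.
    apply/seteqP; split=> [[u v]|//].
    move=> [[[/= /andP[h1 h2] h3] h4] [[/= /andP[h5 h6] _] _]].
    by apply: nDy; rewrite (_ : y = u)//; lra.
  have [s S] := sheets_glue_connected (@closed_row _ _ _ _) (@closed_row _ _ _ _)
    S1 S2 cI.
  exists s; apply: sheets_sub S => -[u v] [[/= /andP[h1 h2] h3] h4].
  by case: (leP u y) => uy; [left|right]; split=> //; split=> //=;
    rewrite ?h1 ?h2 ?uy ?(ltW uy).
- case: (pselect (D (x, y0))) => [Dx|nDx].
    have [U [oU Ux] [s S]] := D_loc Dx.
    have : nbhs (x, y0) U by exact: open_nbhs_nbhs.
    move=> /nbhs_ballP[r /= r0 rU].
    have r20 : 0 < r / 2 by lra.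
    exists (r / 2) => // c d _ cd _ xc dx.
    exists (r / 2) => //; exists s; apply: sheets_sub S => -[u v].
    move=> [[/= /andP[h1 h2] /andP[h3 h4]] _].
    by apply: rU; split; rewrite /= /ball /= ltr_norml; lra.
  have cslice : closed [set x' | D (x', y0)].
    exact: closed_preimage (@pairy_continuous y0) cD.
  have : nbhs x (~` [set x' | D (x', y0)]).
    exact: (open_nbhs_nbhs (conj (closed_openC cslice) nDx)).
  move=> /nbhs_ballP[r /= r0 rD].
  exists (r / 2) => [|c d _ cd _ xc dx]; first by lra.
  (* This piece is empty, and [m0] is a dummy value. *)
  exists 1 => //; exists (fun _ _ => m0); apply: sheets_set0 => -[u v].
  move=> [[/= /andP[h1 h2] _]]; apply: rD.
  by rewrite /ball /= ltr_norml; lra.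
Qed.

(** By [D_shrink] a thin slab of [D] around a row lies in the thickened row of [sheets_row].
    Consecutive slabs meet in a single row, which is connected by [D_itv], so they can be stacked by
    [interval_induction]. *)
Lemma sheets_planar : exists s, sheets D s.
Proof.
pose C (a b : R) := D `&` [set z | a <= z.2 <= b].
have cC a b : closed (C a b).
  by apply: closedI => //; apply: closed_strip => z; exact: cvg_snd.
suff [s S] : exists s, sheets (C (- X) X) s.
  exists s; apply: sheets_sub S => z Dz; split=> //=.
  by rewrite -ler_norml; have [] := D_bnd Dz.
apply: (@interval_induction R (fun a b => exists s, sheets (C a b) s)).
- by rewrite (le_trans _ X_ge0)// oppr_le0.
- move=> x y z ax xy yz zb [s1 S1] [s2 S2].
  have cI : connected (C x y `&` C y z).
    rewrite (_ : _ `&` _ = (fun t => (t, y)) @` [set t | D (t, y)]).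
      apply: connected_continuous_connected; first exact/connected_intervalP.
      exact/continuous_subspaceT/pairy_continuous.
    apply/seteqP; split=> [[u v]|_ [u Du <-]].
      move=> [[Duv /= /andP[h1 h2]] [_ /= /andP[h3 h4]]].
      have -> : v = y by lra.
      by exists u => //; rewrite (_ : y = v)//; lra.
    by split; split=> //=; rewrite lexx ?xy ?yz.
  have [s S] := sheets_glue_connected (@cC _ _) (@cC _ _) S1 S2 cI.
  exists s; apply: sheets_sub S => -[u v] [Duv /= /andP[h1 h2]].
  by case: (leP v y) => vy; [left|right]; split=> //=;
    rewrite ?h1 ?h2 ?vy ?(ltW vy).
- move=> y yX; have [e1 e10 [s S]] := sheets_row y.
  have [e2 e20 HD] := D_shrink y.
  have [e [e0 ee1 ee2]] : exists e, [/\ 0 < e, e <= e1 & e <= e2].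
    exists (Num.min e1 e2).
    by rewrite lt_min e10 e20 !ge_min !lexx orbT.
  exists e => // c d _ cd _ yc dy.
  exists s; apply: sheets_sub S => -[u v] [Duv /= /andP[h1 h2]].
  have [/= Xu _] := D_bnd Duv.
  split; last by apply: (HD u v) => //; rewrite ler_norml; lra.
  by split=> /=; [rewrite -ler_norml|lra].
Qed.

End planar_sheets.

(** * The covering near the branch points *)

Section complex_plane.
Context {R : realType}.
Local Open Scope complex_scope.
Local Notation C := (R[i]^o).

Lemma normRe_le (z : R[i]) : `|complex.Re z|%:C <= `|z|.
Proof. exact: normc_ge_Re. Qed.

Lemma normIm_le (z : R[i]) : `|complex.Im z|%:C <= `|z|.
Proof.
rewrite normc_def lecR -sqrtr_sqr; apply: ler_wsqrtr.
by rewrite lerDr sqr_ge0.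
Qed.

Lemma continuous_Re : continuous (fun z : C => complex.Re z).
Proof.
move=> z; have FF : Filter (nbhs (z : C)) by exact: nbhs_filter.
apply/(@cvgrPdist_lt R R C (nbhs (z : C))) => e e0.
have e0' : (0 : R[i]) < e%:C by rewrite ltcR.
near=> w; have wz : ball z e%:C w by near: w; exact: nbhsx_ballx.
rewrite -ltcR; apply: le_lt_trans wz; apply: le_trans (normRe_le _).
by rewrite lecR; case: (z) => a b; case: (w) => c d.
Unshelve. all: by end_near. Qed.

Lemma continuous_Im : continuous (fun z : C => complex.Im z).
Proof.
move=> z; have FF : Filter (nbhs (z : C)) by exact: nbhs_filter.
apply/(@cvgrPdist_lt R R C (nbhs (z : C))) => e e0.
have e0' : (0 : R[i]) < e%:C by rewrite ltcR.
near=> w; have wz : ball z e%:C w by near: w; exact: nbhsx_ballx.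
rewrite -ltcR; apply: le_lt_trans wz; apply: le_trans (normIm_le _).
by rewrite lecR; case: (z) => a b; case: (w) => c d.
Unshelve. all: by end_near. Qed.

Lemma continuous_Complex : continuous (fun z : R * R => (z.1 +i* z.2 : C)).
Proof.
move=> [a b]; apply/cvgrPdist_lt => e e0.
have [r [r0 ->]] : exists r : R, 0 < r /\ e = r%:C.
  exists (complex.Re e); move: e0; rewrite ltcE /= => /andP[/eqP e0 e1].
  by split=> //; case: e e0 {e1} => x y /= ->.
have r2 : 0 < r / 2 by lra.
have N : nbhs ((a, b) : R * R) (ball ((a, b) : R * R) (r / 2)).
  exact: (@nbhsx_ballx R (R * R)%type).
near=> w; have [/= wa wb] : ball ((a, b) : R * R) (r / 2) w by near: w.
rewrite /= normc_def ltcR /=.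
have h1 := wa; have h2 := wb.
rewrite /ball /= in h1 h2.
apply: (@le_lt_trans _ _ (`|a - w.1| + `|b - w.2|)); last by lra.
rewrite -[leRHS]ger0_norm ?addr_ge0// -sqrtr_sqr; apply: ler_wsqrtr.
rewrite -(real_normK (num_real (a - w.1))) -(real_normK (num_real (b - w.2))).
by rewrite sqrrD -addrA lerD2l lerDr mulrn_wge0// mulr_ge0.
Unshelve. all: by end_near. Qed.

Lemma unit_disk_compact : compact (@unit_disk R).
Proof.
pose A := [set z : R * R | z.1 * z.1 + z.2 * z.2 <= 1].
have cA : compact A.
  apply: (@subclosed_compact _ A (`[(-1 : R), 1]%classic `*` `[(-1 : R), 1]%classic)).
  - apply: (@closed_preimage (R * R)%type R
      (fun z => z.1 * z.1 + z.2 * z.2) [set x | x <= 1]); last exact: closed_le.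
    move=> z; apply: (@continuousD R R (R * R)%type (fun z => z.1 * z.1)
        (fun z => z.2 * z.2)).
      by apply: (@continuousM R (R * R)%type fst fst); exact: cvg_fst.
    by apply: (@continuousM R (R * R)%type snd snd); exact: cvg_snd.
  - by apply: compact_setX; exact: segment_compact.
  - by move=> [x y]; rewrite /A /= !in_itv /= => xy; split; nra.
have := continuous_compact (continuous_subspaceT continuous_Complex) cA.
congr compact; apply/seteqP; split=> [_ [[x y] /= xy <-]|[x y]].
  rewrite /unit_disk /= normc_def -[1]/(1%:C) lecR /= !expr2.
  by rewrite -sqrtr1; apply: ler_wsqrtr.
rewrite /unit_disk /= normc_def -[1]/(1%:C) lecR /= => xy; exists (x, y) => //=.
rewrite /A /= -!expr2; have h : 0 <= x ^+ 2 + y ^+ 2 by rewrite addr_ge0 ?sqr_ge0.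
by rewrite -(sqr_sqrtr h) expr_le1// sqrtr_ge0.
Qed.

Lemma de_moivre (t : R) d :
  (cos t +i* sin t) ^+ d = cos (d%:R * t) +i* sin (d%:R * t).
Proof.
elim: d => [|d IH]; first by rewrite mul0r cos0 sin0.
rewrite exprS IH -natr1 mulrDl mul1r cosD sinD; simpc.
by apply/eqP; rewrite eq_complex /=; apply/andP; split; apply/eqP; ring.
Qed.

(** On the right half-plane the argument is [atan (Im z / Re z)], so polar coordinates give a
    continuous root. Any other nonzero point is brought there by a division, as in
    [sheets_of_filled]. *)
Lemma root_branch (d : nat) : (0 < d)%N -> exists rt : R[i] -> R[i],
  forall z : R[i], 0 < complex.Re z ->
    rt z ^+ d = z /\ {for z : C, continuous (rt : C -> C)}.
Proof.
move=> d0; have dn0 : d%:R != 0 :> R by rewrite pnatr_eq0 -lt0n.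
pose rad (z : C) : R := Num.sqrt (complex.Re z ^+ 2 + complex.Im z ^+ 2).
pose arg (z : C) : R := atan (complex.Im z / complex.Re z).
pose r (z : C) := expR (ln (rad z) / d%:R).
exists (fun z => (r z * cos (arg z / d%:R)) +i* (r z * sin (arg z / d%:R))).
move=> z z0; have rad0 : 0 < rad z.
  by rewrite sqrtr_gt0 ltr_pwDl ?sqr_ge0// exprn_gt0.
split.
  have -> : (r z * cos (arg z / d%:R)) +i* (r z * sin (arg z / d%:R)) =
      (r z)%:C * (cos (arg z / d%:R) +i* sin (arg z / d%:R)).
    by simpc.
  rewrite exprMn de_moivre -rmorphXn /= /r -expRM_natl.
  rewrite mulrCA divff// mulr1 lnK ?posrE// mulrCA divff// mulr1.
  have E : sin (arg z) = complex.Im z / complex.Re z * cos (arg z).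
    rewrite -[X in X * _](@atanK R) /tan mulfVK// cos_atan invr_neq0//.
    by rewrite gt_eqF// sqrtr_gt0 ltr_pwDl// sqr_ge0.
  have F : rad z * cos (arg z) = complex.Re z.
    rewrite /arg cos_atan /rad.
    have -> : complex.Re z ^+ 2 + complex.Im z ^+ 2 =
        (complex.Re z) ^+ 2 * (1 + (complex.Im z / complex.Re z) ^+ 2).
      by field; rewrite gt_eqF.
    rewrite sqrtrM ?sqr_ge0// sqrtr_sqr gtr0_norm// mulfK//.
    by rewrite gt_eqF// sqrtr_gt0 ltr_pwDl// sqr_ge0.
  case: z z0 rad0 E F => a b /= a0 rad0 E F; simpc; rewrite E mulrCA F.
  by congr (_ +i* _); field; rewrite gt_eqF.
have cRe : {for z, continuous (fun z : C => complex.Re z)} by exact: continuous_Re.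
have cIm : {for z, continuous (fun z : C => complex.Im z)} by exact: continuous_Im.
have crad : {for z, continuous rad}.
  apply: (@continuous_comp _ _ _
    (fun z : C => complex.Re z ^+ 2 + complex.Im z ^+ 2) Num.sqrt).
    by apply: continuousD; [exact: (continuousM cRe cRe)|exact: (continuousM cIm cIm)].
  exact: sqrt_continuous.
have carg : {for z, continuous (fun z => arg z / d%:R)}.
  apply: (@continuousM R C arg (fun=> d%:R^-1)); last exact: cst_continuous.
  apply: (@continuous_comp _ _ _ (fun z : C => complex.Im z / complex.Re z) atan).
    apply: (@continuousM R C (fun z => complex.Im z)
      (fun z => (complex.Re z)^-1)) => //.
    apply: (@continuousV R C (fun z => complex.Re z)) => //.
    by rewrite gt_eqF.
  exact: continuous_atan.
have cr : {for z, continuous r}.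
  apply: (@continuous_comp _ _ _ (fun z => ln (rad z) / d%:R) expR).
    apply: (@continuousM R C (fun z => ln (rad z)) (fun=> d%:R^-1));
      last exact: cst_continuous.
    by apply: (@continuous_comp _ _ _ rad (@ln R)) => //; exact: continuous_ln.
  exact: continuous_expR.
apply: (@continuous_comp _ _ _
  (fun z => (r z * cos (arg z / d%:R), r z * sin (arg z / d%:R)))
  (fun p : R * R => (p.1 +i* p.2 : C))); last exact: continuous_Complex.
apply: continuous_pair.
  apply: (@continuousM R C r (fun z => cos (arg z / d%:R))) => //.
  apply: (@continuous_comp _ _ _ (fun z => arg z / d%:R) cos) => //.
  exact: continuous_cos.
apply: (@continuousM R C r (fun z => sin (arg z / d%:R))) => //.
apply: (@continuous_comp _ _ _ (fun z => arg z / d%:R) sin) => //.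
exact: continuous_sin.
Qed.

End complex_plane.

Section filled_disks.
Context {R : realType} {M : topologicalType} (q : M -> 'rV[R]_3) (n : nat).
Local Notation C := (R[i]^o).

Lemma continuous_inverse_compact (S T : topologicalType) (K : set S) (k : S -> T)
    (g : T -> S) : hausdorff_space T -> compact K -> {within K, continuous k} ->
  {in K &, injective k} -> (forall v, (k @` K) v -> K (g v) /\ k (g v) = v) ->
  {within k @` K, continuous g}.
Proof.
move=> hT cK ck k_inj gK; apply/subspace_continuousP => v Dv U.
rewrite /from_subspace nbhsE => -[W [oW Wv] WU].
have cKW : compact (K `&` ~` W).
  by apply: compact_closedI => //; exact: open_closedC.
have ckW : compact (k @` (K `&` ~` W)).
  apply: continuous_compact cKW.
  by apply: continuous_subspaceW ck => x [].
have clkW := compact_closed hT ckW.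
have nv : ~ (k @` (K `&` ~` W)) v.
  move=> [x [Kx nWx] kx]; apply: nWx; have [Kgv kgv] := gK v Dv.
  by rewrite (k_inj x (g v)) ?mem_set// kgv.
suff H : \forall x \near v, (k @` K) x -> U (g x) by exact: H.
have : nbhs v (~` (k @` (K `&` ~` W))).
  exact: (open_nbhs_nbhs (conj (closed_openC clkW) nv)).
apply: filterS => x nx Dx; apply: WU; apply: contrapT => nWx; apply: nx.
by have [Kgx kgx] := gK x Dx; exists (g x).
Qed.

(** Instead of counting roots, the [n] points over [y1] are carried to the fiber over [u]: in each
    disk, multiplication by a constant matches the roots of one nonzero number with those of
    another. *)
Lemma sheets_of_filled (y0 y1 u : 'rV[R]_3) (D : set 'rV[R]_3) (e : 'I_n -> M) :
  filled_by_powers q y0 D -> D y1 -> y1 <> y0 -> D u -> u <> y0 ->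
  injective e -> (forall i, q (e i) = y1) ->
  (forall m, q m = y1 -> exists i, e i = m) ->
  exists2 U, open U /\ U u & exists s : 'I_n -> 'rV[R]_3 -> M,
    sheets q id (U `&` D) s.
Proof.
move=> [k [ck k_inj kD k0 [l [d [c [d0 cc c_inj cD qc]]]]]] Dy1 y10 Du u0.
move=> e_inj qe e_surj.
have {}qc j (z : R[i]) : unit_disk z -> q (c j z) = k (z ^+ d j) by exact: qc.
have /choice[g gK] : forall v, exists z : R[i], (k @` unit_disk) v -> unit_disk z /\ k z = v.
  move=> v; case: (pselect ((k @` unit_disk) v)) => [[z Kz kz]|nv].
    by exists z.
  by exists 0.
have cg : {within D, continuous (g : 'rV[R]_3 -> C)}.
  rewrite -kD; apply: continuous_inverse_compact gK => //.
  exact: unit_disk_compact.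
rewrite kD in gK.
have d_inj (z w : R[i]) : unit_disk z -> unit_disk w -> k z = k w -> z = w.
  by move=> Kz Kw; apply: k_inj; exact: mem_set.
have diskX (z : R[i]) j : unit_disk z <-> unit_disk (z ^+ d j).
  by rewrite /unit_disk /= normrX expr_le1.
pose w0 := g u; pose w1 := g y1.
have [Kw0 kw0] := gK u Du; have [Kw1 kw1] := gK y1 Dy1.
have w00 : w0 != 0 by apply/eqP => w00; apply: u0; rewrite -kw0 -/w0 w00.
have w10 : w1 != 0 by apply/eqP => w10; apply: y10; rewrite -kw1 -/w1 w10.
(* Multiplication by [a j] maps the [d j]-th roots of [w1] onto those of [w0]. *)
pose a j : R[i] := (d j).-root (w0 / w1).
have aE j : a j ^+ d j = w0 / w1 by rewrite /a rootCK.
have a0 j : a j != 0.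
  apply/eqP => aj0; have := aE j; rewrite aj0 expr0n gtn_eqF//.
  by move=> /esym/eqP; rewrite mulf_eq0 invr_eq0 (negPf w00) (negPf w10).
have /choice[J /choice[ze zeE]] : forall i, exists j (z : R[i]),
    [/\ unit_disk z, c j z = e i & z ^+ d j = w1].
  move=> i; have : (q @^-1` D) (e i) by rewrite /= qe.
  rewrite -cD => -[j _ [z Kz cz]]; exists j, z; split=> //.
  apply: d_inj; [exact: (proj1 (diskX z j))|exact: Kw1|].
  by rewrite -qc// cz qe kw1.
have /choice[rt rtE] : forall j, exists rt : R[i] -> R[i],
    forall z : R[i], 0 < complex.Re z ->
      rt z ^+ d j = z /\ {for z : C, continuous (rt : C -> C)}.
  by move=> j; exact: root_branch.
(* The point [e i] is moved to the fiber over [u] by [a], then to the fiber over [v] by a root of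
   [g v / w0], which is close to 1 and so lies in the right half-plane. *)
pose s i v := c (J i) (rt (J i) (g v / w0) * (a (J i) * ze i)).
have : \forall v \near u, D v -> 0 < complex.Re (g v / w0).
  have cf : {for w0, continuous (fun z : C => complex.Re (z / w0))}.
    apply: (@continuous_comp _ _ _ (fun z : C => (z / w0 : C))
      (fun z : C => complex.Re z)); last exact: continuous_Re.
    exact: (@mulrr_continuous R[i] w0^-1).
  have nU : nbhs (w0 : C) [set z : C | 0 < complex.Re (z / w0)].
    have w01 : 0 < complex.Re (w0 / w0) by rewrite divff//= ltr01.
    exact: (cvgr_gt _ cf 0 w01).
  exact: (within_near cg Du nU).
rewrite -nbhs_nearE nbhsE => -[U [oU Uu] HU].
exists U => //; exists s.
have rtw v j : U v -> D v -> rt j (g v / w0) ^+ d j = g v / w0.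
  by move=> Uv Dv; have [] := rtE j (g v / w0) (HU v Uv Dv).
have sX i v : U v -> D v -> (rt (J i) (g v / w0) * (a (J i) * ze i)) ^+ d (J i) = g v.
  move=> Uv Dv; rewrite !exprMn rtw// aE; have [_ _ ->] := zeE i.
  by rewrite mulfVK// mulfVK.
have sK i v : U v -> D v -> unit_disk (rt (J i) (g v / w0) * (a (J i) * ze i)).
  by move=> Uv Dv; apply/(diskX _ (J i)); rewrite sX//; have [] := gK v Dv.
split.
- move=> i; apply/subspace_continuousP => v [Uv Dv] N; rewrite /from_subspace => nN.
  pose F (z : C) : C := rt (J i) (z / w0) * (a (J i) * ze i).
  have cF : {for g v, continuous F}.
    apply: (@continuous_comp _ _ _ (fun z : C => rt (J i) (z / w0) : C)
      (fun z : C => z * (a (J i) * ze i) : C)); last exact: mulrr_continuous.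
    apply: (@continuous_comp _ _ _ (fun z : C => (z / w0 : C)) (rt (J i) : C -> C)).
      exact: (@mulrr_continuous R[i] w0^-1).
    by have [] := rtE (J i) (g v / w0) (HU v Uv Dv).
  have n1 : \forall z \near F (g v), unit_disk z -> N (c (J i) z).
    by apply: within_near (cc (J i)) _ nN; exact: sK.
  have n2 := within_near cg Dv (cF _ n1).
  suff H : \forall x \near v, (U `&` D) x -> N (s i x) by exact: H.
  by apply: filterS n2 => x Hx [Ux Dx]; apply: Hx => //; exact: sK.
- move=> i v [Uv Dv]; rewrite /s qc; last exact: sK.
  by rewrite sX//; have [] := gK v Dv.
- move=> m v [Uv Dv] qm.
  have [Kgv kgv] := gK v Dv.
  have : (q @^-1` D) m by rewrite /= qm.
  rewrite -cD => -[j _ [z Kz cz]].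
  have zX : z ^+ d j = g v.
    apply: d_inj; [exact: (proj1 (diskX z j))|exact: Kgv|].
    by rewrite -qc// cz qm kgv.
  have gv0 : g v != 0.
    have := HU v Uv Dv; apply: contraTneq => ->; rewrite mul0r /= ltxx.
    by [].
  have rt0 j' : rt j' (g v / w0) != 0.
    apply/eqP => rj0; have := rtw v j' Uv Dv; rewrite rj0 expr0n gtn_eqF//.
    by move=> /esym/eqP; rewrite mulf_eq0 invr_eq0 (negPf w00) (negPf gv0).
  (* Dividing by both factors leads back to a point over [y1], whose label is the required one. *)
  pose z' := z / rt j (g v / w0) / a j.
  have z'X : z' ^+ d j = w1.
    rewrite /z' !expr_div_n zX rtw// aE; field.
    by rewrite w00 w10 gv0.
  have Kz' : unit_disk z' by apply/(diskX _ j); rewrite z'X.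
  have [i ei] : exists i, e i = c j z'.
    by apply: e_surj; rewrite qc// z'X.
  have [Kze cze zeX] := zeE i.
  have [Jij zez'] : J i = j /\ ze i = z' by apply: c_inj => //; rewrite cze.
  have sm : s i v = m.
    rewrite /s Jij zez' -cz; congr c; rewrite /z'; field.
    by rewrite a0 rt0.
  exists i; split=> // i' si'.
  have [Kze' cze' zeX'] := zeE i'.
  have : J i = J i' /\ rt (J i) (g v / w0) * (a (J i) * ze i) =
      rt (J i') (g v / w0) * (a (J i') * ze i').
    apply: c_inj; [exact: sK|exact: sK|].
    by rewrite -/(s i v) -/(s i' v) sm.
  move=> [JJ]; rewrite -JJ => /(mulfI (rt0 _)) /(mulfI (a0 _)) zz.
  by apply: e_inj; rewrite -cze -cze' -JJ zz.
Qed.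

End filled_disks.

(** * Euclidean geometry of the unit sphere *)

Section euclidean_space.
Context {R : realType}.
Implicit Types u v w : 'rV[R]_3.

Lemma dotpC u v : dotp u v = dotp v u.
Proof. by apply: eq_bigr => i _; rewrite mulrC. Qed.

Lemma dotpDl u v w : dotp (u + v) w = dotp u w + dotp v w.
Proof. by rewrite -big_split; apply: eq_bigr => i _; rewrite mxE mulrDl. Qed.

Lemma dotpZl (a : R) u w : dotp (a *: u) w = a * dotp u w.
Proof. by rewrite /dotp mulr_sumr; apply: eq_bigr => i _; rewrite mxE mulrA. Qed.

Lemma dotpNl u w : dotp (- u) w = - dotp u w.
Proof. by rewrite -scaleN1r dotpZl mulN1r. Qed.

Lemma dotpDr u v w : dotp w (u + v) = dotp w u + dotp w v.
Proof. by rewrite dotpC dotpDl !(dotpC w). Qed.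

Lemma dotpZr (a : R) u w : dotp w (a *: u) = a * dotp w u.
Proof. by rewrite dotpC dotpZl dotpC. Qed.

Lemma dotpNr u w : dotp w (- u) = - dotp w u.
Proof. by rewrite dotpC dotpNl dotpC. Qed.

Definition dotpE := (dotpDl, dotpDr, dotpZl, dotpZr, dotpNl, dotpNr).

Lemma dotp_ge0 u : 0 <= dotp u u.
Proof. by apply: sumr_ge0 => i _; rewrite -expr2 sqr_ge0. Qed.

Lemma dotp_eq0 u : dotp u u = 0 -> u = 0.
Proof.
move=> /eqP; rewrite psumr_eq0 => [/allP u0|i _]; last by rewrite -expr2 sqr_ge0.
apply/rowP => i; rewrite mxE; have := u0 i (mem_index_enum i).
by rewrite mulf_eq0 orbb => /eqP.
Qed.

Lemma edist_sqr u v : Defs.edist u v ^+ 2 = dotp (u - v) (u - v).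
Proof. by rewrite sqr_sqrtr// dotp_ge0. Qed.

Lemma edist_ge0 u v : 0 <= Defs.edist u v.
Proof. exact: sqrtr_ge0. Qed.

Lemma edistxx u : Defs.edist u u = 0.
Proof. by rewrite /Defs.edist subrr -(scale0r u) !dotpE mul0r sqrtr0. Qed.

Lemma edist_eq0 u v : Defs.edist u v = 0 -> u = v.
Proof.
move=> uv; have := edist_sqr u v; rewrite uv expr0n /= => /esym/dotp_eq0.
by move=> /eqP; rewrite subr_eq0 => /eqP.
Qed.

Lemma edist_sphere u v : sphere u -> sphere v ->
  Defs.edist u v ^+ 2 = 2 - 2 * dotp u v.
Proof.
by move=> uS vS; rewrite edist_sqr !dotpE uS vS (dotpC v u); ring.
Qed.

Lemma dotp_geN1 u v : sphere u -> sphere v -> -1 <= dotp u v.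
Proof.
move=> uS vS; have := dotp_ge0 (u + v).
by rewrite !dotpE uS vS (dotpC v u); lra.
Qed.

Lemma dotp_lt1 u v : sphere u -> sphere v -> u <> v -> dotp u v < 1.
Proof.
move=> uS vS uv; have E := edist_sphere uS vS.
have : 0 < Defs.edist u v ^+ 2.
  rewrite exprn_gt0// lt_def edist_ge0 andbT; apply/eqP => /edist_eq0.
  exact: uv.
by rewrite E; lra.
Qed.

(* The frame is rational in the coordinates of [u], except at [(0, 0, -1)]. *)
Lemma orthonormal_frame u : sphere u -> exists e1 e2 : 'rV[R]_3,
  [/\ dotp e1 e1 = 1, dotp e2 e2 = 1,
      dotp e1 e2 = 0, dotp e1 u = 0 & dotp e2 u = 0] /\
  forall v, v = dotp v e1 *: e1 + dotp v e2 *: e2 + dotp v u *: u.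
Proof.
move=> uS.
have [e1 [e2 H]] : exists e1 e2 : 'rV[R]_3,
    [/\ dotp e1 e1 = 1, dotp e2 e2 = 1,
      dotp e1 e2 = 0, dotp e1 u = 0 & dotp e2 u = 0].
  pose vec (x y z : R) : 'rV[R]_3 := \row_j [:: x; y; z]`_j.
  have vecE x y z x' y' z' : dotp (vec x y z) (vec x' y' z') =
      x * x' + y * y' + z * z'.
    by rewrite /dotp !big_ord_recl big_ord0 !mxE /= addr0 addrA.
  have [x [y [z uE]]] : exists x y z, u = vec x y z.
    exists (u 0 ord0), (u 0 (lift ord0 ord0)), (u 0 (lift ord0 (lift ord0 ord0))).
    apply/rowP => i; rewrite mxE; case: i => -[|[|[|//]]] ilt /=;
      by congr (u _ _); apply: val_inj.
  move: uS; rewrite /sphere /= uE vecE => uS.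
  have [z1|z1] := eqVneq (1 + z) 0.
    exists (vec 0 (-1) 0), (vec (-1) 0 0); rewrite !vecE.
    have z1' : z = -1 by lra.
    have x2 : x ^+ 2 = 0 by have := sqr_ge0 y; have := sqr_ge0 x; rewrite z1' in uS; nra.
    have y2 : y ^+ 2 = 0 by have := sqr_ge0 y; have := sqr_ge0 x; rewrite z1' in uS; nra.
    have /eqP x0 : x == 0 by move/eqP: x2; rewrite sqrf_eq0.
    have /eqP y0 : y == 0 by move/eqP: y2; rewrite sqrf_eq0.
    by rewrite x0 y0; split; ring.
  exists (vec (1 - x * x / (1 + z)) (- (x * y) / (1 + z)) (- x)).
  exists (vec (- (x * y) / (1 + z)) (1 - y * y / (1 + z)) (- y)).
  have xE : x * x = 1 - y * y - z * z by lra.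
  rewrite !vecE; split.
  - have -> : (1 - x * x / (1 + z)) * (1 - x * x / (1 + z)) +
      - (x * y) / (1 + z) * (- (x * y) / (1 + z)) + - x * - x =
      ((1 + z - x * x) ^+ 2 + (x * x) * (y * y) + (x * x) * (1 + z) ^+ 2)
        / (1 + z) ^+ 2 by field.
    by rewrite xE; field.
  - have -> : - (x * y) / (1 + z) * (- (x * y) / (1 + z)) +
      (1 - y * y / (1 + z)) * (1 - y * y / (1 + z)) + - y * - y =
      ((1 + z - y * y) ^+ 2 + (x * x) * (y * y) + (y * y) * (1 + z) ^+ 2)
        / (1 + z) ^+ 2 by field.
    by rewrite xE; field.
  - have -> : (1 - x * x / (1 + z)) * (- (x * y) / (1 + z)) +
      - (x * y) / (1 + z) * (1 - y * y / (1 + z)) + - x * - y =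
      (x * y) * (x * x + y * y - 2 * (1 + z) + (1 + z) ^+ 2) / (1 + z) ^+ 2 by field.
    by rewrite xE; field.
  - have -> : (1 - x * x / (1 + z)) * x + - (x * y) / (1 + z) * y + - x * z =
      x * (1 + z - x * x - y * y - z * (1 + z)) / (1 + z) by field.
    by rewrite xE; field.
  - have -> : - (x * y) / (1 + z) * x + (1 - y * y / (1 + z)) * y + - y * z =
      y * (1 + z - x * x - y * y - z * (1 + z)) / (1 + z) by field.
    by rewrite xE; field.
exists e1, e2; split=> // v; have [h11 h22 h12 h13 h23] := H.
pose F : 'M[R]_3 := \matrix_(i, j) ([:: e1; e2; u]`_i) 0 j.
have rowF i : row i F = [:: e1; e2; u]`_i by apply/rowP => j; rewrite !mxE.
(* A square matrix with orthonormal rows also satisfies [F^T *m F = 1%:M], and this identity is the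
   expansion of [v] in the frame. *)
have FF : F *m F^T = 1%:M.
  apply/matrixP => i j; rewrite !mxE.
  transitivity (dotp ([:: e1; e2; u]`_i) ([:: e1; e2; u]`_j)).
    by apply: eq_bigr => k _; rewrite !mxE.
  case: i => -[|[|[|//]]] ilt; case: j => -[|[|[|//]]] jlt //=;
    by rewrite ?(dotpC e2 e1) ?(dotpC u e1) ?(dotpC u e2) ?h11 ?h22 ?h12 ?h13 ?h23
      ?(uS : dotp u u = 1).
have {}FF := mulmx1C FF.
rewrite -{1}[v]mulmx1 -FF mulmxA mulmx_sum_row !big_ord_recl big_ord0 addr0.
rewrite !rowF /= addrA.
have vF i : (v *m F^T) 0 i = dotp v [:: e1; e2; u]`_i.
  by rewrite !mxE; apply: eq_bigr => k _; rewrite !mxE.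
by rewrite !vF.
Qed.

Lemma continuous_dotp (a : 'rV[R]_3) : continuous (fun v : 'rV[R]_3 => dotp v a).
Proof.
rewrite (_ : (fun v => _) = \sum_(i < 3) (fun v : 'rV[R]_3 => v 0 i * a 0 i)).
  apply: (big_ind (fun f : 'rV[R]_3 -> R => continuous f)).
  - by move=> x; exact: cst_continuous.
  - by move=> f g cf cg x; apply: continuousD; [exact: cf|exact: cg].
  - move=> i _ x; apply: (@continuousM R _ (fun v : 'rV[R]_3 => v 0 i) (fun=> a 0 i)).
      exact: coord_continuous.
    exact: cst_continuous.
by apply/funext => v; rewrite fct_sumE.
Qed.

Lemma continuous_dotpxx : continuous (fun v : 'rV[R]_3 => dotp v v).
Proof.
rewrite (_ : (fun v => _) = \sum_(i < 3) (fun v : 'rV[R]_3 => v 0 i * v 0 i)).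
  apply: (big_ind (fun f : 'rV[R]_3 -> R => continuous f)).
  - by move=> x; exact: cst_continuous.
  - by move=> f g cf cg x; apply: continuousD; [exact: cf|exact: cg].
  - move=> i _ x; apply: (@continuousM R _ (fun v : 'rV[R]_3 => v 0 i) (fun v => v 0 i));
      exact: coord_continuous.
by apply/funext => v; rewrite fct_sumE.
Qed.

Lemma continuous_edist (a : 'rV[R]_3) : continuous (Defs.edist a).
Proof.
move=> x; apply: (@continuous_comp _ _ _ (fun v => dotp (a - v) (a - v)) Num.sqrt).
  apply: (@continuous_comp _ _ _ (fun v => a - v) (fun v => dotp v v)).
    by apply: (@continuousB _ _ _ (fun=> a) id); [exact: cst_continuous|exact: cvg_id].
  exact: continuous_dotpxx.
exact: sqrt_continuous.
Qed.

End euclidean_space.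

(** * Sheets near every point of the sphere other than a branch point *)

Section local_sheets.
Context {R : realType} {b n : nat} {p : 'I_b -> 'rV[R]_3} {rho : 'I_b -> R}.
Context {M : topologicalType} {q : M -> 'rV[R]_3}.
Hypotheses (M_hausdorff : hausdorff_space M)
  (p_sphere : forall i, sphere (p i))
  (rho_gt0 : forall i, 0 < rho i)
  (disks_disjoint : forall i j, i != j ->
     cap (p i) (rho i) `&` cap (p j) (rho j) = set0)
  (b_gt1 : (1 < b)%N)
  (q_covering : covering_over q (exterior p rho) n)
  (q_filling : forall i, filled_by_powers q (p i) (cap (p i) (rho i))).

Lemma exteriorP v : exterior p rho v <->
  sphere v /\ forall i, rho i <= Defs.edist (p i) v.
Proof.
split=> [[vS nv]|[vS rv]]; split=> //.
  by move=> i; rewrite leNgt; apply/negP => vi; apply: nv; exists i.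
by move=> [i _ [_]]; rewrite ltNge rv.
Qed.

Lemma closed_sphere : closed (@sphere R).
Proof.
apply: (@closed_preimage _ _ (fun v : 'rV[R]_3 => dotp v v) [set x | x = 1]).
  exact: continuous_dotpxx.
exact: closed_eq.
Qed.

Lemma closed_exterior : closed (exterior p rho).
Proof.
rewrite (_ : exterior p rho = sphere `&`
    \bigcap_(i in setT) [set v | rho i <= Defs.edist (p i) v]).
  apply: closedI; first exact: closed_sphere.
  apply: closed_bigI => i _.
  apply: (@closed_preimage _ _ (Defs.edist (p i)) [set x | rho i <= x]).
    exact: continuous_edist.
  exact: closed_ge.
apply/seteqP; split=> v; first by move=> /exteriorP[vS rv]; split=> // i _; exact: rv.
by move=> [vS rv]; apply/exteriorP; split=> // i; exact: rv.
Qed.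

Lemma closed_cap i : closed (cap (p i) (rho i)).
Proof.
apply: closedI; first exact: closed_sphere.
apply: (@closed_preimage _ _ (Defs.edist (p i)) [set x | x <= rho i]).
  exact: continuous_edist.
exact: closed_le.
Qed.

Lemma cap_other i j v : i != j -> cap (p i) (rho i) v -> rho j < Defs.edist (p j) v.
Proof.
move=> ij iv; rewrite ltNge; apply/negP => jv.
suff : (cap (p i) (rho i) `&` cap (p j) (rho j)) v by rewrite disks_disjoint.
by split=> //; split=> //; case: iv.
Qed.

Lemma cap_center i : cap (p i) (rho i) (p i).
Proof. by split=> //; rewrite edistxx ltW. Qed.

(** The center of a second, disjoint cap is at distance more than [rho i]. Distances on the sphere
    are at most 2, so [rho i < 2] and the boundary circle is not empty. *)
Lemma cap_boundary i : exists2 y, sphere y & Defs.edist (p i) y = rho i.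
Proof.
have [j ij] : exists j, j != i.
  have b0 : (0 < b)%N by exact: ltn_trans b_gt1.
  pose j0 := Ordinal b0; pose j1 := Ordinal b_gt1.
  by case: (eqVneq j0 i) => [<-|]; [exists j1|exists j0].
have rij : rho i < Defs.edist (p i) (p j) := cap_other ij (cap_center j).
have r4 : rho i ^+ 2 < 4.
  have : rho i ^+ 2 < Defs.edist (p i) (p j) ^+ 2.
    by rewrite ltrXn2r ?nnegrE// ?edist_ge0// ltW.
  rewrite edist_sphere//; have := dotp_geN1 (p_sphere i) (p_sphere j); lra.
have [e1 [e2 [[h11 _ _ h1 _] _]]] := orthonormal_frame (p_sphere i).
(* The cosine of the angular radius, from [edist u v ^+ 2 = 2 - 2 * dotp u v]. *)
pose c := 1 - rho i ^+ 2 / 2.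
have r0 : 0 < rho i ^+ 2 by rewrite exprn_gt0.
have c1 : 0 <= 1 - c ^+ 2 by rewrite /c; nra.
have yS : sphere (c *: p i + Num.sqrt (1 - c ^+ 2) *: e1).
  rewrite /sphere /= !dotpE h11 h1 (dotpC (p i)) h1 p_sphere.
  by rewrite mulr1 !mulr0 addr0 add0r mulr1 -!expr2 sqr_sqrtr//; ring.
exists (c *: p i + Num.sqrt (1 - c ^+ 2) *: e1) => //.
apply/eqP; rewrite -(@eqrXn2 _ 2)// ?edist_ge0 ?(ltW (rho_gt0 i))//; apply/eqP.
rewrite edist_sphere// !dotpE (dotpC (p i) e1) h1 p_sphere /c.
by field.
Qed.

Lemma near_edist_gt (i : 'I_b) u (r : R) : r < Defs.edist (p i) u ->
  \forall v \near u, r < Defs.edist (p i) v.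
Proof. by move=> ru; exact: (cvgr_gt _ (@continuous_edist R (p i) u) r ru). Qed.

Lemma near_edist_lt (i : 'I_b) u (r : R) : Defs.edist (p i) u < r ->
  \forall v \near u, Defs.edist (p i) v < r.
Proof. by move=> ru; exact: (cvgr_lt _ (@continuous_edist R (p i) u) r ru). Qed.

Lemma sheets_of_covering u : exterior p rho u ->
  exists2 U, open U /\ U u & exists s : 'I_n -> 'rV[R]_3 -> M,
    sheets q id (U `&` exterior p rho) s.
Proof.
move=> Eu; have [U [oU Uu] [s [cs qs us _]]] := q_covering Eu.
exists U => //; exists s; split=> // m z UEz qm.
by have := us m; rewrite qm; apply.
Qed.

Lemma sheets_of_cap i u : cap (p i) (rho i) u -> u <> p i ->
  exists2 U, open U /\ U u & exists s : 'I_n -> 'rV[R]_3 -> M,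
    sheets q id (U `&` cap (p i) (rho i)) s.
Proof.
move=> iu up; have [y yS yr] := cap_boundary i.
have iy : cap (p i) (rho i) y by split=> //; rewrite yr.
have Ey : exterior p rho y.
  apply/exteriorP; split=> // j; have [<-|ij] := eqVneq i j; first by rewrite yr.
  exact/ltW/(cap_other ij iy).
have [U [oU Uy] [s S]] := sheets_of_covering Ey.
have UEy : (U `&` exterior p rho) y by [].
apply: (@sheets_of_filled _ _ q n (p i) y u _ (s^~ y) (q_filling i)) => //.
- by move=> yp; have := rho_gt0 i; rewrite -yr yp edistxx ltxx.
- by move=> j k; exact: sheets_inj S UEy.
- by move=> j; have [_ -> ] := S.
- by move=> m qm; exact: sheets_surj S UEy qm.
Qed.

(** On a boundary circle, the exterior and the cap each provide sheets on one closed side, and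
    [sheets_glue_local] joins them. Every other point has a neighborhood in the sphere that lies
    inside the exterior or inside one cap. *)
Lemma sphere_locally_sheeted u : sphere u -> (forall i, u <> p i) ->
  exists2 U, open U /\ U u & exists s : 'I_n -> 'rV[R]_3 -> M,
    sheets q id (U `&` sphere) s.
Proof.
move=> uS up.
have restrict (D U : set 'rV[R]_3) (s : 'I_n -> 'rV[R]_3 -> M) :
    (\forall v \near u, sphere v -> D v) -> open U -> U u ->
    sheets q id (U `&` D) s ->
    exists2 V, open V /\ V u & exists s : 'I_n -> 'rV[R]_3 -> M,
      sheets q id (V `&` sphere) s.
  rewrite -nbhs_nearE nbhsE => -[V [oV Vu] VD] oU Uu S.
  exists (U `&` V); first by split; [exact: openI|].
  by exists s; apply: sheets_sub S => v [[Uv Vv] vS]; split=> //; exact: VD.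
case: (pselect (exists i, cap (p i) (rho i) u)) => [[i iu]|niu]; last first.
  have ru i : rho i < Defs.edist (p i) u.
    by rewrite ltNge; apply/negP => iu; apply: niu; exists i.
  have Eu : exterior p rho u by apply/exteriorP; split=> // i; exact: ltW.
  have [U [oU Uu] [s S]] := sheets_of_covering Eu.
  apply: restrict oU Uu S.
  have : \forall v \near u, forall i, rho i < Defs.edist (p i) v.
    by apply: (@filter_forall _ _ (fun i v => rho i < Defs.edist (p i) v) (nbhs u) (nbhs_filter u)) => i; exact: near_edist_gt.
  by apply: filterS => v rv vS; apply/exteriorP; split=> // i; exact: ltW.
have [U [oU Uu] [s S]] := sheets_of_cap iu (up i).
have [_ /=] := iu; rewrite le_eqVlt => /orP[/eqP ri|ri]; last first.
  apply: restrict oU Uu S; apply: filterS (near_edist_lt ri) => v vi vS.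
  by split=> //=; exact: ltW.
have Eu : exterior p rho u.
  apply/exteriorP; split=> // j; have [<-|ij] := eqVneq i j; first by rewrite ri.
  exact/ltW/(cap_other ij iu).
have [U' [oU' U'u] [s' S']] := sheets_of_covering Eu.
have [V [oV Vu] [s'' S'']] : exists2 V, open V /\ V u & exists s : 'I_n -> 'rV[R]_3 -> M,
    sheets q id (V `&` (exterior p rho `|` cap (p i) (rho i))) s.
  have S1 : sheets q id ((U `&` U') `&` exterior p rho) s'.
    by apply: sheets_sub S' => v [[]].
  have S2 : sheets q id ((U `&` U') `&` cap (p i) (rho i)) s.
    by apply: sheets_sub S => v [[]].
  exact: (sheets_glue_local M_hausdorff (openI oU oU') closed_exterior
    (@closed_cap i) S1 S2).
apply: restrict oV Vu S''.
have : \forall v \near u, forall j, j != i -> rho j < Defs.edist (p j) v.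
  apply: (@filter_forall _ _ (fun j v => j != i -> rho j < Defs.edist (p j) v)
    (nbhs u) (nbhs_filter u)) => j.
  have [->|ji] := eqVneq j i; first by near=> v.
  near=> v => _; near: v.
  by apply: near_edist_gt; apply: cap_other iu; rewrite eq_sym.
apply: filterS => v rv vS; case: (leP (Defs.edist (p i) v) (rho i)) => vi.
  by right.
left; apply/exteriorP; split=> // j; have [->|ji] := eqVneq j i; first exact: ltW.
exact/ltW/rv.
Unshelve. all: by end_near. Qed.

End local_sheets.

(** * Heights of the sheets *)

Section heights.
Context {R : realType} {M : topologicalType} {Z : Type} (q : M -> Z) (n : nat).
Hypothesis M_hausdorff : hausdorff_space M.
Variables (m0 : M) (phi : R * R -> Z) (phi_inj : injective phi).
Variables (I : finType) (xs ys : I -> R) (X dl : R).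
Hypotheses (dl_gt0 : 0 < dl)
  (ys_gap : forall i j, i != j -> 4 * dl < `|ys i - ys j|)
  (xs_bnd : forall i, `|xs i| + dl <= X) (ys_bnd : forall i, `|ys i| + dl <= X)
  (X_ge0 : 0 <= X)
  (q_loc : forall z, (forall i, z <> (xs i, ys i)) ->
     locally_sheeted q n phi z).

Definition mix (t x y : R) := x + t * (y - x).

Lemma mix01 t x y : 0 <= t <= 1 -> 0 <= x <= 1 -> 0 <= y <= 1 ->
  0 <= mix t x y <= 1.
Proof. by rewrite /mix => /andP[? ?] /andP[? ?] /andP[? ?]; apply/andP; nra. Qed.

Definition lev (j : nat) : R := 2^-1 ^+ j.

Lemma lev_gt0 j : 0 < lev j.
Proof. by rewrite exprn_gt0// invr_gt0. Qed.

Lemma lev01 j : 0 <= lev j <= 1.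
Proof. by rewrite ltW ?lev_gt0//= exprn_ile1// ?invr_ge0// invf_le1// ler1n. Qed.

Definition ramp (c y : R) : R := step ((y - c) / dl).

Lemma rampE c y : ramp c y = step ((y - c) / dl).
Proof. by []. Qed.

(* The comb: cut along the rays going right from the punctures. *)
Let D0 : set (R * R) := [set z | `|z.1| <= X /\ `|z.2| <= X /\
  forall i, dl / 2 <= `|z.2 - ys i| \/ z.1 <= xs i - dl].

(** The [i]-th strip has half-width [dl], twice that of the gap in the comb, so that the two overlap
    in a rectangle below the gap and in one above it. Only a box around the puncture is left out by
    both. *)
Let K i : set (R * R) := [set z | xs i + dl <= z.1 <= X /\ `|z.2 - ys i| <= dl].

Lemma near_norm_gt (T : topologicalType) (f : T -> R) a r x :
  {for x, continuous f} -> r < `|f x - a| -> \forall y \near x, r < `|f y - a|.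
Proof.
move=> cf rx; have cg : {for x, continuous (fun y => `|f y - a|)}.
  apply: (@continuous_comp _ _ _ (fun y => f y - a) (fun t : R => `|t|)).
    by apply: (@continuousB _ _ _ f (fun=> a)) => //; exact: cst_continuous.
  exact: norm_continuous.
exact: (cvgr_gt _ cg r rx).
Qed.

Lemma near_norm_lt (T : topologicalType) (f : T -> R) a r x :
  {for x, continuous f} -> `|f x - a| < r -> \forall y \near x, `|f y - a| < r.
Proof.
move=> cf rx; have cg : {for x, continuous (fun y => `|f y - a|)}.
  apply: (@continuous_comp _ _ _ (fun y => f y - a) (fun t : R => `|t|)).
    by apply: (@continuousB _ _ _ f (fun=> a)) => //; exact: cst_continuous.
  exact: norm_continuous.
exact: (cvgr_lt _ cg r rx).
Qed.

Let fst_for (z : R * R) : {for z, continuous (fun z : R * R => z.1)}.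
Proof. exact: cvg_fst. Qed.
Let snd_for (z : R * R) : {for z, continuous (fun z : R * R => z.2)}.
Proof. exact: cvg_snd. Qed.
Let id_for (y : R) : {for y, continuous (fun y : R => y)}.
Proof. exact: cvg_id. Qed.

Lemma closed_of_near (T : topologicalType) (A : set T) :
  (forall x, ~ A x -> \forall y \near x, ~ A y) -> closed A.
Proof.
move=> H; rewrite -openC openE => x /= nAx; exact: H.
Qed.

Let D0_closed : closed D0.
Proof.
rewrite (_ : D0 = [set z | - X <= z.1 <= X] `&` [set z | - X <= z.2 <= X] `&`
   \bigcap_(i in setT) ([set z | dl / 2 <= `|z.2 - ys i|] `|`
                       [set z | z.1 <= xs i - dl])).
  apply: closedI.
    by apply: closedI; apply: closed_strip => z; [exact: cvg_fst|exact: cvg_snd].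
  apply: closed_bigI => i _; apply: closedU.
    apply: closed_of_near => z /negP; rewrite -ltNge => zi.
    have H := near_norm_lt (@snd_for z) zi.
    by near=> w; apply/negP; rewrite -ltNge; exact: (near H w).
  apply: (@closed_preimage _ _ (fun z : R * R => z.1) [set x | x <= xs i - dl]).
    by move=> z; exact: cvg_fst.
  exact: closed_le.
apply/seteqP; split=> z; rewrite /D0 /= -!ler_norml.
  by move=> [h1 [h2 h3]]; split=> // i _; exact: h3.
by move=> [[h1 h2] h3]; split=> //; split=> // i; exact: h3.
Unshelve. all: by end_near. Qed.

Let K_closed i : closed (K i).
Proof.
rewrite (_ : K i = [set z | xs i + dl <= z.1 <= X] `&`
    [set z | ys i - dl <= z.2 <= ys i + dl]).
  by apply: closedI; apply: closed_strip => z; [exact: cvg_fst|exact: cvg_snd].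
by apply/seteqP; split=> z; rewrite /K /= ler_distl.
Qed.

Let D0_sheets : exists s, sheets q (n := n) phi D0 s.
Proof.
apply: (sheets_planar M_hausdorff m0 X_ge0 D0_closed).
- by move=> z [h1 [h2 _]].
- move=> y a c [/= a1 [a2 a3]] [/= c1 [c2 c3]] x /andP[ax xc]; split => /=.
    move: a1 c1; rewrite !ler_norml => /andP[? ?] /andP[? ?]; by apply/andP; split; lra.
  split=> // i; have [|ai] := a3 i; first by left.
  by have [|ci] := c3 i; [left|right; lra].
(* The conditions defining a row are closed, so those that fail at [y0] fail at nearby heights too;
   this is [D_shrink] by contraposition. *)
- move=> y0; have : \forall y \near y0, (forall i, `|y0 - ys i| < dl / 2 ->
      `|y - ys i| < dl / 2) /\ (X < `|y0 - 0| -> X < `|y - 0|).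
    have N1 : \forall y \near y0, X < `|y0 - 0| -> X < `|y - 0|.
      case: (leP `|y0 - 0| X) => [h|Xy].
        by near=> y; rewrite ltNge ?h.
      have H := near_norm_gt (@id_for y0) Xy.
      by near=> y => _; exact: (near H y).
    have N2 : \forall y \near y0, forall i, `|y0 - ys i| < dl / 2 ->
        `|y - ys i| < dl / 2.
      apply: (@filter_forall _ _ (fun i y => `|y0 - ys i| < dl / 2 ->
        `|y - ys i| < dl / 2) (nbhs y0) (nbhs_filter y0)) => i.
      case: (leP (dl / 2) `|y0 - ys i|) => [h|yi].
        by near=> y; rewrite ltNge ?h.
      have H := near_norm_lt (@id_for y0) yi.
      by near=> y => _; exact: (near H y).
    by near=> y; split; [exact: (near N2 y)|exact: (near N1 y)].
  move=> /nbhs_ballP[e /= e0 eH]; exists (e / 2) => [|x y ye [/= h1 [h2 h3]]].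
    by rewrite divr_gt0.
  have [H1 H2] : (forall i, `|y0 - ys i| < dl / 2 -> `|y - ys i| < dl / 2) /\
      (X < `|y0 - 0| -> X < `|y - 0|).
    apply: eH; rewrite /ball /= distrC (le_lt_trans ye)//.
    by rewrite ltr_pdivrMr// mulr2n mulrDr mulr1 ltrDl.
  split=> //=; split.
    rewrite leNgt; apply/negP; move: H2; rewrite !subr0 => H2 /H2.
    by rewrite ltNge h2.
  move=> i; have [|xi] := h3 i; last by right.
  by case: (leP (dl / 2) `|y0 - ys i|) => [|/H1]; [left|rewrite ltNge => /negP].
- move=> z [_ [_ h]]; apply: q_loc => i zE; have := h i.
  rewrite zE /= subrr normr0 => {zE}-[] hh; have := dl_gt0; lra.
Unshelve. all: by end_near. Qed.

Let K_sheets i : exists s, sheets q (n := n) phi (K i) s.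
Proof.
have d0 := dl_gt0.
have := xs_bnd i; have := ys_bnd i => yb xb.
apply: (sheets_planar M_hausdorff m0 X_ge0 (@K_closed i)).
- move=> z [/= /andP[h1 h2]]; rewrite ler_distl => /andP[h3 h4].
  have := ler_norm (- xs i); have := ler_norm (ys i); have := ler_norm (- ys i).
  rewrite !normrN => ? ? ?; rewrite !ler_norml.
  by split; apply/andP; split; lra.
- move=> y a c [/= a1 a2] [/= c1 c2] x /andP[ax xc]; split=> //=.
  by move: a1 c1 => /andP[? ?] /andP[? ?]; apply/andP; split; lra.
- move=> y0; case: (leP `|y0 - ys i| dl) => h.
    by exists 1 => // x y _ [/= h1 h2].
  have := near_norm_gt (@id_for y0) h.
  move=> /nbhs_ballP[e /= e0 eH]; exists (e / 2) => [|x y ye [/= h1 h2]].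
    by rewrite divr_gt0.
  have : dl < `|y - ys i|.
    apply: eH; rewrite /ball /= distrC (le_lt_trans ye)//.
    by rewrite ltr_pdivrMr// mulr2n mulrDr mulr1 ltrDl.
  by rewrite ltNge h2.
- move=> z [/= /andP[h1 h2] h3]; apply: q_loc => j zE.
  have [ij|ij] := eqVneq j i; first by move: h1; rewrite zE ij /= => {zE}?; lra.
  by have := ys_gap ij; move: h3; rewrite zE /= => {zE}? ?; lra.
Qed.

Lemma segment_convex (a a' t x y : R) : a <= x <= a' -> a <= y <= a' ->
  0 <= t <= 1 -> a <= x + t * (y - x) <= a'.
Proof. by move=> /andP[? ?] /andP[? ?] /andP[? ?]; apply/andP; split; nra. Qed.

Lemma rectangle_connected (a a' c c' : R) :
  connected [set z : R * R | a <= z.1 <= a' /\ c <= z.2 <= c'].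
Proof.
set A := [set z | _].
case: (pselect (exists z, A z)) => [[z0 Az0]|A0]; last first.
  rewrite (_ : A = set0); first exact: connected0.
  by apply/seteqP; split=> z // Az; apply: A0; exists z.
pose f (z : R * R) (t : R) : R * R :=
  (z0.1 + t * (z.1 - z0.1), z0.2 + t * (z.2 - z0.2)).
rewrite (_ : A = \bigcup_(z in A) (f z @` `[0, 1])).
  apply: bigcup_connected.
    exists z0 => z Az; exists 0; first by rewrite /= in_itv /= lexx ler01.
    by rewrite /f !mul0r !addr0; case: (z0).
  move=> z Az; apply: connected_continuous_connected; first exact: segment_connected.
  apply/continuous_subspaceT.
  have cf (u v : R) : continuous (fun t : R => u + t * v).
    move=> t; apply: (@continuousD R R R (fun=> u) (fun t => t * v)).
      exact: cst_continuous.
    exact: mulrr_continuous.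
  by move=> t; exact: (continuous_pair (@cf _ _ t) (@cf _ _ t)).
apply/seteqP; split=> [z Az|_ [z Az [t + <-]]].
  exists z => //; exists 1; first by rewrite /= in_itv /= lexx ler01.
  by rewrite /f !mul1r ![z0.1 + _]addrC ![z0.2 + _]addrC !subrK; case: (z).
rewrite /= in_itv /= => t01.
by have [z1 z2] := Az; have [w1 w2] := Az0; split; exact: segment_convex.
Qed.

Let K_D0 i z : K i z -> D0 z -> dl / 2 <= `|z.2 - ys i|.
Proof. by move=> [/= /andP[h1 _] _] [_ [_ /(_ i)]] [//|] ?; have := dl_gt0; lra. Qed.

(** The gap [4 * dl] between the heights of the punctures keeps these rectangles away from the other
    cuts. *)
Let K_rect_sub (i : I) (c c' : R) : ys i - dl <= c -> c' <= ys i + dl ->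
  (c' <= ys i - dl / 2 \/ ys i + dl / 2 <= c) ->
  [set z : R * R | xs i + dl <= z.1 <= X /\ c <= z.2 <= c'] `<=` D0 `&` K i.
Proof.
have d0 := dl_gt0.
move=> hc hc' hcc z [/= /andP[h1 h2] /andP[h3 h4]].
have zi : `|z.2 - ys i| <= dl by rewrite ler_distl; apply/andP; split; lra.
have zi2 : dl / 2 <= `|z.2 - ys i|.
  rewrite leNgt; apply/negP; rewrite ltr_distl => /andP[? ?].
  by case: hcc => ?; lra.
split; last by split; rewrite /= ?h1.
have := xs_bnd i; have := ys_bnd i => yb xb.
have := ler_norm (- xs i); have := ler_norm (ys i); have := ler_norm (- ys i).
rewrite !normrN => ? ? ?.
split; first by rewrite ler_norml; apply/andP; split; lra.
split; first by rewrite ler_norml; apply/andP; split; lra.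
move=> j; have [->|ij] := eqVneq j i; [by left|left].
have := ys_gap ij; have : `|ys j - ys i| <= `|z.2 - ys j| + `|z.2 - ys i|.
  by rewrite (_ : ys j - ys i = - (z.2 - ys j) + (z.2 - ys i)) ?(le_trans (ler_normD _ _))// ?normrN//; ring.
lra.
Qed.

(** The values are prescribed point by point on [M] and then chosen; what has to be checked is that
    the prescriptions on the comb and on the strips agree where they overlap. One formula in [c],
    [pi], [pi'] describes both, so that later arguments need not tell them apart. *)
Lemma exists_heights : exists G H : M -> R,
  [/\ forall m, 0 <= G m <= 1, forall m, 0 <= H m <= 1 &
  forall z0, `|z0.1| < X -> `|z0.2| < X ->
    (forall i, `|z0.2 - ys i| <= dl -> dl < `|z0.1 - xs i|) ->
    exists (N : set (R * R)) s c (pi pi' : 'I_n -> 'I_n),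
      [/\ open N /\ N z0, sheets q phi N s, injective pi, injective pi' &
        forall z j, N z ->
          G (s j z) = mix (ramp c z.2) (lev (pi j)) (lev (pi' j)) /\
          H (s j z) = ramp c z.2 * (1 - ramp c z.2) * lev j]].
Proof.
have d0 := dl_gt0.
have [s S] := D0_sheets.
have /choice[t T] := K_sheets.
have [_ qs _] := S.
have qt i j z : K i z -> q (t i j z) = phi z by have [_ + _] := T i; exact.
(* Sheets of a strip are compared with those of the comb below ([pb]) and above ([pt]); the
   permutation across the strip is [pt i] after the inverse of [pb i]. *)
have /choice[pb pbE] : forall i, exists pi : 'I_n -> 'I_n, injective pi /\
    forall j z, K i z -> z.2 <= ys i - dl / 2 -> s (pi j) z = t i j z.
  move=> i; have [|pi [pi_inj piE]] := sheets_relabel M_hausdorff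
    (@rectangle_connected (xs i + dl) X (ys i - dl) (ys i - dl / 2)) _ (T i) S.
    have h : ys i - dl / 2 <= ys i + dl by lra.
    by move=> z /(K_rect_sub (lexx _) h (or_introl (lexx _)))[].
  exists pi; split=> // j z [/= h1]; rewrite ler_distl => /andP[h2 h3] h4.
  by apply: piE; split=> //=; rewrite h2.
have /choice[pt ptE] : forall i, exists pi : 'I_n -> 'I_n, injective pi /\
    forall j z, K i z -> ys i + dl / 2 <= z.2 -> s (pi j) z = t i j z.
  move=> i; have [|pi [pi_inj piE]] := sheets_relabel M_hausdorff
    (@rectangle_connected (xs i + dl) X (ys i + dl / 2) (ys i + dl)) _ (T i) S.
    have h : ys i - dl <= ys i + dl / 2 by lra.
    by move=> z /(K_rect_sub h (lexx _) (or_intror (lexx _)))[].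
  exists pi; split=> // j z [/= h1]; rewrite ler_distl => /andP[h2 h3] h4.
  by apply: piE; split=> //=; rewrite h3 andbT.
pose c i := ys i - dl / 2.
pose v i j (z : R * R) : R * R :=
  (mix (ramp (c i) z.2) (lev (pb i j)) (lev (pt i j)),
   ramp (c i) z.2 * (1 - ramp (c i) z.2) * lev j).
have ramp01 u y : 0 <= ramp u y <= 1 by rewrite step_ge0 step_le1.
(* On the overlaps the ramp is constantly 0 or 1, so the moving sheet is at a level of the comb and
   the second height vanishes. *)
have v_edge i j k z : K i z -> D0 z -> s k z = t i j z -> v i j z = (lev k, 0).
  move=> Kz Dz st; have := K_D0 Kz Dz; rewrite ler_normr => /orP[h|h].
    have zi : ys i + dl / 2 <= z.2 by lra.
    rewrite -(sheets_inj S Dz (etrans ((ptE i).2 j z Kz zi) (esym st))).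
    have r1 : ramp (c i) z.2 = 1.
      by apply: step_eq1; rewrite ler_pdivlMr// mul1r /c; lra.
    by rewrite /v r1 /mix; congr (_, _); ring.
  have zi : z.2 <= ys i - dl / 2 by lra.
  rewrite -(sheets_inj S Dz (etrans ((pbE i).2 j z Kz zi) (esym st))).
  have r0 : ramp (c i) z.2 = 0.
    by apply: step_eq0; rewrite ler_pdivrMr// mul0r /c; lra.
  by rewrite /v r0 /mix; congr (_, _); ring.
have /choice[V VE] : forall m, exists V : R * R,
    [/\ 0 <= V.1 <= 1, 0 <= V.2 <= 1,
      forall j z, D0 z -> s j z = m -> V = (lev j, 0) &
      forall i j z, K i z -> t i j z = m -> V = v i j z].
  move=> m.
  case: (pselect (exists i j z, K i z /\ t i j z = m)) => [[i [j [z [Kz tz]]]]|nK].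
    exists (v i j z); split.
    - by apply: mix01; rewrite ?ramp01 ?lev01.
    - have := ramp01 (c i) z.2; have := lev01 j; rewrite /v /=.
      move: (lev j) (ramp _ _) => l r /andP[? ?] /andP[? ?].
      by rewrite !mulr_ge0 ?mulr_ile1 ?mulr_ge0 ?subr_ge0// gerBl.
    - move=> k z' Dz' sz'.
      have zz' : z = z' by apply: phi_inj; rewrite -(qt i j)// -(qs k)// tz sz'.
      by apply: v_edge => //; rewrite zz'// sz' -tz zz'.
    - move=> i' j' z' Kz' tz'.
      have zz' : z = z' by apply: phi_inj; rewrite -(qt i j)// -(qt i' j')// tz tz'.
      move: Kz' tz'; rewrite -{}zz' => Kz' tz'.
      have ii' : i = i'.
        apply/eqP; apply/negPn/negP => /ys_gap hg.
        move: Kz Kz' => [_ /= h1] [_ /= h2].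
        have hh : `|ys i - ys i'| <= `|z.2 - ys i| + `|z.2 - ys i'|.
          rewrite (_ : ys i - ys i' = - (z.2 - ys i) + (z.2 - ys i')); last by ring.
          by rewrite (le_trans (ler_normD _ _))// normrN.
        lra.
      move: Kz' tz'; rewrite -{}ii' => Kz' tz'.
      by rewrite (sheets_inj (T i) Kz (etrans tz (esym tz'))).
  have noK i j z : K i z -> t i j z = m -> False.
    by move=> Kz tz; apply: nK; exists i, j, z.
  case: (pselect (exists j z, D0 z /\ s j z = m)) => [[j [z [Dz sz]]]|nD].
    exists (lev j, 0); split=> //=; first exact: lev01.
    - by rewrite lexx ler01.
    - move=> k z' Dz' sz'.
      have zz' : z = z' by apply: phi_inj; rewrite -(qs j)// -(qs k)// sz sz'.
      move: Dz' sz'; rewrite -{}zz' => Dz' sz'.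
      by rewrite (sheets_inj S Dz (etrans sz (esym sz'))).
    - by move=> i' j' z' Kz' /(noK _ _ _ Kz').
  (* Points over neither the comb nor a strip get an arbitrary value. *)
  exists (0, 0); split=> //=; rewrite ?lexx ?ler01//.
    by move=> j z Dz sz; exfalso; apply: nD; exists j, z.
  by move=> i' j' z' Kz' /(noK _ _ _ Kz').
exists (fun m => (V m).1), (fun m => (V m).2); split.
- by move=> m; have [] := VE m.
- by move=> m; have [] := VE m.
move=> z0 z1X z2X z0P.
case: (pselect (exists i, `|z0.2 - ys i| < dl /\ xs i + dl < z0.1)) => [[i [h1 h2]]|nK].
  exists (K i)°, (t i), (c i), (pb i), (pt i); split.
  - split; first exact: open_interior.
    have H1 := near_norm_lt (@snd_for z0) h1.
    have H2 : \forall z \near z0, xs i + dl < z.1 by exact: (cvgr_gt _ (@fst_for z0) _ h2).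
    have H3 : \forall z \near z0, z.1 < X.
      by apply: (cvgr_lt _ (@fst_for z0)); rewrite (le_lt_trans (ler_norm _)).
    near=> z; split => /=; last exact/ltW/(near H1 z).
    by rewrite !ltW//; [exact: (near H3 z)|exact: (near H2 z)].
  - by apply: sheets_sub (T i) => z; exact: interior_subset.
  - by have [] := pbE i.
  - by have [] := ptE i.
  - move=> z j /interior_subset Kz; have [_ _ _ /(_ i j z Kz erefl) ->] := VE (t i j z).
    by [].
(* Starting the ramp at height [X] makes it vanish on the whole comb, where the formula then gives
   the constant levels. *)
exists D0°, s, X, id, id; split=> //.
- split; first exact: open_interior.
  have H1 : \forall z \near z0, `|z.1 - 0| < X.
    by apply: (near_norm_lt (@fst_for z0)); rewrite subr0.
  have H2 : \forall z \near z0, `|z.2 - 0| < X.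
    by apply: (near_norm_lt (@snd_for z0)); rewrite subr0.
  have H3 : \forall z \near z0, forall i, dl / 2 <= `|z.2 - ys i| \/ z.1 <= xs i - dl.
    apply: (@filter_forall _ _ (fun i (z : R * R) =>
      dl / 2 <= `|z.2 - ys i| \/ z.1 <= xs i - dl) (nbhs z0) (nbhs_filter z0)) => i.
    case: (leP `|z0.2 - ys i| (dl / 2)) => h.
      have zd : `|z0.2 - ys i| < dl by lra.
      have := z0P i (ltW zd); rewrite ltr_normr => /orP[h'|h'].
        by exfalso; apply: nK; exists i; split=> //; lra.
      have H : \forall z \near z0, z.1 < xs i - dl.
        by apply: (cvgr_lt _ (@fst_for z0)); lra.
      by near=> z; right; apply/ltW/(near H z).
    have H := near_norm_gt (@snd_for z0) h.
    by near=> z; left; apply/ltW/(near H z).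
  near=> z; split; first by rewrite -[z.1]subr0; exact/ltW/(near H1 z).
  split; first by rewrite -[z.2]subr0; exact/ltW/(near H2 z).
  exact: (near H3 z).
- by apply: sheets_sub S => z; exact: interior_subset.
- move=> z j /interior_subset Dz.
  have [_ _ /(_ j z Dz erefl) -> _] := VE (s j z).
  have r0 : ramp X z.2 = 0.
    apply: step_eq0; rewrite ler_pdivrMr// mul0r subr_le0.
    by case: Dz => _ [+ _]; apply: le_trans; exact: ler_norm.
  by rewrite r0 /mix /=; split; ring.
Unshelve. all: by end_near. Qed.

End heights.

(** * Stereographic coordinates *)

Section smooth_coordinates.
Context {R : realType}.

Lemma smooth_linear (V W : normedModType R) (U : set V) (f : V -> W) :
  (forall (a : R) x y, f (a *: x + y) = a *: f x + f y) -> continuous f ->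
  open U -> smooth U f.
Proof.
move=> f_lin cf oU; pose m := GRing.isLinear.Build R V W *:%R f f_lin.
pose F : {linear V -> W} := HB.pack f m.
exact: (@smooth_lin _ _ _ _ F).
Qed.

Lemma smooth_fst (V W : normedModType R) (U : set (V * W)) :
  open U -> smooth U (fun z : V * W => z.1).
Proof. by apply: smooth_linear => // z; exact: cvg_fst. Qed.

Lemma smooth_snd (V W : normedModType R) (U : set (V * W)) :
  open U -> smooth U (fun z : V * W => z.2).
Proof. by apply: smooth_linear => // z; exact: cvg_snd. Qed.

Lemma smooth_comp_linear (V W W' : normedModType R) (U : set V) (f : V -> W)
    (l : W -> W') :
  (forall (a : R) x y, l (a *: x + y) = a *: l x + l y) -> continuous l ->
  open U -> smooth U f -> smooth U (fun x => l (f x)).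
Proof.
move=> l_lin cl oU; pose m := GRing.isLinear.Build R W W' *:%R l l_lin.
pose L : {linear W -> W'} := HB.pack l m.
exact: (@smooth_comp_lin _ _ _ _ _ _ L).
Qed.

Lemma smooth_scale (V W : normedModType R) (U : set V) (f : V -> R) (a : W) :
  open U -> smooth U f -> smooth U (fun x => f x *: a).
Proof.
apply: (smooth_comp_linear (l := fun t : R => t *: a)) => [t x y|t].
  by rewrite scalerDl scalerA.
exact: scalel_continuous.
Qed.

Lemma smooth_pair (V W W' : normedModType R) (U : set V) (f : V -> W)
    (g : V -> W') : open U -> smooth U f -> smooth U g ->
  smooth U (fun x => (f x, g x)).
Proof.
move=> oU sf sg.
have sf' : smooth U (fun x => (f x, 0) : W * W').
  apply: (smooth_comp_linear (l := fun y : W => (y, 0) : W * W')) sf => //.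
    by move=> a x y; congr (_, _); rewrite /= scaler0 addr0.
  by move=> y; apply: (@continuous_pair _ _ _ id (fun=> 0)); [exact: cvg_id|exact: cst_continuous].
have sg' : smooth U (fun x => (0, g x) : W * W').
  apply: (smooth_comp_linear (l := fun y : W' => (0, y) : W * W')) sg => //.
    by move=> a x y; congr (_, _); rewrite /= scaler0 addr0.
  by move=> y; apply: (@continuous_pair _ _ _ (fun=> 0) id); [exact: cst_continuous|exact: cvg_id].
apply: smooth_ext (smoothD oU sf' sg') => // x _.
by congr (_, _); rewrite /= ?addr0 ?add0r.
Qed.

Lemma smoothB (V : normedModType R) (U : set V) (f g : V -> R) :
  open U -> smooth U f -> smooth U g -> smooth U (fun x => f x - g x).
Proof. by move=> oU sf sg; apply: smoothD => //; exact: smoothN. Qed.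

Lemma smooth_div (V : normedModType R) (U : set V) (f g : V -> R) :
  open U -> (forall x, U x -> g x != 0) -> smooth U f -> smooth U g ->
  smooth U (fun x => f x / g x).
Proof. by move=> oU g0 sf sg; apply: smoothM => //; exact: smoothV. Qed.

Lemma smooth_comp_dotp (V : normedModType R) (U : set V) (f : V -> 'rV[R]_3) a :
  open U -> smooth U f -> smooth U (fun x => dotp (f x) a).
Proof.
apply: (smooth_comp_linear (l := fun v => dotp v a)).
  by move=> t x y; rewrite !dotpE.
exact: continuous_dotp.
Qed.

End smooth_coordinates.

Section stereographic.
Context {R : realType}.
Variables (N e1 e2 : 'rV[R]_3) (tau : R).
Hypotheses (NS : sphere N) (h11 : dotp e1 e1 = 1) (h22 : dotp e2 e2 = 1)
  (h12 : dotp e1 e2 = 0) (h1N : dotp e1 N = 0) (h2N : dotp e2 N = 0)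
  (frameE : forall v, v = dotp v e1 *: e1 + dotp v e2 *: e2 + dotp v N *: N).

(** On the sphere this is half the squared distance to [N], and it is the denominator of the
    stereographic projection from [N]. *)
Definition st_w (u : 'rV[R]_3) := 1 - dotp u N.
Definition st_x (u : 'rV[R]_3) := dotp u e1 / st_w u.
Definition st_y (u : 'rV[R]_3) := dotp u e2 / st_w u + tau * st_x u.

Definition st_den (z : R * R) := z.1 * z.1 + (z.2 - tau * z.1) * (z.2 - tau * z.1) + 1.

(* Inverse stereographic projection from [N], composed with the shear
   [(x, y) |-> (x, y - tau * x)]. *)
Definition st_inv (z : R * R) : 'rV[R]_3 :=
  (2 * z.1 / st_den z) *: e1 + (2 * (z.2 - tau * z.1) / st_den z) *: e2 +
  ((st_den z - 2) / st_den z) *: N.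

Lemma st_den_gt0 z : 0 < st_den z.
Proof. by rewrite ltr_pwDr// addr_ge0// -expr2 sqr_ge0. Qed.

Let den_neq0 z : st_den z != 0. Proof. by rewrite gt_eqF// st_den_gt0. Qed.

Lemma st_inv1 z : dotp (st_inv z) e1 = 2 * z.1 / st_den z.
Proof. by rewrite /st_inv !dotpE h11 (dotpC e2) h12 (dotpC N) h1N; ring. Qed.

Lemma st_inv2 z : dotp (st_inv z) e2 = 2 * (z.2 - tau * z.1) / st_den z.
Proof. by rewrite /st_inv !dotpE h22 h12 (dotpC N) h2N; ring. Qed.

Lemma st_invN z : dotp (st_inv z) N = (st_den z - 2) / st_den z.
Proof. by rewrite /st_inv !dotpE h1N h2N (NS : dotp N N = 1); ring. Qed.

Lemma sphere_frame u : dotp u u = dotp u e1 ^+ 2 + dotp u e2 ^+ 2 + dotp u N ^+ 2.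
Proof. by rewrite {2}[u]frameE !dotpE !expr2. Qed.

Lemma st_inv_sphere z : sphere (st_inv z).
Proof.
rewrite /sphere /= sphere_frame st_inv1 st_inv2 st_invN.
rewrite [X in X + _ + _](_ : _ = 4 * (z.1 * z.1) / st_den z ^+ 2); last by field.
have -> : z.1 * z.1 = st_den z - 1 - (z.2 - tau * z.1) * (z.2 - tau * z.1).
  by rewrite /st_den; ring.
move: (den_neq0 z); move: (st_den z) => d d0.
by field.
Qed.

Lemma st_w_inv z : st_w (st_inv z) = 2 / st_den z.
Proof. by rewrite /st_w st_invN; field. Qed.

Lemma st_w_inv_gt0 z : 0 < st_w (st_inv z).
Proof. by rewrite st_w_inv divr_gt0// st_den_gt0. Qed.

Lemma st_x_inv z : st_x (st_inv z) = z.1.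
Proof. by rewrite /st_x st_w_inv st_inv1; field. Qed.

Lemma st_y_inv z : st_y (st_inv z) = z.2.
Proof. by rewrite /st_y st_x_inv st_w_inv st_inv2; field. Qed.

Lemma st_inv_inj : injective st_inv.
Proof.
move=> z z' zz'; rewrite [z]surjective_pairing [z']surjective_pairing.
by rewrite -!st_x_inv -!st_y_inv zz'.
Qed.

Lemma st_w_gt0 u : sphere u -> u <> N -> 0 < st_w u.
Proof. by move=> uS uN; rewrite /st_w subr_gt0; exact: dotp_lt1. Qed.

(** A lower bound on the distance to [N] thereby bounds the planar coordinates. *)
Lemma st_denE u : sphere u -> 0 < st_w u ->
  st_den (st_x u, st_y u) = 2 / st_w u.
Proof.
move=> uS w0; have w00 : st_w u != 0 by rewrite gt_eqF.
have := uS; rewrite /sphere /= sphere_frame => E.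
rewrite /st_den /= /st_y addrK.
have -> : st_x u * st_x u + dotp u e2 / st_w u * (dotp u e2 / st_w u) =
    (dotp u e1 ^+ 2 + dotp u e2 ^+ 2) / st_w u ^+ 2 by rewrite /st_x; field.
have -> : dotp u e1 ^+ 2 + dotp u e2 ^+ 2 = 1 - (1 - st_w u) ^+ 2.
  by move: E; rewrite (_ : dotp u N = 1 - st_w u); [lra|rewrite /st_w; ring].
by field.
Qed.

Lemma st_invK u : sphere u -> 0 < st_w u -> st_inv (st_x u, st_y u) = u.
Proof.
move=> uS w0; have w00 : st_w u != 0 by rewrite gt_eqF.
rewrite [RHS]frameE /st_inv /= st_denE//.
congr (_ *: _ + _ *: _ + _ *: _).
- by rewrite /st_x; field.
- by rewrite /st_y addrK; field.
- have -> : dotp u N = 1 - st_w u by rewrite /st_w; ring.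
  by field.
Qed.

Lemma continuous_st_w : continuous st_w.
Proof.
move=> u; apply: (@continuousB R R 'rV[R]_3 (fun=> 1) (fun u => dotp u N)).
  exact: cst_continuous.
exact: continuous_dotp.
Qed.

Lemma smooth_st_w (V : normedModType R) (U : set V) f :
  open U -> smooth U f -> smooth U (fun x => st_w (f x)).
Proof.
by move=> oU sf; apply: smoothB => //; [exact: smooth_cst|exact: smooth_comp_dotp].
Qed.

Lemma smooth_st_x (V : normedModType R) (U : set V) f :
  open U -> (forall x, U x -> 0 < st_w (f x)) -> smooth U f ->
  smooth U (fun x => st_x (f x)).
Proof.
move=> oU w0 sf; apply: smooth_div => //.
- by move=> x Ux; rewrite gt_eqF// w0.
- exact: smooth_comp_dotp.
- exact: smooth_st_w.
Qed.

Lemma smooth_st_y (V : normedModType R) (U : set V) f :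
  open U -> (forall x, U x -> 0 < st_w (f x)) -> smooth U f ->
  smooth U (fun x => st_y (f x)).
Proof.
move=> oU w0 sf; apply: smoothD => //.
  apply: smooth_div => //.
  - by move=> x Ux; rewrite gt_eqF// w0.
  - exact: smooth_comp_dotp.
  - exact: smooth_st_w.
by apply: smoothM => //; [exact: smooth_cst|exact: smooth_st_x].
Qed.

Lemma smooth_st_inv (V : normedModType R) (U : set V) (f g : V -> R) :
  open U -> smooth U f -> smooth U g -> smooth U (fun x => st_inv (f x, g x)).
Proof.
move=> oU sf sg.
have sg' : smooth U (fun x => g x - tau * f x).
  by apply: smoothB => //; apply: smoothM => //; exact: smooth_cst.
have sd : smooth U (fun x => st_den (f x, g x)).
  apply: smoothD => //; last exact: smooth_cst.
  by apply: smoothD => //; exact: smoothM.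
have s2 (h : V -> R) : smooth U h -> smooth U (fun x => 2 * h x / st_den (f x, g x)).
  move=> sh; apply: smooth_div => //; apply: smoothM => //.
  exact: smooth_cst.
apply: smoothD => //; last first.
  apply: smooth_scale => //; apply: smooth_div => //.
  by apply: smoothB => //; exact: smooth_cst.
by apply: smoothD => //; apply: smooth_scale => //; exact: s2.
Qed.

Lemma continuous_st_inv : continuous st_inv.
Proof.
move=> z; have -> : st_inv = (fun z => st_inv (z.1, z.2)).
  by apply/funext => -[].
have oT : open [set: (R * R)%type] by exact: openT.
exact: (smooth_continuous (smooth_st_inv oT (smooth_fst oT) (smooth_snd oT))).
Qed.

End stereographic.

(** * Crossings of the straight lines that join the levels *)

Section crossings.
Context {R : realType}.

Lemma lev_inj : injective (@lev R).
Proof.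
by apply: ieexprIn; rewrite ?invr_gt0// invr_eq1 -[1]/(1%:R) eqr_nat.
Qed.

Lemma lev_double i j : (i < j)%N -> 2 * lev j <= lev i :> R.
Proof.
move=> ij; have -> : 2 * lev j = lev i * lev (j - i.+1) :> R.
  by rewrite /lev -{1}(subnKC ij) exprD exprS; field.
rewrite ger_pMr ?lev_gt0//.
by have /andP[_] := @lev01 R (j - i.+1).
Qed.

(* The levels [2^-j] decrease so fast that no three of the points [(a_j, A_j)]
   lie on a line of negative slope. *)
Lemma no_triple_crossing (t : R) (a b c A B C : nat) : 0 < t < 1 ->
  a != b -> a != c -> b != c ->
  mix t (lev a) (lev A) = mix t (lev b) (lev B) ->
  mix t (lev b) (lev B) = mix t (lev c) (lev C) -> False.
Proof.
move=> /andP[t0 t1].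
have sorted (a' b' c' A' B' C' : nat) : (a' < b')%N -> (b' < c')%N ->
    mix t (lev a') (lev A') = mix t (lev b') (lev B') ->
    mix t (lev b') (lev B') = mix t (lev c') (lev C') -> False.
  rewrite /mix => /lev_double ab /lev_double bc E1 E2.
  have pos i : 0 < @lev R i  := @lev_gt0 R i.
  have pA := pos A'; have pB := pos B'; have pC := pos C'.
  have pa := pos a'; have pb := pos b'; have pc := pos c'.
  (* By [F1] and [F2] the drops on the side of [a'], [b'], [c'] are proportional to the rises on the
     other side. Halving gives [lev a' - lev b' >= lev b' > lev b' - lev c'], so the first rise is
     the larger one; but it also gives [lev C' - lev B' >= lev B' > lev B' - lev A']. *)
  have F1 : (1 - t) * (@lev R a' - @lev R b') = t * (@lev R B' - @lev R A') by lra.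
  have F2 : (1 - t) * (@lev R b' - @lev R c') = t * (@lev R C' - @lev R B') by lra.
  have BA : @lev R A' < @lev R B'.
    rewrite -subr_gt0 -(pmulr_rgt0 _ t0) -F1 mulr_gt0//; lra.
  have CB : @lev R B' < @lev R C'.
    rewrite -subr_gt0 -(pmulr_rgt0 _ t0) -F2 mulr_gt0//; lra.
  have lt_of i j : @lev R i < @lev R j  -> (j < i)%N.
    by case: (ltngtP j i) => // [/lev_double|->]; [have := pos j; lra|rewrite ltxx].
  have BC2 : 2 * @lev R B' <= @lev R C' := lev_double (lt_of _ _ CB).
  have F3 : t * (@lev R C' - @lev R B') < t * (@lev R B' - @lev R A').
    by rewrite -F1 -F2 ltr_pM2l; lra.
  by move: F3; rewrite ltr_pM2l//; lra.
move=> ab ac bc E1 E2; have E3 := etrans E1 E2.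
case: (ltngtP a b) ab => // ab _; case: (ltngtP b c) bc => // bc _;
  case: (ltngtP a c) ac => // ac _.
- exact: sorted ab bc E1 E2.
- by have := ltn_trans ab bc; rewrite ltnNge (ltnW ac).
- exact: sorted ac bc E3 (esym E2).
- exact: sorted ac ab (esym E3) E1.
- exact: sorted ab ac (esym E1) E3.
- exact: sorted bc ac E2 (esym E3).
- by have := ltn_trans bc ab; rewrite ltnNge (ltnW ac).
- exact: sorted bc ab (esym E2) (esym E1).
Qed.

End crossings.

Section differentials.
Context {R : realType}.
Implicit Types V W : normedModType R.

(** If functions [F] recover every coordinate of the source from [psi], this chain rule shows that
    the differential of [psi] is injective. *)
Lemma diff_left_inverse V W (psi : V -> W) (F : W -> R) (l : V -> R) x v :
  (forall (a : R) y z, l (a *: y + z) = a *: l y + l z) -> continuous l ->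
  differentiable psi x -> differentiable F (psi x) ->
  (\forall y \near x, F (psi y) = l y) ->
  'd F (psi x) ('d psi x v) = l v.
Proof.
move=> l_lin cl dpsi dF Fl; pose m := GRing.isLinear.Build R V R *:%R l l_lin.
pose L : {linear V -> R} := HB.pack l m.
have dl : is_diff x L L by split; [exact: linear_differentiable|exact: diff_lin].
have Fl' : \forall y \near x, L y = (F \o psi) y.
  by apply: filterS Fl => y /= ->.
have [_ dFpsi] := is_diff_near Fl' dl.
by rewrite -[LHS]/(('d F (psi x) \o 'd psi x) v) -diff_comp// dFpsi.
Qed.

Lemma diff_pair_inj V W W' (f : V -> W) (g : V -> W') x :
  differentiable f x -> differentiable g x -> injective ('d f x) ->
  injective ('d (fun y => (f y, g y)) x).
Proof.
move=> df dg inj v w; have -> := diff_pair df dg.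
by move=> [/inj].
Qed.

End differentials.

Lemma card_set2_II (T : Type) (x y : T) : x <> y -> ([set x; y] #= `I_2)%card.
Proof.
move=> xy; apply/eq_cardSP; exists x; first by left.
apply/eq_cardSP; exists y; first by split; [right|move=> /esym].
rewrite II0 card_eq0; apply/eqP/seteqP; split=> z //= [[[|]]//].
Qed.

(** * General position *)

Section sheeted_heights.
Context {R : realType} {n : nat} {M : topologicalType} (q : M -> 'rV[R]_3).
Variables (N e1 e2 : 'rV[R]_3) (tau dl : R).
Hypotheses (NS : sphere N) (h11 : dotp e1 e1 = 1) (h22 : dotp e2 e2 = 1)
  (h12 : dotp e1 e2 = 0) (h1N : dotp e1 N = 0) (h2N : dotp e2 N = 0)
  (frameE : forall v, v = dotp v e1 *: e1 + dotp v e2 *: e2 + dotp v N *: N).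
Hypotheses (M_hausdorff : hausdorff_space M) (q_cont : continuous q)
  (q_sphere : forall m, sphere (q m)) (dl_gt0 : 0 < dl).
Local Notation st_w := (st_w N).
Local Notation st_x := (st_x N e1).
Local Notation st_y := (st_y N e1 e2 tau).
Local Notation st_inv := (st_inv N e1 e2 tau).
Local Notation ramp := (ramp dl).
Variables (G H : M -> R) (V : set 'rV[R]_3).

(** [G] moves the sheet [j] from the level of [pi j] to that of [pi' j], whereas the bump in [H] has
    the size [lev j] of the label itself; it separates the sheets while they move. *)
Definition sheet_formula (B : set (R * R)) (s : 'I_n -> R * R -> M) (c : R)
    (pi pi' : 'I_n -> 'I_n) := forall z j, B z ->
  G (s j z) = mix (ramp c z.2) (lev (pi j)) (lev (pi' j)) /\
  H (s j z) = ramp c z.2 * (1 - ramp c z.2) * lev j.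

Hypotheses (oV : open V) (V_w : forall m, V (q m) -> 0 < st_w (q m))
  (V_sheets : forall m, V (q m) -> exists B s c pi pi',
    [/\ open B /\ B (st_x (q m), st_y (q m)), sheets q st_inv B s,
        injective pi, injective pi' & sheet_formula (B `&` st_inv @^-1` V) s c pi pi']).

Let A := q @^-1` V.

Let oA : open A. Proof. by apply: open_comp => // m _; exact: q_cont. Qed.

Lemma continuous_st_z u : 0 < st_w u ->
  {for u, continuous (fun u => (st_x u, st_y u))}.
Proof.
move=> w0; have oW : open [set u | 0 < st_w u].
  rewrite (_ : [set u | _] = st_w @^-1` [set x | 0 < x]) //.
  apply: open_comp; last exact: open_gt.
  by move=> x _; exact: continuous_st_w.
have sid : smooth [set u | 0 < st_w u] (fun u : 'rV[R]_3 => u).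
  by apply: smooth_linear => // x; exact: cvg_id.
have sx := smooth_st_x (N := N) e1 oW (fun u h => h) sid.
have sy := smooth_st_y (N := N) e1 e2 tau oW (fun u h => h) sid.
exact: (continuous_pair (smooth_continuous sx w0) (smooth_continuous sy w0)).
Qed.

(** Locally a continuous map into [A] stays on one sheet, so its heights are explicit functions of
    [st_y] alone. Taking the identity of [M] gives continuity, and taking a local parametrization
    gives smoothness. *)
Lemma sheet_near (T : topologicalType) (sigma : T -> M) t0 :
  {for t0, continuous sigma} -> A (sigma t0) ->
  exists c (pi pi' : 'I_n -> 'I_n) j, \forall t \near t0,
    G (sigma t) = mix (ramp c (st_y (q (sigma t)))) (lev (pi j)) (lev (pi' j)) /\
    H (sigma t) = ramp c (st_y (q (sigma t))) * (1 - ramp c (st_y (q (sigma t)))) * lev j.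
Proof.
move=> cs At0; have [B [s [c [pi [pi' [[oB Bz0] S _ _ GH]]]]]] := V_sheets At0.
have w0 := V_w At0.
have invq t : 0 < st_w (q (sigma t)) ->
    st_inv (st_x (q (sigma t)), st_y (q (sigma t))) = q (sigma t).
  by move=> wt; apply: st_invK.
have [j js] := sheets_surj S Bz0 (esym (invq t0 w0)).
exists c, pi, pi', j.
pose ze t := (st_x (q (sigma t)), st_y (q (sigma t))).
have cqs : {for t0, continuous (q \o sigma)}.
  by apply: continuous_comp => //; exact: q_cont.
have cz : {for t0, continuous ze}.
  apply: (@continuous_comp _ _ _ (q \o sigma) (fun u => (st_x u, st_y u))) => //.
  exact: continuous_st_z.
have nB : \forall t \near t0, B (ze t).
  by apply: (cz B); exact: (open_nbhs_nbhs (conj oB Bz0)).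
have nV : \forall t \near t0, V (q (sigma t)).
  by apply: (cqs V); exact: (open_nbhs_nbhs (conj oV At0)).
have E : \forall t \near t0, s j (ze t) = sigma t.
  apply: (@agree_near M n M_hausdorff _ (nbhs t0) _ sigma (fun i t => s i (ze t))
    (sigma t0) (fun i => s i (ze t0))).
  - exact: cs.
  - move=> i U nU.
    have n1 := sheets_near S Bz0 nU.
    suff : \forall t \near t0, B (ze t) -> U (s i (ze t)).
      move=> h; suff : \forall t \near t0, U (s i (ze t)) by [].
      by apply: filterS2 h nB => t; apply.
    exact: (cz _ n1).
  - by move=> i; rewrite -js; apply: sheets_inj S Bz0.
  - apply: filterS2 nB nV => t Bt Vt; apply: sheets_surj S Bt _.
    by rewrite invq//; exact: V_w.
near=> t.
have Et : s j (ze t) = sigma t by near: t.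
have Bt : B (ze t) by near: t.
have Vt : V (q (sigma t)) by near: t.
have BVt : (B `&` st_inv @^-1` V) (ze t).
  by split=> //=; rewrite invq//; exact: V_w.
by have := GH (ze t) j BVt; rewrite Et.
Unshelve. all: by end_near. Qed.

Lemma continuous_heights m : A m -> {for m, continuous G} /\ {for m, continuous H}.
Proof.
move=> Am; have cid : {for m, continuous (fun m : M => m)} by exact: cvg_id.
have [c [pi [pi' [j GH]]]] := sheet_near cid Am.
have cr : {for m, continuous (fun m => ramp c (st_y (q m)))}.
  have cy : {for m, continuous (fun m => st_y (q m))}.
    have cz := continuous_st_z (V_w Am).
    apply: (@continuous_comp _ _ _ (fun m => (st_x (q m), st_y (q m))) snd).
      by apply: (@continuous_comp _ _ _ q (fun u => (st_x u, st_y u))) => //; exact: q_cont.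
    exact: cvg_snd.
  apply: (@continuous_comp _ _ _ (fun m => (st_y (q m) - c) / dl) (@step R)).
    apply: (@continuousM R M (fun m => st_y (q m) - c) (fun=> dl^-1)).
      by apply: (@continuousB R R M (fun m => st_y (q m)) (fun=> c)) => //; exact: cst_continuous.
    exact: cst_continuous.
  exact: (smooth_continuous smooth_step).
have near_eq (f g : M -> R) : (\forall x \near m, f x = g x) ->
    {for m, continuous g} -> {for m, continuous f}.
  move=> fg cg; rewrite /prop_for /continuous_at (nbhs_singleton fg).
  by apply: cvg_trans cg; apply: near_eq_cvg; apply: filterS fg => x.
split.
  apply: (near_eq _ (fun m => lev (pi j) + ramp c (st_y (q m)) * (lev (pi' j) - lev (pi j)))).
    by apply: filterS GH => x [].
  apply: (@continuousD R R M (fun=> lev (pi j))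
    (fun m => ramp c (st_y (q m)) * (lev (pi' j) - lev (pi j)))).
    exact: cst_continuous.
  apply: (@continuousM R M (fun m => ramp c (st_y (q m))) (fun=> lev (pi' j) - lev (pi j))) => //.
  exact: cst_continuous.
apply: (near_eq _ (fun m => ramp c (st_y (q m)) * (1 - ramp c (st_y (q m))) * lev j)).
  by apply: filterS GH => x [].
apply: (@continuousM R M (fun m => ramp c (st_y (q m)) * (1 - ramp c (st_y (q m)))) (fun=> lev j)).
  apply: (@continuousM R M (fun m => ramp c (st_y (q m))) (fun m => 1 - ramp c (st_y (q m)))) => //.
  apply: (@continuousB R R M (fun=> 1) (fun m => ramp c (st_y (q m)))) => //.
  exact: cst_continuous.
exact: cst_continuous.
Qed.

Lemma smooth_ramp (W : normedModType R) (U : set W) (f : W -> R) c :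
  open U -> smooth U f -> smooth U (fun x => ramp c (f x)).
Proof.
move=> oU sf; apply: (@smooth_comp_real _ _ _ (fun x => (f x - c) / dl) setT (@step R)) => //.
  exact: smooth_step.
apply: smoothM => //; last exact: smooth_cst.
by apply: smoothB => //; exact: smooth_cst.
Qed.

Lemma smooth_mix (W : normedModType R) (U : set W) (f : W -> R) x y :
  open U -> smooth U f -> smooth U (fun z => mix (f z) x y).
Proof.
move=> oU sf; apply: smoothD => //; first exact: smooth_cst.
by apply: smoothM => //; exact: smooth_cst.
Qed.

Lemma smooth_heights W s : local_param q A W s ->
  smooth W (G \o s) /\ smooth W (H \o s).
Proof.
move=> [cs sA [oW sq _]].
have sub : forall w, W w -> exists2 U, U w & smooth U (G \o s) /\ smooth U (H \o s).
  move=> w Ww; have Asw : A (s w) by apply: sA; exists w.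
  have [c [pi [pi' [j]]]] := sheet_near (cs w Ww) Asw.
  rewrite -nbhs_nearE nbhsE => -[U [oU Uw] HU].
  have oUW : open (U `&` W) by exact: openI.
  exists (U `&` W) => //.
  have sqs : smooth (U `&` W) (q \o s) by apply: smooth_sub sq => x [].
  have sr : smooth (U `&` W) (fun x => ramp c (st_y (q (s x)))).
    apply: smooth_ramp => //; apply: smooth_st_y => // x [_ Wx].
    by apply: V_w; apply: (sA (s x)); exists x.
  split.
    apply: smooth_ext (smooth_mix (lev (pi j)) (lev (pi' j)) oUW sr) => //.
    by move=> x [/HU[h _] _]; rewrite /= h.
  apply: smooth_ext (_ : smooth (U `&` W) (fun x =>
    ramp c (st_y (q (s x))) * (1 - ramp c (st_y (q (s x)))) * lev j)) => //.
    by move=> x [/HU[_ h] _]; rewrite /= h.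
  apply: smoothM => //; last exact: smooth_cst.
  apply: smoothM => //; apply: smoothB => //; exact: smooth_cst.
by split; apply: smooth_cover => w /sub[U Uw [? ?]]; exists U.
Qed.

(** [q \o s] is already an immersion for every local parametrization [s], so the further component
    only has to be smooth. *)
Lemma immersion_with (W : normedModType R) (h : M -> W) :
  (forall U s, local_param q A U s -> smooth U (h \o s)) ->
  immersion_on q A (fun m => (q m, h m)).
Proof.
move=> sh; exists A; split=> // U s Us; have [cs sA [oU sq inj]] := Us.
split=> //.
  exact: (smooth_pair oU sq (sh _ _ Us)).
move=> x Ux; apply: (diff_pair_inj _ _ (inj x Ux)).
  exact: (smooth_differentiable sq).
exact: (smooth_differentiable (sh _ _ Us)).
Qed.

Lemma immersion_3d : immersion_on q A (fun m => (q m, G m)).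
Proof. by apply: immersion_with => U s /smooth_heights[]. Qed.

Lemma immersion_4d : immersion_on q A (fun m => (q m, (G m, H m))).
Proof.
apply: immersion_with => U s Us; have [sG sH] := smooth_heights Us.
by have [_ _ [oU _ _]] := Us; exact: (smooth_pair oU sG sH).
Qed.

(** Where the ramp [r] is 0 or 1, [G] separates the sheets because [pi] and [pi'] are injective. In
    between [r * (1 - r)] is nonzero, and [H] separates them. *)
Lemma heights_inj m1 m2 : A m1 -> A m2 -> q m1 = q m2 -> G m1 = G m2 ->
  H m1 = H m2 -> m1 = m2.
Proof.
move=> A1 A2 q12.
have [B [s [c [pi [pi' [[oB Bz] S pi_inj pi'_inj GH]]]]]] := V_sheets A1.
have invq : st_inv (st_x (q m1), st_y (q m1)) = q m1 by apply: st_invK => //; exact: V_w.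
have [j1 <-] := sheets_surj S Bz (esym invq).
have [j2 <-] : exists j, s j (st_x (q m1), st_y (q m1)) = m2.
  by apply: sheets_surj S Bz _; rewrite invq q12.
have BV : (B `&` st_inv @^-1` V) (st_x (q m1), st_y (q m1)) by split; rewrite //= invq.
have [-> ->] := GH _ j1 BV; have [-> ->] := GH _ j2 BV.
rewrite /mix; set r := ramp _ _.
have [r0|r0] := eqVneq r 0.
  by rewrite r0 !mul0r !addr0 => /lev_inj/ord_inj/pi_inj ->.
have [r1|r1] := eqVneq r 1.
  by rewrite r1 !mul1r ![lev (pi _) + _]addrC !subrK => /lev_inj/ord_inj/pi'_inj ->.
move=> _ /mulfI h; congr (s _ _); apply/ord_inj/lev_inj/h.
by rewrite mulf_neq0// subr_eq0 eq_sym.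
Qed.

(** By [heights_inj] the map is injective on [A], so the condition on multiple points holds
    vacuously. *)
Lemma general_position_of_4d :
  general_position_4d q A (fun m => (q m, (G m, H m))).
Proof.
split; first exact: immersion_4d.
move=> y [m1 [m2 [A1 A2 m12 <-]]] [q21 G21 H21]; exfalso; apply: m12.
by apply: heights_inj => //.
Qed.

Lemma ramp_itv c y : 0 < ramp c y < 1 -> 0 < (y - c) / dl < 1.
Proof.
rewrite rampE; set x := (_ / _) => /andP[h0 h1].
rewrite !ltNge; apply/andP; split; apply/negP.
  by move=> /step_eq0 E; move: h0; rewrite E ltxx.
by move=> /step_eq1 E; move: h1; rewrite E ltxx.
Qed.

Let i2 : 'I_3 := ord_max.

Let ord3P (i : 'I_3) : [\/ i = 0, i = 1 | i = i2].
Proof.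
by case: i => -[|[|[|//]]] p; [apply: Or31|apply: Or32|apply: Or33]; apply: val_inj.
Qed.

(* Over a strip where the ramp is strictly monotone, in the coordinates given by
   [st_x], the value of the ramp and the height, the sheets are planes. *)
Lemma crossing_model B s c pi pi' z0 h0 j k :
  open B -> sheets q st_inv B s -> injective pi ->
  sheet_formula (B `&` st_inv @^-1` V) s c pi pi' ->
  B z0 -> V (st_inv z0) -> j != k -> 0 < ramp c z0.2 < 1 ->
  mix (ramp c z0.2) (lev (pi j)) (lev (pi' j)) = h0 ->
  mix (ramp c z0.2) (lev (pi k)) (lev (pi' k)) = h0 ->
  (forall l, l != j -> l != k ->
     mix (ramp c z0.2) (lev (pi l)) (lev (pi' l)) <> h0) ->
  locally_modeled ((fun m => (q m, G m)) @` A) (st_inv z0, h0) double_model.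
Proof.
move=> oB S pi_inj GH Bz0 Vz0 jk r01 Ej Ek El.
have dl_neq0 : dl != 0 by rewrite gt_eqF.
pose a l : R := lev (pi l); pose d l : R := lev (pi' l) - lev (pi l).
have mixE r l : mix r (lev (pi l)) (lev (pi' l)) = a l + r * d l by [].
pose r0 := ramp c z0.2.
pose D := d k - d j.
(* Lines of equal slope that cross coincide, so [j] and [k] would start at the same level. *)
have D0 : D != 0.
  rewrite subr_eq0; apply/eqP => dkj; move: (etrans Ej (esym Ek)).
  rewrite !mixE dkj => /addIr /lev_inj/ord_inj/pi_inj jk'.
  by rewrite jk' eqxx in jk.
have r0E : r0 * D = a j - a k.
  by have := etrans Ej (esym Ek); rewrite !mixE -/r0 /D => E; lra.
(* The coordinates at [(x, r, h)] are [h - a j - r * d j], [h - a k - r * d k] and [x - z0.1], where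
   [r] is the ramp. Solving for [r] and [h] gives [bt] and [ht]; [Y] then recovers [st_y] from [r]
   through [step_inv]. *)
pose bt (t : 'rV[R]_3) := (t 0 0 - t 0 1 - (a k - a j)) / D.
pose ht (t : 'rV[R]_3) := t 0 0 + a j + bt t * d j.
pose X (t : 'rV[R]_3) := z0.1 + t 0 i2.
pose Y (t : 'rV[R]_3) := c + dl * step_inv (bt t).
pose psi t := (st_inv (X t, Y t), ht t).
pose U := [set t : 'rV[R]_3 | 0 < bt t < 1].
have scoord (i : 'I_3) (O : set 'rV[R]_3) : open O -> smooth O (fun t : 'rV[R]_3 => t 0 i).
  apply: smooth_linear; first by move=> x u v; rewrite !mxE.
  exact: coord_continuous.
have sbt (O : set 'rV[R]_3) : open O -> smooth O bt.
  move=> oO; apply: smoothM => //; last exact: smooth_cst.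
  apply: smoothB => //; last exact: smooth_cst.
  by apply: smoothB => //; exact: scoord.
have oU : open U.
  rewrite (_ : U = bt @^-1` `]0, 1[%classic).
    apply: open_comp; last exact: interval_open.
    by move=> x _; apply: (smooth_continuous (sbt setT openT)).
  by apply/seteqP; split=> t; rewrite /U /= in_itv.
have sY : smooth U Y.
  apply: smoothD => //; first exact: smooth_cst.
  apply: smoothM => //; first exact: smooth_cst.
  apply: (smooth_comp_real oU _ smooth_step_inv) => //; exact: sbt.
have sX : smooth U X by apply: smoothD => //; [exact: smooth_cst|exact: scoord].
have sht : smooth U ht.
  apply: smoothD => //; last by apply: smoothM => //; [exact: sbt|exact: smooth_cst].
  by apply: smoothD => //; [exact: scoord|exact: smooth_cst].
have spsi : smooth U psi.
  by apply: smooth_pair => //; exact: smooth_st_inv.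
have rampY t : U t -> ramp c (Y t) = bt t.
  by move=> Ut; rewrite rampE /Y addrC addKr mulrC mulKf// step_invK.
(* The last condition keeps every sheet other than [j] and [k] away from the image of the chart. *)
pose O := U `&` [set t | B (X t, Y t) /\ V (st_inv (X t, Y t)) /\
  forall l, l != j -> l != k -> a l + bt t * d l != ht t].
pose W := [set v : 'rV[R]_3 * R | 0 < st_w v.1].
(* The components of the inverse of [psi], as functions on an open set of the ambient space; they
   prove that [psi] and its differential are injective. *)
pose F (i : 'I_3) (v : 'rV[R]_3 * R) : R :=
  [:: v.2 - a j - ramp c (st_y v.1) * d j;
      v.2 - a k - ramp c (st_y v.1) * d k; st_x v.1 - z0.1]`_i.
have F0 v : F 0 v = v.2 - a j - ramp c (st_y v.1) * d j by [].
have F1 v : F 1 v = v.2 - a k - ramp c (st_y v.1) * d k by [].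
have F2 v : F i2 v = st_x v.1 - z0.1 by [].
have oW : open W.
  rewrite (_ : W = (fun v => st_w v.1) @^-1` [set x | 0 < x]) //.
  apply: open_comp; last exact: open_gt.
  move=> v _; apply: (@continuous_comp _ _ _ fst st_w); first exact: cvg_fst.
  exact: continuous_st_w.
have sF i : smooth W (F i).
  have s1 : smooth W (fun v : 'rV[R]_3 * R => v.1) by exact: smooth_fst.
  have s2 : smooth W (fun v : 'rV[R]_3 * R => v.2) by exact: smooth_snd.
  have sr : smooth W (fun v : 'rV[R]_3 * R => ramp c (st_y v.1)).
    by apply: smooth_ramp => //; exact: smooth_st_y.
  case: (ord3P i) => ->.
  - apply: smoothB => //; first by apply: smoothB => //; exact: smooth_cst.
    by apply: smoothM => //; exact: smooth_cst.
  - apply: smoothB => //; first by apply: smoothB => //; exact: smooth_cst.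
    by apply: smoothM => //; exact: smooth_cst.
  - by apply: smoothB => //; [exact: smooth_st_x|exact: smooth_cst].
have Fpsi i t : U t -> F i (psi t) = t 0 i.
  move=> Ut; case: (ord3P i) => ->.
  - rewrite F0 /psi /= st_y_inv//= rampY// /ht; ring.
  - rewrite F1 /psi /= st_y_inv//= rampY// /ht /bt.
    by rewrite /D; field.
  - by rewrite F2 /psi /= st_x_inv//= /X; ring.
have Wpsi t : W (psi t) by exact: st_w_inv_gt0.
have oO : open O.
  rewrite openE => t [Ut [Bt [Vt lt]]].
  have cXY : {for t, continuous (fun t => (X t, Y t))}.
    exact: (continuous_pair (smooth_continuous sX Ut) (smooth_continuous sY Ut)).
  have n1 : \forall t' \near t, U t' by exact: open_nbhs_nbhs.
  have n2 : \forall t' \near t, B (X t', Y t').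
    by apply: (cXY B); exact: open_nbhs_nbhs.
  have n3 : \forall t' \near t, V (st_inv (X t', Y t')).
    have cS : {for t, continuous (fun t => st_inv (X t, Y t))}.
      apply: (@continuous_comp _ _ _ (fun t => (X t, Y t)) st_inv) => //.
      exact: continuous_st_inv.
    by apply: (cS V); exact: open_nbhs_nbhs.
  have n4 : \forall t' \near t, forall l, l != j -> l != k ->
      a l + bt t' * d l != ht t'.
    apply: (@filter_forall _ _ (fun l t' => l != j -> l != k ->
      a l + bt t' * d l != ht t') (nbhs t) (nbhs_filter t)) => l.
    have [->|lj] := eqVneq l j; first by near=> t'.
    have [->|lk] := eqVneq l k; first by near=> t'.
    have sg : smooth U (fun t => a l + bt t * d l - ht t).
      apply: smoothB => //; apply: smoothD => //; first exact: smooth_cst.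
      by apply: smoothM => //; [exact: sbt|exact: smooth_cst].
    have cg := smooth_continuous sg Ut.
    have g0 : [set x : R | x != 0] (a l + bt t * d l - ht t).
      by rewrite /= subr_eq0 lt.
    have n4 : \forall t' \near t, a l + bt t' * d l - ht t' != 0.
      exact: (cg _ (open_nbhs_nbhs (conj open_neq0 g0))).
    by near=> t' => _ _; rewrite -subr_eq0; near: t'.
  near=> t'; split; first by near: t'.
  split; first by near: t'.
  by split; near: t'.
have bt0 : bt 0 = r0.
  by rewrite /bt !mxE -[r0](mulfK D0) r0E; congr (_ / _); ring.
have U0 : U 0 by rewrite /U /= bt0.
have Y0 : Y 0 = z0.2.
  rewrite /Y bt0 /r0 rampE stepK; last exact: ramp_itv.
  by field.
have X0 : X 0 = z0.1 by rewrite /X mxE addr0.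
have h0E : ht 0 = h0.
  by rewrite /ht bt0 mxE add0r -Ej mixE.
have XY0 : (X 0, Y 0) = z0 by rewrite X0 Y0; case: (z0).
exists O, psi; split.
- split; last first.
    move=> t t' /set_mem[Ut _] /set_mem[Ut' _] E.
    by apply/rowP => i; rewrite -!Fpsi// E.
  split=> //; first by move=> i; apply: smooth_sub spsi _ => t [].
  move=> t [Ut _] v v' E; apply/rowP => i.
  have dE w : 'd (F i) (psi t) ('d psi t w) = w 0 i.
    apply: (diff_left_inverse (l := fun t : 'rV[R]_3 => t 0 i)).
    + by move=> x y z; rewrite !mxE.
    + exact: coord_continuous.
    + exact: smooth_differentiable spsi Ut.
    + exact: smooth_differentiable (sF i) (Wpsi t).
    + have : \forall y \near t, U y by exact: open_nbhs_nbhs.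
      by apply: filterS => y; exact: Fpsi.
  by rewrite -!dE E.
- split=> //; rewrite /= XY0; split=> //; split=> // l lj lk.
  by rewrite bt0 h0E; apply/eqP; exact: El.
- by rewrite /psi XY0 h0E.
(* The conditions of [O] expressed in the target, which make the image of the chart relatively open
   in [sphere * R]. *)
- pose P := [set v : 'rV[R]_3 * R | [/\ W v, V v.1, 0 < ramp c (st_y v.1) < 1,
     B (st_x v.1, st_y v.1) & forall l, l != j -> l != k ->
       a l + ramp c (st_y v.1) * d l != v.2]].
  exists P.
    rewrite openE => v [Wv Vv rv Bv lv].
    have s1 : smooth W (fun v : 'rV[R]_3 * R => v.1) by exact: smooth_fst.
    have s2 : smooth W (fun v : 'rV[R]_3 * R => v.2) by exact: smooth_snd.
    have sr : smooth W (fun v : 'rV[R]_3 * R => ramp c (st_y v.1)).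
      by apply: smooth_ramp => //; exact: smooth_st_y.
    have n1 : \forall v' \near v, W v' by exact: open_nbhs_nbhs.
    have n2 : \forall v' \near v, V v'.1.
      by apply: (smooth_continuous s1 Wv); exact: open_nbhs_nbhs.
    have n3 : \forall v' \near v, 0 < ramp c (st_y v'.1) < 1.
      have [r_gt0 r_lt1] := andP rv; have cr := smooth_continuous sr Wv.
      have m1 : \forall v' \near v, 0 < ramp c (st_y v'.1) by exact: (cvgr_gt _ cr).
      have m2 : \forall v' \near v, ramp c (st_y v'.1) < 1 by exact: (cvgr_lt _ cr).
      by near=> v'; apply/andP; split; [exact: (near m1 v')|exact: (near m2 v')].
    have n4 : \forall v' \near v, B (st_x v'.1, st_y v'.1).
      have cz : {for v, continuous (fun v => (st_x v.1, st_y v.1))}.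
        apply: (@continuous_comp _ _ _ fst (fun u => (st_x u, st_y u))).
          exact: cvg_fst.
        exact: continuous_st_z.
      by apply: (cz B); exact: open_nbhs_nbhs.
    have n5 : \forall v' \near v, forall l, l != j -> l != k ->
       a l + ramp c (st_y v'.1) * d l != v'.2.
      apply: (@filter_forall _ _ (fun l v' => l != j -> l != k ->
        a l + ramp c (st_y v'.1) * d l != v'.2) (nbhs v) (nbhs_filter v)) => l.
      have [->|lj] := eqVneq l j; first by near=> t'.
      have [->|lk] := eqVneq l k; first by near=> t'.
      have sg : smooth W (fun v => a l + ramp c (st_y v.1) * d l - v.2).
        apply: smoothB => //; apply: smoothD => //; first exact: smooth_cst.
        by apply: smoothM => //; exact: smooth_cst.
      have cg := smooth_continuous sg Wv.
      have g0 : [set x : R | x != 0] (a l + ramp c (st_y v.1) * d l - v.2).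
        by rewrite /= subr_eq0 lv.
      have n5 : \forall v' \near v, a l + ramp c (st_y v'.1) * d l - v'.2 != 0.
        exact: (cg _ (open_nbhs_nbhs (conj open_neq0 g0))).
      by near=> v' => _ _; rewrite -subr_eq0; near: v'.
    by near=> v'; split; near: v'.
  apply/seteqP; split=> [_ [t [Ut [Bt [Vt lt]]] <-]|[u h] [[/= Wv Vv rv Bv lv] [uS _]]].
    have yE : st_y (psi t).1 = Y t by rewrite /= st_y_inv.
    have xE : st_x (psi t).1 = X t by rewrite /= st_x_inv.
    split; last by split=> //=; exact: st_inv_sphere.
    split=> //; first by rewrite yE rampY.
    - by rewrite yE xE.
    - by rewrite yE rampY.
  pose r := ramp c (st_y u).
  pose t : 'rV[R]_3 := \row_i F i (u, h).
  have t0E : t 0 0 = h - a j - r * d j by rewrite mxE F0.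
  have t1E : t 0 1 = h - a k - r * d k by rewrite mxE F1.
  have t2E : t 0 i2 = st_x u - z0.1 by rewrite mxE F2.
  have btE : bt t = r by rewrite /bt t0E t1E /D; field.
  have YE : Y t = st_y u.
    by rewrite /Y btE /r rampE stepK; [field|exact: ramp_itv].
  have XE : X t = st_x u by rewrite /X t2E; ring.
  have hE : ht t = h by rewrite /ht btE t0E; ring.
  exists t; last by rewrite /psi XE YE hE st_invK.
  split; first by rewrite /U /= btE.
  by rewrite /= XE YE st_invK// hE btE; split.
- move=> t [Ut [Bt [Vt lt]]].
  have BVt : (B `&` st_inv @^-1` V) (X t, Y t) by [].
  have HT l : G (s l (X t, Y t)) = a l + bt t * d l.
    by have [-> _] := GH _ l BVt; rewrite /= rampY.
  have E0 : t 0 0 = ht t - (a j + bt t * d j) by rewrite /ht; ring.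
  have E1 : t 0 1 = ht t - (a k + bt t * d k).
    have : bt t * D = t 0 0 - t 0 1 - (a k - a j) by rewrite /bt mulfVK.
    by rewrite /ht /D => E; lra.
  rewrite /double_model /=; split.
    move=> [m Am [qm Gm]].
    have [l lE] := sheets_surj S Bt qm.
    have lh : a l + bt t * d l = ht t by rewrite -HT lE Gm.
    have [lj|lj] := eqVneq l j; first by rewrite E0 -lj lh subrr mul0r.
    have [lk|lk] := eqVneq l k; first by rewrite E1 -lk lh subrr mulr0.
    by have := lt l lj lk; rewrite lh eqxx.
  have [_ qs _] := S.
  have inS l : a l + bt t * d l = ht t ->
      ((fun m => (q m, G m)) @` A) (psi t).
    move=> lh; exists (s l (X t, Y t)); first by rewrite /A /= qs.
    by rewrite /psi -lh -HT qs.
  move=> /eqP; rewrite mulf_eq0 => /orP[]/eqP.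
    by rewrite E0 => /subr0_eq/esym; exact: inS.
  by rewrite E1 => /subr0_eq/esym; exact: inS.
Unshelve. all: by end_near. Qed.

(** Only the double point alternative occurs. Where the ramp is 0 or 1 injectivity of the labels
    excludes any crossing, and strictly in between [no_triple_crossing] leaves just two sheets. *)
Lemma general_position_of_3d : general_position_3d q A (fun m => (q m, G m)).
Proof.
split; first exact: immersion_3d.
move=> y [m1 [m2 [A1 A2 m12 y1 y2]]]; left.
have [B [s [c [pi [pi' [[oB Bz] S pi_inj pi'_inj GH]]]]]] := V_sheets A1.
set z0 := (_, _) in Bz.
have invq : st_inv z0 = q m1 by apply: st_invK => //; exact: V_w.
have Vz0 : V (st_inv z0) by rewrite invq.
have BV : (B `&` st_inv @^-1` V) z0 by [].
move: y1 y2; case: y => u h [qu1 Gh1] [qu2 Gh2].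
have uE : u = st_inv z0 by rewrite invq.
pose r := ramp c z0.2.
have lab m : q m = u -> G m = h -> exists2 l, s l z0 = m &
    mix r (lev (pi l)) (lev (pi' l)) = h.
  move=> qm Gm; have [l lm] : exists l, s l z0 = m.
    by apply: sheets_surj S Bz _; rewrite qm uE.
  by exists l => //; have [<- _] := GH _ l BV; rewrite lm.
have [j jm Ej] := lab m1 qu1 Gh1.
have [k km Ek] := lab m2 qu2 Gh2.
have jk : j != k.
  by apply/eqP => jk; apply: m12; rewrite -jm -km jk.
have r01 : 0 < r < 1.
  have r_ge0 : 0 <= r by exact: step_ge0.
  have r_le1 : r <= 1 by exact: step_le1.
  rewrite !lt_neqAle r_ge0 r_le1 !andbT; apply/andP; split; apply/eqP => r0.
    have := etrans Ej (esym Ek); rewrite /mix -r0 !mul0r !addr0.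
    by move=> /lev_inj/ord_inj/pi_inj jk'; rewrite jk' eqxx in jk.
  have := etrans Ej (esym Ek).
  rewrite /mix r0 !mul1r ![lev (pi _) + _]addrC !subrK.
  by move=> /lev_inj/ord_inj/pi'_inj jk'; rewrite jk' eqxx in jk.
have El l : l != j -> l != k -> mix r (lev (pi l)) (lev (pi' l)) <> h.
  move=> lj lk E.
  have neq (x y : 'I_n) : x != y -> (pi x : nat) != pi y.
    by apply: contra_neq => /ord_inj/pi_inj.
  exact: (no_triple_crossing r01 (neq _ _ lj) (neq _ _ lk) (neq _ _ jk)
    (etrans E (esym Ej)) (etrans Ej (esym Ek))).
split.
  rewrite (_ : A `&` _ = [set m1; m2]); first exact: card_set2_II.
  apply/seteqP; split=> [m [Am [qm Gm]]|m [->|->]]; last 2 first.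
  - by split=> //=; rewrite qu1 Gh1.
  - by split=> //=; rewrite qu2 Gh2.
  have [l lm E] := lab m qm Gm.
  have [lj|lj] := eqVneq l j; first by left; rewrite -lm lj jm.
  have [lk|lk] := eqVneq l k; first by right; rewrite -lm lk km.
  by exfalso; exact: El E.
rewrite uE.
exact: (crossing_model oB S pi_inj GH Bz Vz0 jk r01 Ej Ek El).
Qed.

End sheeted_heights.

(** * The choice of constants and the cutoff near the branch set *)

Section cutoff.
Context {R : realType}.

Lemma avoid_finite (J : finType) (f : J -> R) : exists x, forall j, x <> f j.
Proof.
exists (1 + \sum_j `|f j|) => j; apply/eqP; rewrite gt_eqF//.
rewrite (le_lt_trans (ler_norm _))// (bigD1 j)//=.
by rewrite addrCA ltrDl ltr_pwDl// sumr_ge0.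
Qed.

Lemma below_finite (J : finType) (f : J -> R) : (forall j, 0 < f j) ->
  exists2 d, 0 < d & forall j, d < f j.
Proof.
move=> f0; have [m0 mf] : 0 < \big[Num.min/1]_j f j /\
    forall j, \big[Num.min/1]_j f j <= f j.
  by split; [apply/bigmin_gtP|move=> j; exact: bigmin_le].
exists ((\big[Num.min/1]_j f j) / 2) => [|j]; first by rewrite divr_gt0.
by rewrite (lt_le_trans _ (mf j))// ltr_pdivrMr// ltr_pMr// ltr1n.
Qed.

Lemma continuous_bigmin (T : topologicalType) (J : finType) (g : T -> R)
    (f : J -> T -> R) : continuous g -> (forall j, continuous (f j)) ->
  continuous (fun x => \big[Num.min/g x]_j f j x).
Proof.
move=> cg cf; rewrite unlock; elim: (index_enum J) => [|j r IH] //=.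
by move=> x; apply: (@continuous_min _ _ (f j)); [exact: cf|exact: IH].
Qed.

Lemma continuous_truncation (T : topologicalType) (f : T -> R) x :
  {for x, continuous f} ->
  {for x, continuous (fun x => Num.max 0 (Num.min 1 (f x)))}.
Proof.
move=> cf; apply: continuous_max; first exact: cst_continuous.
by apply: continuous_min; [exact: cst_continuous|exact: cf].
Qed.

End cutoff.

Theorem theorem1 (R : realType) (k n b : nat)
    (hk : (1 <= k)%N) (hn : n = (2 * k + 1)%N) (hb : (1 < b)%N)
    (p : 'I_b -> 'rV[R]_3) (p_inj : injective p)
    (p_sphere : forall i, sphere (p i))
    (rho : 'I_b -> R) (rho_gt0 : forall i, 0 < rho i)
    (disks_disjoint : forall i j, i != j ->
       cap (p i) (rho i) `&` cap (p j) (rho j) = set0)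
    (x0 : exterior p rho)
    (phi : {multiplicative pi1 R x0 -> [subg dihedral n]})
    (M : topologicalType) (q : M -> 'rV[R]_3)
    (M_cover : branched_cover phi q) :
  exists f : M -> 'rV[R]_3 * (R * R),
    [/\ immersed_braiding q n p rho f,
        continuous f,
        immersion_on q (q @^-1` exterior p rho) f &
        forall m, (f m).1 = q m].
Proof.
have [hM cq qS q_cov _ q_fill] := M_cover.
(* The dummy value for sheets over empty sets; it exists because [n > 0]. *)
have [m0 _] : exists m0 : M, True.
  have [_ _ [s _]] := q_cov _ (set_valP x0).
  have n0 : (0 < n)%N by rewrite hn addn1.
  by exists (s (Ordinal n0) (set_val x0)).
pose ib : 'I_b := Ordinal hb.
pose N := p ib; have NS : sphere N := p_sphere ib.
have [e1 [e2 [[h11 h22 h12 h1N h2N] frameE]]] := orthonormal_frame NS.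
pose J := {i : 'I_b | i != ib}.
pose P (i : J) := p (val i).
have PS i : sphere (P i) by exact: p_sphere.
have P_inj : injective P by move=> i j /p_inj/val_inj.
have w_gt0 u : sphere u -> u <> N -> 0 < st_w N u by exact: st_w_gt0.
have Pw i : 0 < st_w N (P i).
  by apply: w_gt0 => // /p_inj E; have := valP i; rewrite E eqxx.
pose xs i := st_x N e1 (P i).
(* Two heights [ys] coincide over distinct [xs] for exactly one slope, the quotient below. For equal
   [xs] the quotient is 0, a harmless extra value to avoid, since then distinct points already
   differ in height. *)
have [tau tau_avoid] := @avoid_finite R (J * J)%type (fun ij =>
  (st_y N e1 e2 0 (P ij.1) - st_y N e1 e2 0 (P ij.2)) / (xs ij.2 - xs ij.1)).
pose ys i := st_y N e1 e2 tau (P i).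
have ysE i : ys i = st_y N e1 e2 0 (P i) + tau * xs i.
  by rewrite /ys /st_y mul0r addr0.
have PE i : st_inv N e1 e2 tau (xs i, ys i) = P i by exact: st_invK.
have ys_inj i j : i != j -> ys i != ys j.
  move=> ij; apply/eqP => yij.
  have [xij|xij] := eqVneq (xs i) (xs j).
    by move/eqP: ij; apply; apply: P_inj; rewrite -!PE yij xij.
  apply: (tau_avoid (i, j)) => /=.
  have xji : xs j - xs i != 0 by rewrite subr_eq0 eq_sym.
  apply: (mulIf xji); rewrite mulfVK//.
  by move: yij; rewrite !ysE => E; lra.
(* Each cap contains a box around its puncture in the plane, so points of the exterior stay outside
   these boxes. *)
have near_box i : exists2 e, 0 < e & forall z, `|z.1 - xs i| < e ->
    `|z.2 - ys i| < e ->
    Defs.edist (P i) (st_inv N e1 e2 tau z) < rho (val i).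
  have cE : {for (xs i, ys i), continuous
      (fun z => Defs.edist (P i) (st_inv N e1 e2 tau z))}.
    apply: (@continuous_comp _ _ _ (st_inv N e1 e2 tau) (Defs.edist (P i))).
      exact: continuous_st_inv.
    exact: continuous_edist.
  have E0 : Defs.edist (P i) (st_inv N e1 e2 tau (xs i, ys i)) < rho (val i).
    by rewrite PE edistxx.
  have : \forall z \near (xs i, ys i),
      Defs.edist (P i) (st_inv N e1 e2 tau z) < rho (val i).
    exact: (cvgr_lt _ cE _ E0).
  move=> /nbhs_ballP[e /= e0 eH]; exists e => // z z1 z2.
  by apply: eH; split; rewrite /ball /= distrC.
have /choice[bx bxE] : forall i, exists e, 0 < e /\ forall z, `|z.1 - xs i| < e ->
    `|z.2 - ys i| < e ->
    Defs.edist (P i) (st_inv N e1 e2 tau z) < rho (val i).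
  by move=> i; have [e e0 He] := near_box i; exists e.
have [dl0 dl00 dl0bx] := below_finite (fun i => (bxE i).1).
(* The diagonal gets the dummy value 1 to keep the minimum positive. *)
have ys_pos (ij : J * J) : 0 < if ij.1 == ij.2 then 1 else `|ys ij.1 - ys ij.2|.
  by case: eqVneq => // ij'; rewrite normr_gt0 subr_eq0 ys_inj.
have [dl1 dl10 dl1ys] := below_finite ys_pos.
(* With this choice [4 * dl] is below all box sizes and all gaps: the strips are disjoint, and the
   boxes of half-side [2 * dl] lie inside the caps. *)
pose dl := Num.min dl0 dl1 / 4.
have m01 : 0 < Num.min dl0 dl1 by rewrite lt_min dl00.
have dl_gt0 : 0 < dl by rewrite divr_gt0.
have dl4 : 4 * dl = Num.min dl0 dl1 by rewrite /dl; field.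
have dl_bx i : 2 * dl < bx i.
  have : 4 * dl <= dl0 by rewrite dl4 ge_min lexx.
  by have := dl0bx i; lra.
have ys_gap i j : i != j -> 4 * dl < `|ys i - ys j|.
  move=> ij; have := dl1ys (i, j); rewrite /= (negPf ij).
  by apply: le_lt_trans; rewrite dl4 ge_min lexx orbT.
(* On the exterior [st_w] is at least [rho ib ^+ 2 / 2], which is [2 * eta]; the factor 2 leaves
   room for the cutoff. *)
pose eta := rho ib ^+ 2 / 4.
have eta_gt0 : 0 < eta by rewrite divr_gt0// exprn_gt0.
pose S := \sum_i (`|xs i| + `|ys i|).
have S_ge i : `|xs i| + `|ys i| <= S.
  by rewrite /S (bigD1 i)//= lerDl sumr_ge0// => j _; rewrite addr_ge0.
have S_ge0 : 0 <= S by rewrite sumr_ge0// => j _; rewrite addr_ge0.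
(* If [st_w > eta], then [st_den < 2 / eta] bounds [z.1] and [z.2 - tau * z.1], hence [z.2] by the
   first summand. The other summands make room for the punctures and their strips. *)
pose X := 2 / eta * (1 + `|tau|) + S + dl.
have eta2 : 0 < 2 / eta by rewrite divr_gt0.
have X0 : 0 <= 2 / eta * (1 + `|tau|) by rewrite mulr_ge0// ?ltW// addr_ge0.
have q_loc z : (forall i, z <> (xs i, ys i)) ->
    locally_sheeted q n (st_inv N e1 e2 tau) z.
  move=> zP; have uS := st_inv_sphere tau NS h11 h22 h12 h1N h2N frameE z.
  have wz := st_w_inv_gt0 tau NS h1N h2N z.
  have uP i : st_inv N e1 e2 tau z <> p i.
    have [->|iN] := eqVneq i ib.
      by move=> E; move: wz; rewrite E /st_w (NS : dotp N N = 1) subrr ltxx.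
    move=> E; apply: (zP (exist _ i iN)); rewrite /xs /ys /P /= -E.
    by rewrite st_x_inv// st_y_inv//; case: (z).
  have [U [oU Uz] [s Ss]] := sphere_locally_sheeted hM p_sphere rho_gt0
    disks_disjoint hb q_cov q_fill uS uP.
  exists (st_inv N e1 e2 tau @^-1` U).
    split=> //; apply: open_comp oU => x _; exact: continuous_st_inv.
  exists (fun i => s i \o st_inv N e1 e2 tau).
  apply: sheets_pullback Ss.
    exact/continuous_subspaceT/continuous_st_inv.
  by move=> x Ux; split=> //; exact: st_inv_sphere.
have [G0 [H0 [G01 H01 GH0]]] : exists G H : M -> R,
  [/\ forall m, 0 <= G m <= 1, forall m, 0 <= H m <= 1 &
  forall z0, `|z0.1| < X -> `|z0.2| < X ->
    (forall i, `|z0.2 - ys i| <= dl -> dl < `|z0.1 - xs i|) ->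
    exists (B : set (R * R)) s c (pi pi' : 'I_n -> 'I_n),
      [/\ open B /\ B z0, sheets q (st_inv N e1 e2 tau) B s,
        injective pi, injective pi' &
        sheet_formula dl G H B s c pi pi']].
  apply: (exists_heights hM m0) => //.
  - exact: st_inv_inj.
  - by move=> i; have := S_ge i; have := normr_ge0 (ys i); rewrite /X; lra.
  - by move=> i; have := S_ge i; have := normr_ge0 (xs i); rewrite /X; lra.
  - by rewrite /X; lra.
(* The sup distance to the puncture in the plane, multiplied by [st_w] so that it is defined and
   continuous everywhere, even at [N]. *)
pose bxd i u := Num.max `|dotp u e1 - xs i * st_w N u|
  `|dotp u (e2 + tau *: e1) - ys i * st_w N u|.
have bxdE i u : 0 < st_w N u -> bxd i u =
    Num.max `|st_x N e1 u - xs i| `|st_y N e1 e2 tau u - ys i| * st_w N u.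
  move=> w0; have wn0 : st_w N u != 0 by rewrite gt_eqF.
  rewrite maxr_pMl ?ltW// /bxd; congr Num.max.
    by rewrite -[X in _ = _ * X]ger0_norm ?ltW// -normrM /st_x; congr `|_|; field.
  rewrite -[X in _ = _ * X]ger0_norm ?ltW// -normrM /st_y /st_x dotpDr dotpZr.
  by congr `|_|; field.
(* The heights are constructed over [psi > 0]; the branch points have [psi <= 0]
   and the exterior has [psi > eps]. *)
pose psi u := \big[Num.min/st_w N u - eta]_(i : J) (bxd i u - dl * st_w N u).
have psi_gtP t u : (t < psi u) <->
    t < st_w N u - eta /\ forall i, t < bxd i u - dl * st_w N u.
  split=> [/bigmin_gtP[h1 h2]|[h1 h2]]; first by split=> // i; exact: h2.
  by apply/bigmin_gtP; split=> // i _; exact: h2.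
have cw := continuous_st_w (N := N).
have cpsi : continuous psi.
  apply: continuous_bigmin.
    by move=> u; apply: (@continuousB R R 'rV[R]_3 (st_w N) (fun=> eta));
      [exact: cw|exact: cst_continuous].
  move=> i u.
  have cc (a : 'rV[R]_3) (t : R) : {for u, continuous
      (fun u => `|dotp u a - t * st_w N u|)}.
    apply: (@continuous_comp _ _ _ (fun u => dotp u a - t * st_w N u)
      (fun y : R => `|y|)); last exact: norm_continuous.
    apply: (@continuousB R R 'rV[R]_3 (fun u => dotp u a) (fun u => t * st_w N u)).
      exact: continuous_dotp.
    by apply: (@continuousM R 'rV[R]_3 (fun=> t) (st_w N));
      [exact: cst_continuous|exact: cw].
  apply: (@continuousB R R 'rV[R]_3 (bxd i) (fun u => dl * st_w N u)).
    apply: continuous_max; exact: cc.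
  by apply: (@continuousM R 'rV[R]_3 (fun=> dl) (st_w N));
    [exact: cst_continuous|exact: cw].
(* On the exterior [st_w - eta] is at least [eta], and the other terms of [psi] are at least
   [dl * (2 * eta)]; halving the minimum makes the bound strict. *)
pose eps := Num.min eta (2 * dl * eta) / 2.
have mm0 : 0 < Num.min eta (2 * dl * eta) by rewrite lt_min eta_gt0 !mulr_gt0.
have eps_gt0 : 0 < eps by rewrite divr_gt0.
have eps1 : eps < eta.
  have : 2 * eps <= eta by rewrite /eps mulrC divfK// ge_min lexx.
  lra.
have eps2 : eps < 2 * dl * eta.
  have : 2 * eps <= 2 * dl * eta by rewrite /eps mulrC divfK// ge_min lexx orbT.
  lra.
have psi_ext u : exterior p rho u -> eps < psi u.
  move=> /exteriorP[uS uP]; apply/psi_gtP.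
  have w2 : 2 * eta <= st_w N u.
    have : rho ib ^+ 2 <= Defs.edist N u ^+ 2.
      by rewrite lerXn2r ?nnegrE ?edist_ge0 ?(ltW (rho_gt0 ib))// uP.
    by rewrite edist_sphere// dotpC /eta /st_w; lra.
  have w0 : 0 < st_w N u by lra.
  split; first by lra.
  move=> i; rewrite bxdE// -mulrBl.
  have : 2 * dl <= Num.max `|st_x N e1 u - xs i| `|st_y N e1 e2 tau u - ys i|.
    rewrite leNgt; apply/negP; rewrite gt_max => /andP[zx zy].
    have := (bxE i).2 (st_x N e1 u, st_y N e1 e2 tau u)
      (lt_trans zx (dl_bx i)) (lt_trans zy (dl_bx i)).
    by rewrite st_invK// ltNge uP.
  set mx := Num.max _ _ => mx2.
  have mx1 : dl <= mx - dl by lra.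
  have eta0 : 0 <= 2 * eta by lra.
  apply: (lt_le_trans eps2); rewrite -[2 * dl * eta]mulrA mulrCA.
  exact: ler_pM (ltW dl_gt0) eta0 mx1 w2.
have psi_p i : psi (p i) <= 0.
  rewrite leNgt; apply/negP => /psi_gtP[h1 h2].
  have [iN|iN] := eqVneq i ib.
    by move: h1; rewrite iN /st_w (NS : dotp N N = 1); lra.
  have := h2 (exist _ i iN); rewrite bxdE; last exact: (Pw (exist _ i iN)).
  rewrite !subrr normr0 maxxx mul0r add0r oppr_gt0 => h.
  have := mulr_gt0 dl_gt0 (Pw (exist _ i iN)).
  by rewrite ltNge (ltW h).
have psi_good m : 0 < psi (q m) -> 0 < st_w N (q m) /\
    exists (B : set (R * R)) s c (pi pi' : 'I_n -> 'I_n),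
      [/\ open B /\ B (st_x N e1 (q m), st_y N e1 e2 tau (q m)),
        sheets q (st_inv N e1 e2 tau) B s,
        injective pi, injective pi' &
        sheet_formula dl G0 H0 B s c pi pi'].
  move=> /psi_gtP[h1 h2]; have w1 : eta < st_w N (q m) by lra.
  have w0 : 0 < st_w N (q m) by lra.
  split=> //; have := st_denE tau frameE (qS m) w0.
  set z := (_, _) => denE.
  have den_lt : st_den tau z < 2 / eta.
    by rewrite denE ltr_pM2l// ltf_pV2.
  have sq_le (x y : R) : `|x| <= x * x + y * y + 1.
    by rewrite ler_norml; apply/andP; split; nra.
  have zx : `|z.1| < 2 / eta by apply: le_lt_trans den_lt; exact: sq_le.
  have zy' : `|z.2 - tau * z.1| < 2 / eta.
    apply: le_lt_trans den_lt.
    by rewrite /st_den [_ * _ + _]addrC; exact: sq_le.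
  have zy : `|z.2| < 2 / eta * (1 + `|tau|).
    rewrite -[z.2](subrK (tau * z.1)) (le_lt_trans (ler_normD _ _))//.
    by rewrite mulrDr mulr1 ltr_leD// normrM mulrC ler_wpM2r// ltW.
  apply: GH0.
  - rewrite /X; apply: lt_le_trans zx _.
    have : 0 <= 2 / eta * `|tau| by rewrite mulr_ge0// ltW.
    by rewrite mulrDr mulr1; lra.
  - by rewrite /X; lra.
  - move=> i zi; have := h2 i; rewrite bxdE// -mulrBl pmulr_lgt0//.
    by rewrite subr_gt0 lt_max -/z => /orP[//|]; rewrite ltNge zi.
(* This cutoff is merely continuous, but it is constantly 1 where [psi > eps], so the smooth
   formulas hold unchanged there. *)
pose chi u := Num.max 0 (Num.min 1 (psi u / eps)).
have chi01 u : 0 <= chi u <= 1.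
  by rewrite /chi le_max lexx ge_max ler01 ge_min lexx.
have chi1 u : eps < psi u -> chi u = 1.
  move=> h; rewrite /chi (min_idPl _) ?(max_idPr _)//.
  by rewrite ler_pdivlMr// mul1r ltW.
have chi0 u : psi u <= 0 -> chi u = 0.
  move=> h; apply: max_idPl; rewrite ge_min; apply/orP; right.
  by rewrite ler_pdivrMr// mul0r.
have cchi : continuous chi.
  move=> u; have cpe : {for u, continuous (fun u => psi u / eps)}.
    by apply: (@continuousM R 'rV[R]_3 psi (fun=> eps^-1)); [exact: cpsi|exact: cst_continuous].
  exact: (continuous_truncation cpe).
have open_psi t : open [set u | t < psi u].
  rewrite (_ : [set u | _] = psi @^-1` [set x | t < x]) //.
  by apply: open_comp; [move=> x _; exact: cpsi|exact: open_gt].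
have cG0 m : 0 < psi (q m) -> {for m, continuous G0} /\ {for m, continuous H0}.
  move=> m_pos.
  have w' m' : [set u | 0 < psi u] (q m') -> 0 < st_w N (q m').
    by move=> /psi_good[].
  apply: (continuous_heights (n := n) (tau := tau) (dl := dl) frameE hM cq qS (open_psi 0) w') => //.
  move=> m' /psi_good[_ [B [s [c [pi [pi' [hB Ss pi_inj pi'_inj F]]]]]]].
  by exists B, s, c, pi, pi'; split=> // z j [Bz _]; exact: F.
pose G m := chi (q m) * G0 m; pose H m := chi (q m) * H0 m.
have cut (h : M -> R) : (forall m, 0 <= h m <= 1) ->
    (forall m, 0 < psi (q m) -> {for m, continuous h}) ->
    continuous (fun m => chi (q m) * h m) /\
    forall m, 0 <= chi (q m) * h m <= 1.
  move=> h01 ch; split=> m; last first.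
    have /andP[? ?] := h01 m; have /andP[? ?] := chi01 (q m).
    by rewrite mulr_ge0// mulr_ile1.
  have cchiq : {for m, continuous (chi \o q)}.
    by apply: continuous_comp; [exact: cq|exact: cchi].
  have [m0'|m_pos] := leP (psi (q m)) 0; last first.
    by apply: (@continuousM R M (chi \o q) h) => //; exact: ch.
  (* Here [h] is only known to lie in [[0, 1]]; the product is squeezed between 0 and [chi], which
     tends to 0. *)
  rewrite /prop_for /continuous_at chi0// mul0r.
  have cc0 : (chi \o q) x @[x --> m] --> (0 : R).
    by have := cchiq; rewrite /prop_for /continuous_at /= chi0.
  have le_h : \forall x \near m, 0 <= chi (q x) * h x <= (chi \o q) x.
    near=> x; have /andP[? ?] := h01 x; have /andP[? ?] := chi01 (q x).
    by rewrite mulr_ge0//= ler_piMr.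
  have c00 : (fun=> 0 : R) @ m --> (0 : R) by exact: cvg_cst.
  exact: (squeeze_cvgr le_h c00 cc0).
have [cG G_01] := cut G0 G01 (fun m h => (cG0 m h).1).
have [cH H_01] := cut H0 H01 (fun m h => (cG0 m h).2).
pose V := [set u | eps < psi u].
have V_w m : V (q m) -> 0 < st_w N (q m).
  by move=> Vm; have [] := psi_good m (lt_trans eps_gt0 Vm).
have V_sheets m : V (q m) -> exists B s c (pi pi' : 'I_n -> 'I_n),
    [/\ open B /\ B (st_x N e1 (q m), st_y N e1 e2 tau (q m)),
      sheets q (st_inv N e1 e2 tau) B s, injective pi, injective pi' &
      sheet_formula dl G H (B `&` st_inv N e1 e2 tau @^-1` V) s c pi pi'].
  move=> Vm; have [_ [B [s [c [pi [pi' [hB Ss pi_inj pi'_inj F]]]]]]] :=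
    psi_good m (lt_trans eps_gt0 Vm).
  exists B, s, c, pi, pi'; split=> // z j [Bz Vz].
  have [_ qs _] := Ss; have [<- <-] := F z j Bz.
  by rewrite /G /H qs// chi1// !mul1r.
have gp3 := general_position_of_3d NS h11 h22 h12 h1N h2N frameE hM cq qS dl_gt0
  (open_psi eps) V_w V_sheets.
have gp4 := general_position_of_4d frameE hM cq qS (open_psi eps) V_w V_sheets.
have VE : ~` [set u | psi u <= eps] = V.
  by apply/seteqP; split=> u /=; rewrite /V /= ltNge => /negP.
have away (Q : set M -> Prop) : Q (q @^-1` V) -> away_from_branching q p rho Q.
  (* The removed set contains the branch points in its interior because [psi <= 0 < eps] there, and
     it misses the exterior by [psi_ext]. *)
  move=> QV; exists [set u | psi u <= eps]; split.
  - by rewrite -[X in closed X]setCK VE; apply: open_closedC; exact: open_psi.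
  - move=> _ [i _ <-].
    have h : psi (p i) < eps by rewrite (le_lt_trans (psi_p i)).
    have : \forall u \near p i, psi u < eps by exact: (cvgr_lt _ (cpsi (p i)) _ h).
    by apply: filterS => u /ltW.
  - apply/seteqP; split=> // u [/= h1 /psi_ext]; by rewrite ltNge h1.
  - by rewrite VE.
pose f m : 'rV[R]_3 * (R * R) := (q m, (G m, H m)).
have cf : continuous f.
  move=> m; apply: continuous_pair; first exact: cq.
  by apply: continuous_pair; [exact: cG|exact: cH].
exists f; split=> //.
  split=> //.
  - split=> //=.
    + by move=> m; apply: continuous_pair; [exact: cq|exact: cG].
    + move=> m /=; have /andP[h0 h] := G_01 m; rewrite h0 /=.
      by rewrite (le_trans h)// ler1n.
    + exact: away.
  - move=> m /=; have /andP[h0 h] := H_01 m; rewrite h andbT.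
    by rewrite (le_trans _ h0)// lerN10.
  - exact: away.
have [[A [oA VA im]] _] := gp4.
exists A; split=> // m /psi_ext Vm; exact: VA.
Unshelve. all: by end_near. Qed.
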